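(* Let $p_1,\ldots,p_k$ be rationally independent integer polynomials with $p_i(0)=0$ for $i=1,\ldots,k$. For every $\delta>0$ and $\varepsilon>0$ there exists $N(\varepsilon,\delta)$ such that for all $N>N(\varepsilon,\delta)$ and every set of integers $\Lambda\subset[1,N]$ with $|\Lambda|\geq\delta N$, there exists $n\in\mathbb{N}$ such that $\Lambda$ contains at least $(1-\varepsilon)\delta^{k+1}N$ configurations of the form $\{x,x+p_1(n),\ldots,x+p_k(n)\}$ with this same fixed $n$; that is, there are at least $(1-\varepsilon)\delta^{k+1}N$ integers $x$ with $x,x+p_1(n),\ldots,x+p_k(n)\in\Lambda$.
   Context: $\mathbb{N}=\{1,2,\ldots\}$. An integer polynomial is a polynomial taking integer values on the integers. A family $p_1,\ldots,p_k$ of integer polynomials is rationally independent if every nontrivial integer combination of them is not constant. The integer $n$ may depend on $\Lambda$ and $N$. *)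

(* Defs.v *)
From HB Require Import structures.
From mathcomp Require Import all_boot all_order all_algebra.
From mathcomp Require Import finmap reals.

Set Implicit Arguments.
Unset Strict Implicit.
Unset Printing Implicit Defensive.

Import Order.TTheory GRing.Theory Num.Theory.
Local Open Scope ring_scope.

Definition integer_poly (R : realType) (p : {poly R}) : Prop :=
  forall m : int, p.[m%:~R] \is a Num.int.

Definition rationally_independent (R : realType) (k : nat)
    (p : 'I_k -> {poly R}) : Prop :=
  forall c : 'I_k -> int, (exists i, c i != 0) ->
    forall a : R, \sum_(i < k) p i *~ c i <> a%:P.

(* The value p(m) as an element of int.  For an integer polynomial p.[m%:~R] is
   an integer, so taking the floor loses nothing. *)
Definition int_value (R : realType) (p : {poly R}) (m : int) : int :=
  Num.floor p.[m%:~R].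

(* The condition x \in L belongs to the configuration
   {x, x + p_1(n), ..., x + p_k(n)}; it also bounds x, so that the set of all
   integers x to be counted is finite. *)
Definition config_starts (R : realType) (k : nat) (p : 'I_k -> {poly R})
    (L : {fset int}) (n : nat) : {fset int} :=
  [fset x : int in L | [forall i : 'I_k, (x + int_value (p i) n%:Z)%R \in L]]%fset.

(* Main.v *)
Require Import Defs.
From mathcomp Require Import all_boot all_order all_algebra.
From mathcomp Require Import finmap reals.
From mathcomp Require Import boolp classical_sets functions filter topology normedtype.
From mathcomp Require Import cyclic separable cyclotomic complex.
From mathcomp Require Import zify ring lra.

Set Implicit Arguments.
Unset Strict Implicit.
Unset Printing Implicit Defensive.

Import Order.TTheory GRing.Theory Num.Theory.
Local Open Scope ring_scope.
Import Normc.
Local Open Scope complex_scope.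
Local Notation Re := complex.Re.
Local Notation Im := complex.Im.
Local Notation "z ^J" := (conjc z) (at level 2, format "z ^J").

(** Suppose that the theorem fails for some [delta] and [epsilon]. Counterexamples on
    longer and longer intervals, averaged along an ultrafilter, give a finitely
    additive measure on [nat * int] that is invariant under translations of the
    integer, a set of measure at least [delta], and no good return time at all. All
    limits below are taken in the same way: a [mean] is a finitely additive
    probability, a [system] is a set with an action of the integers preserving a
    mean, and limits, products and iterated averages of systems are systems. No
    measurability is involved, hence every function is available.

    Let [f] be the indicator function of the set. The elements of small norm in the
    convex hulls of the translates of [f] by multiples of [t!] converge, as [t]
    grows, to a function [W] that is almost invariant under translations by
    multiples of large factorials ([near_minimizers], [w_limit_almost_invariant]).
    If every [p i] is integral without constant term, its values at multiples of
    [t!] are divisible by [t!]; so the average of the product of [f] with the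
    translates of [W] by [p 1 n, ..., p k n] is nearly that of [f * W ^ k] for these
    [n], and by convexity this is at least the mean of [f] to the power [k + 1]
    ([w_limit_power]). It remains to replace [W] by [f] in each factor
    ([telescoping]). Whatever the step, the averages of [f - W] along progressions of
    suitable length are small ([w_difference_small]). So it suffices that every
    function contributing to multiple averages along independent polynomials has
    averages bounded below along the progressions of some step, whatever their
    length. This is [progression_average].

    For its proof, consider averages over [n] of the correlations of [f0] and of
    translates of functions [f i] by [p i n], multiplied by phases [l ^ q n] with
    [l] an invariant function of modulus one; all polynomials together are
    independent. If such averages do not tend to zero, one function after the other
    is replaced by an eigenfunction, which turns it into a phase
    ([eigen_extension]). Once all of them are gone, Weyl's equidistribution theorem
    ([weyl_family]) shows that the eigenvalues [l] are almost rational with positive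
    probability ([rational_eigenvalues_all]).

    To replace [f i], first exchange it for the limit of the averages with which it
    correlates ([dual_limit]). This dual function still correlates with them, so
    van der Corput's inequality and induction on the exponents ([pet]) bound below
    its box norms of some dimension, at every scale. In dimension two, a large box
    norm means a correlation with a character on long pieces of orbits
    ([box2_inverse]); attaching the pieces to the points gives an extension of the
    system where the characters are eigenfunctions, and the dual function can be
    traded for them ([lift_correlates]). In dimension [d + 2], the same is done for
    the derivatives along cubes of dimension [d], giving eigenfunctions attached to
    cubes; all the phases already present cancel along cubes. By induction on the
    number of functions their eigenvalues are almost rational, so that they are
    almost constant along progressions and can be averaged out: this leaves a large
    box norm of dimension [d + 1] ([lift_descends]). *)

(** * Complex numbers *)

Section Complex.
Variable R : realType.
Local Notation C := R[i].
Implicit Types z w : C.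

Lemma normc_ge0 z : 0 <= normc z.
Proof. by case: z => a b /=; rewrite sqrtr_ge0. Qed.

Lemma normc_sqr z : normc z ^+ 2 = Re z ^+ 2 + Im z ^+ 2.
Proof. by case: z => a b /=; rewrite sqr_sqrtr // addr_ge0 ?sqr_ge0. Qed.

Lemma normc_conj z : normc z^J = normc z.
Proof. by case: z => a b /=; rewrite sqrrN. Qed.

Lemma Re_mulJ z w : Re (z * w^J) = Re z * Re w + Im z * Im w.
Proof. by case: z => a b; case: w => c d /=; ring. Qed.

Lemma mulcJ z : z * z^J = (normc z ^+ 2)%:C.
Proof.
rewrite normc_sqr; case: z => a b; apply/eqP.
by rewrite eq_complex /=; apply/andP; split; apply/eqP; ring.
Qed.

Lemma Re_mulcJ z : Re (z * z^J) = normc z ^+ 2.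
Proof. by rewrite mulcJ. Qed.

Lemma ReD z w : Re (z + w) = Re z + Re w. Proof. by case: z; case: w. Qed.
Lemma ReN z : Re (- z) = - Re z. Proof. by case: z. Qed.
Lemma ReB z w : Re (z - w) = Re z - Re w. Proof. by rewrite ReD ReN. Qed.
Lemma Re_conj z : Re z^J = Re z. Proof. by case: z. Qed.
Lemma Re_scale (x : R) z : Re (x%:C * z) = x * Re z.
Proof. by case: z => a b /=; ring. Qed.

Lemma Re_sum (I : Type) (r : seq I) (P : pred I) (F : I -> C) :
  Re (\sum_(i <- r | P i) F i) = \sum_(i <- r | P i) Re (F i).
Proof. by apply: (big_morph (@complex.Re R)) => // x y; apply: ReD. Qed.

Lemma normc_real (x : R) : normc x%:C = `|x|.
Proof. by rewrite /= expr0n /= addr0 sqrtr_sqr. Qed.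

Lemma absRe_le z : `|Re z| <= normc z.
Proof. by case: z => a b /=; rewrite -sqrtr_sqr ler_wsqrtr // lerDl sqr_ge0. Qed.

Lemma Re_le z : Re z <= normc z.
Proof. exact: le_trans (ler_norm _) (absRe_le z). Qed.

Lemma normcX z n : normc (z ^+ n) = normc z ^+ n.
Proof. by elim: n => [|n IH]; rewrite ?expr0 ?normc1 // !exprS normcM IH. Qed.

Lemma normc_sum (I : Type) (r : seq I) (P : pred I) (F : I -> C) :
  normc (\sum_(i <- r | P i) F i) <= \sum_(i <- r | P i) normc (F i).
Proof.
elim/big_ind2: _ => [|x1 x2 y1 y2 h1 h2|//]; first by rewrite normc0.
exact: le_trans (le_normcD _ _) (lerD h1 h2).
Qed.

Lemma normcB z w : normc (z - w) = normc (w - z).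
Proof. by rewrite -(normcN (z - w)) opprB. Qed.

Lemma normc_natr n : normc (n%:R : C) = n%:R.
Proof. by rewrite -(rmorph_nat (real_complex R)) normc_real ger0_norm. Qed.

Lemma normc_eq0 z : (normc z == 0) = (z == 0).
Proof. by apply/eqP/eqP => [/eq0_normc//|->]; rewrite normc0. Qed.

(** [le1] is kept as a named predicate so that bounds of products, conjugates
    and averages can be found by proof search. *)
Definition le1 z : Prop := normc z <= 1.

Lemma le1_1 : le1 1. Proof. by rewrite /le1 normc1. Qed.
Lemma le1_0 : le1 0. Proof. by rewrite /le1 normc0. Qed.
Lemma le1M z w : le1 z -> le1 w -> le1 (z * w).
Proof. by move=> hz hw; rewrite /le1 normcM mulr_ile1 // normc_ge0. Qed.
Lemma le1J z : le1 z -> le1 z^J.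
Proof. by rewrite /le1 normc_conj. Qed.
Lemma le1X z n : le1 z -> le1 (z ^+ n).
Proof. by move=> hz; rewrite /le1 normcX exprn_ile1 // normc_ge0. Qed.
Lemma le1_prod (I : Type) (r : seq I) (P : pred I) (F : I -> C) :
  (forall i, P i -> le1 (F i)) -> le1 (\prod_(i <- r | P i) F i).
Proof. by move=> h; apply: big_ind => //; [exact: le1_1 | exact: le1M]. Qed.

End Complex.

Arguments le1 : simpl never.
(* Goals come with various instances of the ring of complex numbers, which
   only full unification identifies. *)
Hint Extern 1 (le1 _) => exact: le1_1 : core.
Hint Extern 1 (le1 _) => exact: le1_0 : core.
Hint Extern 3 (le1 _) => apply: le1M : core.
Hint Extern 2 (le1 _) => (apply: le1_prod; intros) : core.
Hint Extern 2 (le1 _) => apply: le1J : core.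
Hint Extern 2 (le1 _) => apply: le1X : core.

(** * Averages *)

Section Average.
Implicit Types F : fieldType.

Definition av F (M : nat) (c : nat -> F) : F := (\sum_(n < M) c n) / M%:R.

Lemma eq_av F M (c d : nat -> F) :
  (forall n, (n < M)%N -> c n = d n) -> av M c = av M d.
Proof. by move=> h; rewrite /av; congr (_ / _); apply: eq_bigr => i _; apply: h. Qed.

Lemma avD F M (c d : nat -> F) : av M (fun n => c n + d n) = av M c + av M d.
Proof. by rewrite /av big_split mulrDl. Qed.

Lemma avZ F M a (c : nat -> F) : av M (fun n => a * c n) = a * av M c.
Proof. by rewrite /av -big_distrr mulrA. Qed.

Lemma avZr F M a (c : nat -> F) : av M (fun n => c n * a) = av M c * a.
Proof. by rewrite /av -big_distrl mulrAC. Qed.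

Lemma avN F M (c : nat -> F) : av M (fun n => - c n) = - av M c.
Proof. by rewrite /av sumrN mulNr. Qed.

Lemma avB F M (c d : nat -> F) : av M (fun n => c n - d n) = av M c - av M d.
Proof. by rewrite avD avN. Qed.

Lemma exchange_av F M N (c : nat -> nat -> F) :
  av M (fun m => av N (fun n => c m n)) = av N (fun n => av M (fun m => c m n)).
Proof.
rewrite /av -!mulr_suml exchange_big /= -!mulrA; congr (_ * _).
by rewrite mulrC.
Qed.

Lemma avM F M N (c d : nat -> F) :
  av M c * av N d = av M (fun m => av N (fun n => c m * d n)).
Proof. by rewrite -avZr; apply: eq_av => n _; rewrite avZ. Qed.

End Average.

Section RealAverage.
Variable R : realType.
Implicit Types c d : nat -> R.

Lemma av_const M (a : R) : (0 < M)%N -> av M (fun=> a) = a.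
Proof.
by move=> M0; rewrite /av sumr_const card_ord -[a *+ M]mulr_natr mulfK // pnatr_eq0 -lt0n.
Qed.

Lemma le_av M c d : (forall n, (n < M)%N -> c n <= d n) -> av M c <= av M d.
Proof.
by move=> h; rewrite ler_wpM2r ?invr_ge0 // ler_sum // => i _; apply: h.
Qed.

Lemma av_ge0 M c : (forall n, (n < M)%N -> 0 <= c n) -> 0 <= av M c.
Proof. by move=> h; rewrite divr_ge0 // sumr_ge0 // => i _; apply: h. Qed.

Lemma av_le M c (a : R) : (0 < M)%N -> (forall n, (n < M)%N -> c n <= a) -> av M c <= a.
Proof. by move=> M0 h; rewrite -[leRHS](av_const a M0) le_av. Qed.

Lemma le_av_const M c (a : R) : (0 < M)%N -> (forall n, (n < M)%N -> a <= c n) -> a <= av M c.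
Proof. by move=> M0 h; rewrite -[leLHS](av_const a M0) le_av. Qed.

Lemma av_norm M c : `|av M c| <= av M (fun n => `|c n|).
Proof.
by rewrite /av normrM normfV normr_nat ler_wpM2r ?invr_ge0 // ler_norm_sum.
Qed.

Lemma Re_av M (c : nat -> R[i]) : Re (av M c) = av M (fun n => Re (c n)).
Proof.
rewrite /av -Re_sum mulrC -(rmorph_nat (real_complex R)) -fmorphV Re_scale.
by rewrite mulrC.
Qed.

Lemma conj_av M (c : nat -> R[i]) : (av M c)^J = av M (fun n => (c n)^J).
Proof. by rewrite /av rmorphM rmorph_sum /= fmorphV rmorph_nat. Qed.

Lemma normc_av M (c : nat -> R[i]) : normc (av M c) <= av M (fun n => normc (c n)).
Proof.
by rewrite /av normcM normcV normc_natr ler_wpM2r ?invr_ge0 // normc_sum.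
Qed.

Lemma le1_av M (c : nat -> R[i]) : (forall n, le1 (c n)) -> le1 (av M c).
Proof.
move=> h; apply: le_trans (normc_av _ _) _; case: M => [|M].
  by rewrite /av big_ord0 mul0r.
by apply: av_le => // n _; apply: h.
Qed.

Lemma av_sqr M c : (0 < M)%N -> av M c ^+ 2 <= av M (fun n => c n ^+ 2).
Proof.
move=> M0; rewrite -subr_ge0; set m := av M c.
have -> : av M (fun n => c n ^+ 2) - m ^+ 2 = av M (fun n => (c n - m) ^+ 2).
  rewrite [RHS](eq_av (d := fun n => c n ^+ 2 - (2 * m) * c n + m ^+ 2)); last first.
    by move=> n _; ring.
  by rewrite avD avB avZ av_const // -/m; ring.
by apply: av_ge0 => n _; apply: sqr_ge0.
Qed.

Lemma av_shift M h c (K : R) : (forall n, `|c n| <= K) ->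
  `|av M (fun n => c (n + h)%N) - av M c| <= 2 * K * h%:R / M%:R.
Proof.
move=> hK; have K0 : 0 <= K by apply: le_trans (hK 0%N).
have [->|M0] := posnP M.
  by rewrite /av !big_ord0 !mul0r subrr normr0 invr0 mulr0.
rewrite /av -mulrBl normrM normfV normr_nat ler_wpM2r ?invr_ge0 //.
elim: h => [|h IH].
  rewrite (eq_bigr (fun n : 'I_M => c n)) => [|i _]; last by rewrite addn0.
  by rewrite subrr normr0 mulr0.
have E : \sum_(n < M) c (n + h.+1)%N =
    \sum_(n < M) c (n + h)%N + c (M + h)%N - c h.
  have := big_ord_recr M (fun i : 'I_M.+1 => c (i + h)%N) (op := +%R).
  rewrite big_ord_recl /= add0n => /(canRL (addKr _)) => E.
  rewrite [RHS]addrC -E.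
  by apply: eq_bigr => i _; rewrite /bump /= add1n addSnnS.
rewrite E.
have -> : \sum_(n < M) c (n + h)%N + c (M + h)%N - c h - \sum_(n < M) c n =
  (\sum_(n < M) c (n + h)%N - \sum_(n < M) c n) + (c (M + h)%N - c h) by ring.
apply: le_trans (ler_normD _ _) _.
have -> : 2 * K * h.+1%:R = 2 * K * h%:R + (K + K) by rewrite -natr1; ring.
by apply: lerD => //; apply: le_trans (ler_normB _ _) _; apply: lerD.
Qed.

End RealAverage.
Hint Extern 2 (le1 _) => (apply: le1_av; intro) : core.

(** * Means: finitely additive averages *)

Section Bounded.
Variable R : realType.
Local Notation C := R[i].
Variable X : Type.
Implicit Types f g : X -> R.

Definition bdd f := exists K : R, forall x, `|f x| <= K.

Lemma bdd_cst (a : R) : bdd (fun=> a). Proof. by exists `|a|. Qed.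

Lemma bddD f g : bdd f -> bdd g -> bdd (fun x => f x + g x).
Proof.
move=> [K hK] [L hL]; exists (K + L) => x.
exact: le_trans (ler_normD _ _) (lerD (hK x) (hL x)).
Qed.

Lemma bddN f : bdd f -> bdd (fun x => - f x).
Proof. by move=> [K hK]; exists K => x; rewrite normrN. Qed.

Lemma bddB f g : bdd f -> bdd g -> bdd (fun x => f x - g x).
Proof. by move=> hf /bddN hg; apply: bddD. Qed.

Lemma bddM f g : bdd f -> bdd g -> bdd (fun x => f x * g x).
Proof.
move=> [K hK] [L hL]; exists (K * L) => x.
by rewrite normrM ler_pM.
Qed.

Lemma bddX f n : bdd f -> bdd (fun x => f x ^+ n).
Proof. by move=> [K hK]; exists (K ^+ n) => x; rewrite normrX lerXn2r ?nnegrE // (le_trans _ (hK x)). Qed.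

Lemma bdd_sum (I : Type) (r : seq I) (P : pred I) (F : I -> X -> R) :
  (forall i, bdd (F i)) -> bdd (fun x => \sum_(i <- r | P i) F i x).
Proof.
move=> h; elim: r => [|i r IH].
  by exists 0 => x; rewrite big_nil normr0.
have [K hK] := bddD (h i) IH; have [L hL] := IH.
exists (K + L) => x; rewrite big_cons; have := hK x; have := hL x.
case: (P i) => h1 h2.
  by apply: le_trans h2 _; rewrite lerDl; apply: le_trans h1.
by apply: le_trans h1 _; rewrite lerDr; apply: le_trans h2.
Qed.

Lemma bdd_av M (F : nat -> X -> R) :
  (forall i, bdd (F i)) -> bdd (fun x => av M (fun n => F n x)).
Proof. by move=> h; apply: bddM; [apply: bdd_sum => i; apply: h | apply: bdd_cst]. Qed.

Lemma bdd_Re (F : X -> C) : (forall x, le1 (F x)) -> bdd (fun x => Re (F x)).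
Proof. by move=> h; exists 1 => x; apply: le_trans (absRe_le _) (h x). Qed.

Lemma bdd_normc (F : X -> C) : (forall x, le1 (F x)) -> bdd (fun x => normc (F x)).
Proof. by move=> h; exists 1 => x; rewrite ger0_norm ?normc_ge0 //; apply: h. Qed.

Lemma bdd_normcB (F G : X -> C) : (forall x, le1 (F x)) -> (forall x, le1 (G x)) ->
  bdd (fun x => normc (F x - G x)).
Proof.
move=> h h'; exists (1 + 1) => x; rewrite ger0_norm ?normc_ge0 //.
apply: le_trans (le_normcD _ _) _; rewrite normcN; apply: lerD; [apply: h|apply: h'].
Qed.

Lemma bdd_bool (P : X -> bool) : bdd (fun x => (P x)%:R).
Proof. by exists 1 => x; case: (P x); rewrite ?normr1 ?normr0. Qed.

End Bounded.

Lemma bdd_comp (R : realType) (X Y : Type) (h : Y -> X) (f : X -> R) :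
  bdd f -> bdd (fun y => f (h y)).
Proof. by move=> [K hK]; exists K. Qed.

Ltac bd := solve [repeat first
  [ assumption | exact: bdd_cst | apply: bdd_Re; intro; solve [auto 10]
  | apply: bdd_normcB; intro; solve [auto 10]
  | apply: bdd_normc; intro; solve [auto 10] | exact: bdd_bool
  | apply: bdd_av; intro | apply: bdd_sum; intro | apply: bddB | apply: bddD | apply: bddN | apply: bddM | apply: bddX ]].

Section Mean.
Variable R : realType.
Local Notation C := R[i].

(** A mean is a finitely additive probability, given as a functional; only its
    values on bounded functions matter. *)
Record mean (X : Type) := Mean {
  mfun :> (X -> R) -> R;
  mean_lin : forall a f g, bdd f -> bdd g ->
    mfun (fun x => a * f x + g x) = a * mfun f + mfun g;
  mean_ge0 : forall f, bdd f -> (forall x, 0 <= f x) -> 0 <= mfun f;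
  mean1 : mfun (fun=> 1) = 1 }.

Section Theory.
Variable X : Type.
Variable m : mean X.
Implicit Types f g : X -> R.

Lemma eq_mean f g : (forall x, f x = g x) -> m f = m g.
Proof. by move=> /funext ->. Qed.

Lemma meanD f g : bdd f -> bdd g -> m (fun x => f x + g x) = m f + m g.
Proof.
move=> hf hg; rewrite -[m f]mul1r -mean_lin //.
by apply: eq_mean => x; rewrite mul1r.
Qed.

Lemma mean0 : m (fun=> 0) = 0.
Proof.
have := mean_lin m (-1) (bdd_cst X (0:R)) (bdd_cst X 0).
rewrite (eq_mean (g := fun=> 0)) => [|x]; last by ring.
by move=> ->; ring.
Qed.

Lemma meanZ a f : bdd f -> m (fun x => a * f x) = a * m f.
Proof.
move=> hf; rewrite -[RHS]addr0 -mean0 -mean_lin //; last exact: bdd_cst.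
by apply: eq_mean => x; rewrite addr0.
Qed.

Lemma meanN f : bdd f -> m (fun x => - f x) = - m f.
Proof.
by move=> hf; rewrite -mulN1r -meanZ //; apply: eq_mean => x; rewrite mulN1r.
Qed.

Lemma meanB f g : bdd f -> bdd g -> m (fun x => f x - g x) = m f - m g.
Proof. by move=> hf hg; rewrite meanD ?meanN //; apply: bddN. Qed.

Lemma mean_cst a : m (fun=> a) = a.
Proof.
by have := meanZ a (bdd_cst X (1 : R)); rewrite mean1 mulr1.
Qed.

Lemma le_mean f g : bdd f -> bdd g -> (forall x, f x <= g x) -> m f <= m g.
Proof.
move=> hf hg h; rewrite -subr_ge0 -meanB // mean_ge0 //; first exact: bddB.
by move=> x; rewrite subr_ge0.
Qed.

Lemma mean_le f a : bdd f -> (forall x, f x <= a) -> m f <= a.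
Proof. by move=> hf h; rewrite -[leRHS]mean_cst le_mean //; apply: bdd_cst. Qed.

Lemma le_mean_cst f a : bdd f -> (forall x, a <= f x) -> a <= m f.
Proof. by move=> hf h; rewrite -[leLHS]mean_cst le_mean //; apply: bdd_cst. Qed.

Lemma mean_norm f (K : R) : (forall x, `|f x| <= K) -> `|m f| <= K.
Proof.
move=> h; have hf : bdd f by exists K.
rewrite ler_norml mean_le // ?le_mean_cst // => x; have := h x; rewrite ler_norml; lra.
Qed.

Lemma mean_sum (I : Type) (r : seq I) (F : I -> X -> R) :
  (forall i, bdd (F i)) -> m (fun x => \sum_(i <- r) F i x) = \sum_(i <- r) m (F i).
Proof.
move=> h; elim: r => [|i r IH].
  by rewrite big_nil -[RHS]mean0; apply: eq_mean => x; rewrite big_nil.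
rewrite big_cons -IH -meanD //; last by apply: bdd_sum.
by apply: eq_mean => x; rewrite big_cons.
Qed.

Lemma mean_av M (F : nat -> X -> R) :
  (forall i, bdd (F i)) -> m (fun x => av M (fun n => F n x)) = av M (fun n => m (F n)).
Proof.
move=> h; rewrite /av -mean_sum // [RHS]mulrC -meanZ; last by apply: bdd_sum.
by apply: eq_mean => x; rewrite mulrC.
Qed.

Lemma mean_sqr f : bdd f -> m f ^+ 2 <= m (fun x => f x ^+ 2).
Proof.
move=> hf; rewrite -subr_ge0; set a := m f.
have -> : m (fun x => f x ^+ 2) - a ^+ 2 = m (fun x => (f x - a) ^+ 2).
  rewrite [RHS](eq_mean (g := fun x => (f x ^+ 2 - (2 * a) * f x) + a ^+ 2)); last first.
    by move=> x; ring.
  rewrite meanD; [|bd|bd]; rewrite meanB; [|bd|bd].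
  by rewrite meanZ // mean_cst -/a; ring.
by apply: mean_ge0 => [|x]; [bd | apply: sqr_ge0].
Qed.

Lemma mean_exp2 f d : bdd f -> m f ^+ (2 ^ d) <= m (fun x => f x ^+ (2 ^ d)).
Proof.
move=> hf; elim: d => [|d IH]; first by rewrite expn0.
have E (a : R) : a ^+ (2 ^ d.+1) = (a ^+ (2 ^ d)) ^+ 2 by rewrite -exprM expnSr.
rewrite E (@eq_mean (fun x => f x ^+ (2 ^ d.+1)) _ (fun x => E (f x))).
case: d IH E => [|d] IH E; first by rewrite expn0; apply: mean_sqr.
apply: le_trans _ (mean_sqr _); last bd.
rewrite lerXn2r ?nnegrE //.
  by rewrite expnS exprM exprn_ge0 // sqr_ge0.
by apply: mean_ge0 => [|x]; [bd | rewrite expnS exprM exprn_ge0 // sqr_ge0].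
Qed.

End Theory.

Section Monad.
Variables X Y : Type.

Definition dirac_mean (x : X) : mean X.
Proof. by refine (@Mean X (fun f => f x) _ _ _) => //. Defined.

Definition bind_mean (m : mean X) (k : X -> mean Y) : mean Y.
Proof.
refine (@Mean Y (fun f => m (fun x => k x f)) _ _ _).
- move=> a f g [K hK] [L hL].
  rewrite -mean_lin; [|by exists K => x; apply: mean_norm|by exists L => x; apply: mean_norm].
  by apply: eq_mean => x; rewrite mean_lin //; [exists K | exists L].
- move=> f [K hK] h; apply: mean_ge0 => [|x]; first by exists K => x; apply: mean_norm.
  by apply: mean_ge0 => //; exists K.
- by rewrite -[RHS](mean1 m); apply: eq_mean => x; rewrite mean1.
Defined.

End Monad.

Definition map_mean (X Y : Type) (h : X -> Y) (m : mean X) : mean Y :=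
  bind_mean m (fun x => dirac_mean (h x)).

(** The uniform mean on the first [M] integers; the maximum only serves to make
    it a mean when [M = 0]. *)
Definition unif (M : nat) : mean nat.
Proof.
refine (@Mean nat (fun c => av (maxn M 1) c) _ _ _).
- by move=> a f g _ _; rewrite avD avZ.
- by move=> f _ h; apply: av_ge0.
- by rewrite av_const //; lia.
Defined.

Lemma unifE M c : (0 < M)%N -> unif M c = av M c.
Proof. by move=> h /=; congr av; lia. Qed.

End Mean.

(** Generalized limits of bounded sequences, along a free ultrafilter. *)
Section UltraLimit.
Import numFieldNormedType.Exports.
Variable R : realType.
Local Open Scope classical_set_scope.

Lemma free_ultra_exists : exists U : set_system nat, UltraFilter U /\ \oo `<=` U.
Proof. exact: ultraFilterLemma. Qed.

Definition free_ultra : set_system nat := projT1 (cid free_ultra_exists).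

Instance free_ultraP : UltraFilter free_ultra.
Proof. by case: (projT2 (cid free_ultra_exists)). Qed.

Lemma free_ultra_oo : \oo `<=` free_ultra.
Proof. by case: (projT2 (cid free_ultra_exists)). Qed.

Lemma cvg_free_ultra (u : nat -> R) : bdd u -> cvg (u x @[x --> free_ultra]).
Proof.
move=> [K hK]; have uK : free_ultra [set x | u x \in `[- K, K]%R].
  have -> : [set x | u x \in `[- K, K]%R] = setT.
    by apply/seteqP; split=> // x _; rewrite /mkset in_itv /= -ler_norml.
  exact: filterT.
have := @segment_compact R (- K) K (u x @[x --> free_ultra]) _ uK.
case=> p [_ hp]; apply/cvg_ex; exists p => A /= Ap.
case: (in_ultra_setVsetC (u @^-1` A) free_ultraP) => // hA.
by have [y [hy1 hy2]] := hp (~` A) A hA Ap.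
Qed.

Definition LIM : mean R nat.
Proof.
refine (@Mean R nat (fun u => lim (u x @[x --> free_ultra])) _ _ _).
- move=> a f g hf hg; apply/cvg_lim => //.
  by apply: cvgD; [apply: cvgMr|]; apply: cvg_free_ultra.
- move=> f hf h; apply: limr_ge; first exact: cvg_free_ultra.
  by apply: filterS filterT => x _.
- by apply/cvg_lim => //; apply: cvg_cst.
Defined.

Lemma LIM_ge (u : nat -> R) a N : bdd u -> (forall n, (N <= n)%N -> a <= u n) -> a <= LIM u.
Proof.
move=> hu h; apply: limr_ge; first exact: cvg_free_ultra.
by apply: free_ultra_oo; exists N.
Qed.

Lemma LIM_le (u : nat -> R) a N : bdd u -> (forall n, (N <= n)%N -> u n <= a) -> LIM u <= a.
Proof.
move=> hu h; rewrite -lerN2 -meanN //; apply: (LIM_ge (N := N)); first exact: bddN.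
by move=> n hn; rewrite lerN2 h.
Qed.

Lemma LIM_frequently (u : nat -> R) a b N :
  bdd u -> a <= LIM u -> b < a -> exists2 n, (N <= n)%N & b <= u n.
Proof.
move=> hu hl hb; have [//|h] := pselect (exists2 n, (N <= n)%N & b <= u n).
suff : LIM u <= b by lra.
apply: (LIM_le (N := N)) => // n hn; rewrite leNgt; apply/negP => h'.
by apply: h; exists n => //; apply: ltW.
Qed.

Lemma LIM_small (u : nat -> R) (K : R) : (forall j, `|u j| <= K / j.+1%:R) -> LIM u = 0.
Proof.
move=> hu; have K0 : 0 <= K by have := hu 0%N; rewrite divr1; exact: le_trans.
have bu : bdd u.
  by exists K => j; apply: le_trans (hu j) _; rewrite ler_pdivrMr ?ltr0n // ler_peMr // ler1n.
have key (v : nat -> R) : bdd v -> (forall j, v j <= K / j.+1%:R) -> LIM v <= 0.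
  move=> bv hv; rewrite leNgt; apply/negP => pos.
  suff : LIM v <= LIM v / 2 by lra.
  apply: (LIM_le (N := Num.bound (K / (LIM v / 2)))) => // j hj.
  apply: le_trans (hv j) _; rewrite ler_pdivrMr ?ltr0n // mulrC -ler_pdivrMr ?divr_gt0 //.
  have := archi_boundP (divr_ge0 K0 (ltW (divr_gt0 pos (ltr0n R 2)))) => /ltW h.
  by apply: le_trans h _; rewrite ler_nat (leq_trans hj).
apply/eqP; rewrite eq_le key ?andTb => //; last by move=> j; apply: le_trans (ler_norm _) (hu j).
rewrite -oppr_le0 -meanN // key //; first exact: bddN.
by move=> j; apply: le_trans (ler_norm _) _; rewrite normrN.
Qed.

End UltraLimit.
Arguments LIM {R}.
Arguments unif {R}.

(** * The Cauchy--Schwarz inequality and box norms *)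

Section CauchySchwarz.
Variable R : realType.
Local Notation C := R[i].

Definition cmean (X : Type) (m : mean R X) (F : X -> C) : R := m (fun x => Re (F x)).

Lemma eq_cmean (X : Type) (m : mean R X) (F G : X -> C) :
  (forall x, F x = G x) -> cmean m F = cmean m G.
Proof. by move=> /funext ->. Qed.

Lemma cmean_norm (X : Type) (m : mean R X) (F : X -> C) :
  (forall x, le1 (F x)) -> `|cmean m F| <= 1.
Proof. by move=> h; apply: mean_norm => x; apply: le_trans (absRe_le _) (h x). Qed.

Lemma cmean_le1 (X : Type) (m : mean R X) (F : X -> C) :
  (forall x, le1 (F x)) -> cmean m F <= 1.
Proof. by move=> h; apply: le_trans (ler_norm _) (cmean_norm m h). Qed.

Lemma cmean_av (X : Type) (m : mean R X) M (F : nat -> X -> C) :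
  (forall n x, le1 (F n x)) ->
  cmean m (fun x => av M (fun n => F n x)) = av M (fun n => cmean m (F n)).
Proof.
move=> h; rewrite /cmean -mean_av => [|n]; last bd.
by apply: eq_mean => x; rewrite Re_av.
Qed.

Lemma cmean_conj (X : Type) (m : mean R X) (F : X -> C) :
  cmean m (fun x => (F x)^J) = cmean m F.
Proof. by apply: eq_mean => x; rewrite Re_conj. Qed.

Lemma bdd_cmean (I X : Type) (m : I -> mean R X) (F : I -> X -> C) :
  (forall i x, le1 (F i x)) -> bdd (fun i => cmean (m i) (F i)).
Proof. by move=> h; exists 1 => i; apply: cmean_norm. Qed.

Lemma cmean_lipschitz (X : Type) (m : mean R X) (F G : X -> C) :
  (forall x, le1 (F x)) -> (forall x, le1 (G x)) ->
  cmean m F <= cmean m G + m (fun x => normc (F x - G x)).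
Proof.
move=> hF hG; rewrite -lerBlDl /cmean -meanB; [|bd|bd].
by apply: le_mean => [||x]; [bd|bd|rewrite -ReB Re_le].
Qed.

Lemma mean_le_root (X : Type) (m : mean R X) (F : X -> R) (e : R) :
  bdd F -> 0 <= e -> m (fun x => F x ^+ 2) <= e ^+ 2 -> m F <= e.
Proof.
move=> hF e0 h; rewrite leNgt; apply/negP => h'.
have := le_trans (mean_sqr m hF) h.
by rewrite ler_pXn2r ?nnegrE //; [lra | lra].
Qed.

Lemma cmean_sqr (X : Type) (m : mean R X) (g F : X -> C) :
  (forall x, le1 (g x)) -> (forall x, le1 (F x)) ->
  cmean m (fun x => g x * F x) ^+ 2 <= m (fun x => normc (F x) ^+ 2).
Proof.
move=> hg hF; apply: le_trans (mean_sqr _ _) _; first by bd.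
apply: le_mean => [||x]; [bd|bd|].
rewrite -(real_normK (num_real _)) ler_sqr ?nnegrE ?normc_ge0 ?normr_ge0 //.
apply: le_trans (absRe_le _) _.
by rewrite normcM ler_piMl ?normc_ge0 //; apply: hg.
Qed.

Lemma mean_normc_av_sqr (X : Type) (m : mean R X) H (u : nat -> X -> C) :
  (forall h x, le1 (u h x)) ->
  m (fun x => normc (av H (fun h => u h x)) ^+ 2) =
  av H (fun h => av H (fun h' => cmean m (fun x => u h x * (u h' x)^J))).
Proof.
move=> hu; rewrite /cmean (eq_mean _ (g := fun x => av H (fun h => av H (fun h' =>
   Re (u h x * (u h' x)^J))))).
  rewrite mean_av => [|h]; last bd.
  by apply: eq_av => h _; rewrite mean_av => // h'; bd.
move=> x; rewrite -Re_mulcJ conj_av avM Re_av.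
by apply: eq_av => h _; rewrite Re_av.
Qed.

(** The Cauchy--Schwarz step behind all later estimates: a factor that does not
    depend on the averaging parameter is discarded at the price of doubling that
    parameter. *)
Lemma cauchy_schwarz_av (X : Type) (m : mean R X) H (g : X -> C) (u : nat -> X -> C) :
  (forall x, le1 (g x)) -> (forall h x, le1 (u h x)) ->
  av H (fun h => cmean m (fun x => g x * u h x)) ^+ 2 <=
  av H (fun h => av H (fun h' => cmean m (fun x => u h x * (u h' x)^J))).
Proof.
move=> hg hu; rewrite -mean_normc_av_sqr //.
rewrite -cmean_av; last by auto.
rewrite (eq_cmean _ (G := fun x => g x * av H (fun h => u h x))) => [|x].
  by apply: cmean_sqr => // x; auto.
by rewrite avZ.
Qed.

(** The product over the vertices of a cube: each coordinate is taken in [h] or in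
    [h'], with a conjugation for every coordinate taken in [h']. *)
Fixpoint cube (h h' : seq nat) (Z : seq nat -> C) : C :=
  match h, h' with
  | a :: h, b :: h' =>
      cube h h' (fun l => Z (a :: l)) * (cube h h' (fun l => Z (b :: l)))^J
  | _, _ => Z [::]
  end.

Lemma eq_cube h h' Z W : (forall l, Z l = W l) -> cube h h' Z = cube h h' W.
Proof. by move=> /funext ->. Qed.

Lemma cubeM h h' Z W :
  cube h h' (fun l => Z l * W l) = cube h h' Z * cube h h' W.
Proof.
elim: h h' Z W => [|a h IH] [|b h'] Z W //=.
by rewrite !IH rmorphM /=; ring.
Qed.

Lemma cube_conj h h' Z : cube h h' (fun l => (Z l)^J) = (cube h h' Z)^J.
Proof.
elim: h h' Z => [|a h IH] [|b h'] Z //=.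
by rewrite !IH rmorphM.
Qed.

Lemma cube_prod h h' (I : Type) (r : seq I) (Z : I -> seq nat -> C) :
  cube h h' (fun l => \prod_(i <- r) Z i l) = \prod_(i <- r) cube h h' (Z i).
Proof.
elim: r => [|i r IH].
  rewrite big_nil; elim: h h' => [|a h IH] [|b h'] //=; rewrite ?big_nil //.
  rewrite (eq_cube _ _ (W := fun l => \prod_(i <- [::]) Z i l)) ?IH => [|l]; last by rewrite !big_nil.
  rewrite (eq_cube _ _ (W := fun l => \prod_(i <- [::]) Z i l)) ?IH => [|l]; last by rewrite !big_nil.
  by rewrite rmorph1 mulr1.
rewrite big_cons -IH -cubeM; apply: eq_cube => l; exact: big_cons.
Qed.

Lemma le1_cube h h' Z : (forall l, le1 (Z l)) -> le1 (cube h h' Z).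
Proof. by elim: h h' Z => [|a h IH] [|b h'] Z hZ //=; auto. Qed.

(** In a cube of positive dimension every phase meets its conjugate. *)
Lemma cube_cst h h' z : size h = size h' -> (0 < size h)%N -> normc z = 1 ->
  cube h h' (fun=> z) = 1.
Proof.
case: h h' => [|a h] [|b h'] //= _ _ hz.
rewrite mulcJ; suff -> : normc (cube h h' (fun=> z)) = 1 by rewrite expr1n.
elim: h h' => [|c h IH] [|d h'] //=.
by rewrite normcM normc_conj IH mulr1.
Qed.

Fixpoint box_mean (Hs : seq nat) : mean R (seq nat) :=
  if Hs is H :: Hs then
    bind_mean (unif H) (fun a => map_mean (cons a) (box_mean Hs))
  else dirac_mean R [::].

Lemma box_meanS H Hs F :
  box_mean (H :: Hs) F = unif H (fun a => box_mean Hs (fun h => F (a :: h))).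
Proof. by []. Qed.

Lemma bdd_box (X : Type) Hs (F : seq nat -> X -> R) :
  (forall h, bdd (F h)) -> bdd (fun x => box_mean Hs (fun h => F h x)).
Proof.
elim: Hs F => [|H Hs IH] F hF /=; first exact: hF.
apply: bddM; last by bd.
apply: bdd_sum => i.
by apply: (IH (fun h => F (nat_of_ord i :: h))).
Qed.

Lemma mean_box (X : Type) (m : mean R X) Hs (F : seq nat -> X -> R) :
  (forall h, bdd (F h)) ->
  m (fun x => box_mean Hs (fun h => F h x)) = box_mean Hs (fun h => m (F h)).
Proof.
elim: Hs F => [|H Hs IH] F hF //=.
rewrite mean_av => [|i]; last by apply: (bdd_box _ (F := fun h => F (i :: h))).
by apply: eq_av => i _; rewrite (IH (fun h => F (i :: h))).
Qed.

(** Products of [d] functions, the [i]-th of which does not depend on the [i]-th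
    coordinate: these are the factors that Cauchy--Schwarz inequalities remove. *)
Fixpoint partial_deps (P : Type) (d : nat) (W : seq nat -> P -> C) : Prop :=
  if d is d'.+1 then
    exists W1, exists V, [/\ (forall h p, le1 (W1 h p)), (forall a h p, le1 (V a h p)),
       (forall a, partial_deps d' (V a)) &
       forall a h p, W (a :: h) p = W1 h p * V a h p]
  else forall p, W [::] p = 1.

End CauchySchwarz.

Hint Extern 2 (le1 (cube _ _ _)) => (apply: le1_cube; intro) : core.

Section BoxCauchySchwarz.
Variable R : realType.
Local Notation C := R[i].

Lemma partial_depsM (P : Type) d (V W : seq nat -> P -> C) :
  partial_deps d V -> partial_deps d W ->
  partial_deps d (fun h p => V h p * W h p).
Proof.
elim: d V W => [|d IH] V W /=; first by move=> hV hW p; rewrite hV hW mulr1.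
move=> [V1 [V2 [h1 h2 h3 h4]]] [W1 [W2 [k1 k2 k3 k4]]].
exists (fun h p => V1 h p * W1 h p), (fun a h p => V2 a h p * W2 a h p).
split=> [h p|a h p|a|a h p]; [by auto|by auto|by auto|].
by rewrite h4 k4; ring.
Qed.

Lemma partial_depsJ (P : Type) d (V : seq nat -> P -> C) :
  partial_deps d V -> partial_deps d (fun h p => (V h p)^J).
Proof.
elim: d V => [|d IH] V /=; first by move=> hV p; rewrite hV rmorph1.
move=> [V1 [V2 [h1 h2 h3 h4]]].
exists (fun h p => (V1 h p)^J), (fun a h p => (V2 a h p)^J).
split=> [h p|a h p|a|a h p]; [by auto|by auto|by auto|].
by rewrite h4 rmorphM.
Qed.

Lemma partial_deps_comp (P P' : Type) d (V : seq nat -> P -> C) (r : P' -> P) :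
  partial_deps d V -> partial_deps d (fun h p => V h (r p)).
Proof.
elim: d V => [|d IH] V /=; first by move=> hV p; rewrite hV.
move=> [V1 [V2 [h1 h2 h3 h4]]].
exists (fun h p => V1 h (r p)), (fun a h p => V2 a h (r p)).
by split=> *; auto.
Qed.

(** When the cube is unfolded at its first vertex, each remaining vertex misses
    one of the coordinates of that vertex. *)
Lemma cube_first_vertex (P : Type) h' (Z : seq nat -> P -> C) :
  (forall h p, le1 (Z h p)) ->
  exists W, [/\ partial_deps (size h') W, (forall h p, le1 (W h p)) &
    forall h p, size h = size h' -> cube h h' (fun l => Z l p) = Z h p * W h p].
Proof.
elim: h' Z => [|b h' IH] Z hZ.
  exists (fun _ _ => 1); split=> // [h p|[|//] p _] /=; [by auto|by rewrite mulr1].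
have /choice[W hW] : forall a, exists W : seq nat -> P -> C,
  [/\ partial_deps (size h') W, (forall h p, le1 (W h p)) &
    forall h p, size h = size h' ->
      cube h h' (fun l => Z (a :: l) p) = Z (a :: h) p * W h p].
  by move=> a; apply: (IH (fun h => Z (a :: h))).
pose V (h : seq nat) p := if h is a :: h then
   (cube h h' (fun l => Z (b :: l) p))^J * W a h p else 1.
exists V; split=> [|[|a h] p|[|a h] p] //=.
- exists (fun h p => (cube h h' (fun l => Z (b :: l) p))^J), (fun a => W a).
  by split=> [h p|a h p|a|//]; [auto 6|case: (hW a)|case: (hW a)].
- by auto.
- by case: (hW a) => _ h2 _; auto 6.
- by move=> [] sz; case: (hW a) => _ _ ->//; ring.
Qed.

(** The coordinates are doubled one at a time; each time the factor that does not
    depend on the coordinate disappears. *)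
Lemma box_cauchy_schwarz (P : Type) (m : mean R P) Hs (Z W : seq nat -> P -> C) :
  (forall h p, le1 (Z h p)) -> (forall h p, le1 (W h p)) ->
  partial_deps (size Hs) W ->
  box_mean R Hs (fun h => cmean m (fun p => Z h p * W h p)) ^+ (2 ^ size Hs) <=
  box_mean R Hs (fun h => box_mean R Hs (fun h' =>
     cmean m (fun p => cube h h' (fun l => Z l p)))).
Proof.
elim: Hs P m Z W => [|H Hs IH] P m Z W hZ hW /=.
  by move=> h1; rewrite expn0 expr1 le_eqVlt; apply/orP; left; apply/eqP;
     apply: eq_cmean => p; rewrite h1 mulr1.
move=> [W1 [V [h1 h2 h3 h4]]]; set N := maxn H 1.
pose m' := bind_mean (box_mean R Hs) (fun h => map_mean (pair h) m).
pose u a (q : seq nat * P) := Z (a :: q.1) q.2 * V a q.1 q.2.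
have hu a q : le1 (u a q) by rewrite /u; auto.
have := cauchy_schwarz_av m' N (g := fun q => W1 q.1 q.2) (fun q => h1 q.1 q.2) hu.
set x := av N _; set y := av N _ => xy.
pose g a b := box_mean R Hs (fun h => cmean m (fun p => u a (h, p) * (u b (h, p))^J)).
have -> : av N (fun a => box_mean R Hs (fun h =>
    cmean m (fun p => Z (a :: h) p * W (a :: h) p))) = x.
  apply: eq_av => a _; apply: eq_mean => h; apply: eq_mean => p.
  by rewrite h4 /u /=; congr complex.Re; ring.
rewrite expnS exprM.
have g1 a b h : `|cmean m (fun p => u a (h, p) * (u b (h, p))^J)| <= 1.
  by apply: cmean_norm => p; auto.
have N0 : (0 < N)%N by rewrite /N; lia.
have yE : y = unif N (fun a => unif N (g a)).
  rewrite unifE // /y; apply: eq_av => a _; rewrite unifE //.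
apply: (@le_trans _ _ (unif N (fun a => unif N (fun b => g a b ^+ (2 ^ size Hs))))).
  apply: (@le_trans _ _ (y ^+ (2 ^ size Hs))).
    by rewrite lerXn2r ?nnegrE ?sqr_ge0 // (le_trans _ xy) ?sqr_ge0.
  rewrite yE; apply: le_trans (mean_exp2 _ _ _) _.
    by exists 1 => a; apply: mean_norm => b; apply: mean_norm.
  apply: le_mean => [||a].
  - apply: bddX; exists 1 => a; apply: mean_norm => b; exact: mean_norm.
  - exists 1 => a; apply: mean_norm => b; rewrite normrX exprn_ile1 //.
    exact: mean_norm.
  - by apply: mean_exp2; exists 1 => b; apply: mean_norm.
rewrite unifE //; apply: le_av => a _.
rewrite -(@mean_box R _ (unif H) Hs (fun h b => box_mean R Hs (fun h' =>
  cmean m (fun p => cube h h' (fun l => Z (a :: l) p) *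
                    (cube h h' (fun l => Z (b :: l) p))^J)))); last first.
  move=> h; exists 1 => b; apply: mean_norm => h'; apply: cmean_norm => p; auto.
rewrite unifE //; apply: le_av => b _.
have := IH _ m (fun h p => Z (a :: h) p * (Z (b :: h) p)^J)
               (fun h p => V a h p * (V b h p)^J).
have -> : g a b = box_mean R Hs (fun h => cmean m (fun p =>
   Z (a :: h) p * (Z (b :: h) p)^J * (V a h p * (V b h p)^J))).
  apply: eq_mean => h; apply: eq_cmean => p; rewrite /u /= rmorphM /=; ring.
move=> IH'; apply: le_trans (IH' _ _ _) _ => [h p|h p||].
- by auto.
- by auto.
- by apply: partial_depsM => //; apply: partial_depsJ.
rewrite le_eqVlt; apply/orP; left; apply/eqP.
apply: eq_mean => h; apply: eq_mean => h'; apply: eq_cmean => p.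
by rewrite cubeM cube_conj.
Qed.

End BoxCauchySchwarz.

(** * Systems and their box norms *)

(** The phase space is a bare set: invariant finitely additive means are closed
    under all the limits and products used below, so that each of them can be
    realized by passing to an extension. *)
Record system (R : realType) := System {
  pt :> Type;
  act : int -> pt -> pt;
  smean : mean R pt;
  act0 : forall x, act 0 x = x;
  actD : forall a b x, act (a + b) x = act a (act b x);
  smean_act : forall a f, bdd f -> smean (fun x => f (act a x)) = smean f }.

Section Box.
Variable R : realType.
Local Notation C := R[i].
Variable S : system R.
Implicit Types (f g : S -> C) (x : S).
Local Notation E := (cmean (smean S)).

Lemma actC a b x : act a (act b x) = act b (act a x).
Proof. by rewrite -!actD addrC. Qed.

Lemma cmean_act a f : (forall x, le1 (f x)) -> E (fun x => f (act a x)) = E f.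
Proof. by move=> hf; rewrite /cmean -[RHS](smean_act (s := S) a) //; bd. Qed.

Definition dcube h h' f x := cube h h' (fun l => f (act (sumn l)%:Z x)).

Lemma le1_dcube h h' f x : (forall x, le1 (f x)) -> le1 (dcube h h' f x).
Proof. by move=> hf; rewrite /dcube; auto. Qed.

Lemma dcubeM h h' f g x :
  dcube h h' (fun x => f x * g x) x = dcube h h' f x * dcube h h' g x.
Proof. exact: cubeM. Qed.

Lemma dcubeJ h h' f x : dcube h h' (fun x => (f x)^J) x = (dcube h h' f x)^J.
Proof. exact: cube_conj. Qed.

(** The local Gowers norm to the power [2 ^ size Hs], over cubes of sides [Hs]. *)
Fixpoint Box (Hs : seq nat) f : R :=
  if Hs is H :: Hs then
    unif H (fun a => unif H (fun b =>
      Box Hs (fun x => f (act a%:Z x) * (f (act b%:Z x))^J)))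
  else E f.

Lemma BoxS H Hs f : Box (H :: Hs) f = unif H (fun a => unif H (fun b =>
      Box Hs (fun x => f (act a%:Z x) * (f (act b%:Z x))^J))).
Proof. by []. Qed.

Lemma eq_Box Hs f g : (forall x, f x = g x) -> Box Hs f = Box Hs g.
Proof. by move=> /funext ->. Qed.

Lemma Box_norm Hs f : (forall x, le1 (f x)) -> `|Box Hs f| <= 1.
Proof.
elim: Hs f => [|H Hs IH] f hf; first exact: cmean_norm.
apply: mean_norm => a; apply: mean_norm => b; apply: IH => x; auto.
Qed.

Lemma Box_conj Hs f : Box Hs (fun x => (f x)^J) = Box Hs f.
Proof.
elim: Hs f => [|H Hs IH] f; first exact: cmean_conj.
apply: eq_mean => a; apply: eq_mean => b; rewrite -[RHS]IH.
by apply: eq_Box => x; rewrite rmorphM.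
Qed.

Lemma Box_act Hs a f : (forall x, le1 (f x)) -> Box Hs (fun x => f (act a x)) = Box Hs f.
Proof.
elim: Hs f => [|H Hs IH] f hf; first exact: cmean_act.
apply: eq_mean => b; apply: eq_mean => c.
rewrite -[RHS]IH; last by move=> x; auto.
by apply: eq_Box => x; rewrite !(actC a).
Qed.

Lemma Box_cat Hs Ks f : (forall x, le1 (f x)) ->
  Box (Hs ++ Ks) f =
  box_mean R Hs (fun h => box_mean R Hs (fun h' => Box Ks (dcube h h' f))).
Proof.
elim: Hs f => [|H Hs IH] f hf.
  by apply: eq_Box => x; rewrite /dcube /= act0.
rewrite [LHS]/= [RHS]/=; apply: eq_av => a _.
rewrite -(@mean_box R _ (unif H) Hs (fun h b => box_mean R Hs (fun h' => Box Ks (dcube (a :: h) (b :: h') f)))).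
  apply: eq_av => b _; rewrite IH; last by move=> x; auto.
  apply: eq_mean => h; apply: eq_mean => h'; apply: eq_Box => x.
  rewrite dcubeM dcubeJ /dcube /= -!/(dcube _ _ _ _).
  by congr (_ * _^J); apply: eq_cube => l; rewrite -actD PoszD.
move=> h; exists 1 => b; apply: mean_norm => h'; apply: Box_norm => x.
exact: le1_dcube.
Qed.

Lemma Box1 H f : (forall x, le1 (f x)) ->
  Box [:: H] f = smean S (fun x => normc (av (maxn H 1) (fun a => f (act a%:Z x))) ^+ 2).
Proof. by move=> hf; rewrite mean_normc_av_sqr => [|h x]; auto. Qed.

(** Isolating one coordinate exhibits a box norm as an average of squares, whence
    its positivity and monotonicity. *)
Lemma Box_head H Hs f : (forall x, le1 (f x)) ->
  Box (H :: Hs) f =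
  box_mean R Hs (fun h => box_mean R Hs (fun h' => Box [:: H] (dcube h h' f))).
Proof.
move=> hf.
have B a b h h' : `|Box [::] (dcube (a :: h) (b :: h') f)| <= 1.
  by apply: Box_norm => x; apply: le1_dcube.
have -> : Box (H :: Hs) f = unif H (fun a => unif H (fun b =>
   box_mean R Hs (fun h => box_mean R Hs (fun h' => Box [::] (dcube (a :: h) (b :: h') f))))).
  apply: eq_mean => a; apply: eq_mean => b.
  transitivity (Box (Hs ++ [::]) (fun x => f (act a%:Z x) * (f (act b%:Z x))^J)).
    by rewrite cats0.
  rewrite Box_cat; last by move=> x; auto.
  apply: eq_mean => h; apply: eq_mean => h'; apply: eq_Box => x.
  rewrite dcubeM dcubeJ /dcube /= -!/(dcube _ _ _ _).
  by congr (_ * _^J); apply: eq_cube => l; rewrite -actD PoszD.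
transitivity (unif H (fun a => box_mean R Hs (fun h => unif H (fun b => box_mean R Hs
   (fun h' => Box [::] (dcube (a :: h) (b :: h') f)))))).
  apply: eq_mean => a; rewrite mean_box // => h.
  by exists 1 => b; apply: mean_norm.
rewrite mean_box => [|h]; last by exists 1 => a; do 2 apply: mean_norm => ?.
apply: eq_mean => h.
transitivity (unif H (fun a => box_mean R Hs (fun h' => unif H (fun b =>
   Box [::] (dcube (a :: h) (b :: h') f))))).
  by apply: eq_mean => a; rewrite mean_box // => h'; exists 1 => b.
rewrite mean_box => [|h']; last by exists 1 => a; apply: mean_norm.
apply: eq_mean => h'; apply: eq_mean => a; apply: eq_mean => b.
apply: eq_Box => x; rewrite /dcube /=.
by congr (_ * _^J); apply: eq_cube => l; rewrite -actD PoszD addrC.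
Qed.

Lemma Box1_ge0 H f : (forall x, le1 (f x)) -> 0 <= Box [:: H] f.
Proof. by move=> hf; rewrite Box1 // mean_ge0 // => [|x]; [bd|rewrite sqr_ge0]. Qed.

Lemma Box_ge0 H Hs f : (forall x, le1 (f x)) -> 0 <= Box (H :: Hs) f.
Proof.
move=> hf; rewrite Box_head //; apply: mean_ge0 => [|h].
  exists 1 => h; apply: mean_norm => h'; apply: Box_norm => x; exact: le1_dcube.
apply: mean_ge0 => [|h']; first by exists 1 => h'; apply: Box_norm => x; exact: le1_dcube.
by apply: Box1_ge0 => x; apply: le1_dcube.
Qed.

Lemma sum_blocks (V : nmodType) m H (F : nat -> V) :
  \sum_(i < m * H) F i = \sum_(a < m) \sum_(b < H) F (a * H + b)%N.
Proof.
elim: m => [|m IH]; first by rewrite mul0n !big_ord0.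
rewrite big_ord_recr /= -IH mulSnr big_split_ord /=.
by congr (_ + _); apply: eq_bigr => i _.
Qed.

Lemma av_blocks (K : numFieldType) m H (F : nat -> K) : (0 < m)%N -> (0 < H)%N ->
  av (m * H) F = av m (fun a => av H (fun b => F (a * H + b)%N)).
Proof.
move=> m0 H0; rewrite /av sum_blocks -mulr_suml natrM invfM.
by rewrite -mulrA [_^-1 * _]mulrC.
Qed.

(** Averages over long boxes are averages of translates of those over short
    ones; as translates have equal norms, convexity makes box norms decrease. *)
Lemma Box1_mono m H f : (0 < m)%N -> (0 < H)%N -> (forall x, le1 (f x)) ->
  Box [:: (m * H)%N] f <= Box [:: H] f.
Proof.
move=> m0 H0 hf; rewrite !Box1 //.
have -> : maxn (m * H) 1 = (m * H)%N by nia.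
have -> : maxn H 1 = H by lia.
pose G (x : S) : C := av H (fun b => f (act b%:Z x)).
have hG x : le1 (G x) by rewrite /G; auto.
apply: (@le_trans _ _ (smean S (fun x => av m (fun a => normc (G (act (a * H)%N%:Z x)) ^+ 2)))).
  apply: le_mean => [||x]; [bd|bd|].
  rewrite av_blocks //; apply: le_trans (_ : av m (fun a => normc (G (act (a * H)%N%:Z x))) ^+ 2 <= _).
    rewrite lerXn2r ?nnegrE ?normc_ge0 ?av_ge0 // => [n _|]; first exact: normc_ge0.
    apply: le_trans (normc_av _ _) _; rewrite le_eqVlt; apply/orP; left; apply/eqP.
    apply: eq_av => a _; congr normc; apply: eq_av => b _.
    by rewrite -actD -PoszD addnC.
  exact: av_sqr.
rewrite mean_av => [|a]; last bd.
apply: av_le => // a _; rewrite le_eqVlt; apply/orP; left; apply/eqP.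
by rewrite (smean_act (s := S) _ (f := fun x => normc (G x) ^+ 2)) //; bd.
Qed.

Lemma Box_mono Hs Ks f : (forall x, le1 (f x)) ->
  size Hs = size Ks -> all (fun H => 0 < H)%N Hs -> all2 dvdn Ks Hs ->
  Box Hs f <= Box Ks f.
Proof.
elim: Hs Ks f => [|H Hs IH] [|K Ks] f hf //= [sz] /andP[H0 Hs0] /andP[KH KHs].
apply: (@le_trans _ _ (Box (K :: Hs) f)).
  have [m Em] := dvdnP KH; have m0 : (0 < m)%N by nia.
  have K0 : (0 < K)%N by nia.
  rewrite -/(Box (H :: Hs) f) Em [leLHS]Box_head // [leRHS]Box_head //.
  have dc h h' x : le1 (dcube h h' f x) by apply: le1_dcube.
  apply: le_mean => [||h].
  - by exists 1 => h; apply: mean_norm => h'; apply: Box_norm.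
  - by exists 1 => h; apply: mean_norm => h'; apply: Box_norm.
  apply: le_mean => [||h']; [by exists 1 => h'; apply: Box_norm..|].
  exact: Box1_mono.
have ff a b x : le1 (f (act a x) * (f (act b x))^J) by auto.
change (Box (K :: Hs) f <= Box (K :: Ks) f); rewrite !BoxS.
apply: le_mean => [||a].
- by exists 1 => a; apply: mean_norm => b; apply: Box_norm.
- by exists 1 => a; apply: mean_norm => b; apply: Box_norm.
apply: le_mean => [||b]; [by exists 1 => b; apply: Box_norm..|].
exact: IH.
Qed.

Lemma sum_sparse_le c H (x : nat -> R) : (0 < c)%N -> (forall i, 0 <= x i) ->
  \sum_(a < H) x (c * a)%N <= \sum_(i < c * H) x i.
Proof.
move=> c0 hx; rewrite mulnC sum_blocks; apply: ler_sum => a _.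
case: c c0 => // c _; rewrite big_ord_recl /= addn0 mulnC lerDl.
exact: sumr_ge0.
Qed.

(** Restricting a coordinate to a progression of step [c] costs a factor only:
    the function of that coordinate being averaged is nonnegative as soon as
    another coordinate remains. *)
Lemma Box_step (c : int) H K Hs f : c != 0 -> (0 < H)%N -> (forall x, le1 (f x)) ->
  av H (fun a => av H (fun b => Box (K :: Hs)
     (fun x => f (act (c * a%:Z) x) * (f (act (c * b%:Z) x))^J)))
  <= (`|c|%N)%:R ^+ 2 * Box ((`|c| * H)%N :: K :: Hs) f.
Proof.
move=> c0 H0 hf; set d := `|c|%N; have d0 : (0 < d)%N by rewrite /d; lia.
pose G (i j : int) := Box (K :: Hs) (fun x => f (act i x) * (f (act j x))^J).
have G0 i j : 0 <= G i j by apply: Box_ge0 => x; auto.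
have GD t i j : G (i + t) (j + t) = G i j.
  rewrite /G -[RHS](Box_act _ t); last by move=> x; auto.
  by apply: eq_Box => x; rewrite -!actD.
have -> : av H (fun a => av H (fun b => Box (K :: Hs)
     (fun x => f (act (c * a%:Z) x) * (f (act (c * b%:Z) x))^J))) =
   av H (fun a => av H (fun b => G (d * a)%N%:Z (d * b)%N%:Z)).
  have [cp|cn] := leP 0 c.
    by apply: eq_av => a _; apply: eq_av => b _; rewrite -/(G _ _) !PoszM /d;
       congr G; lia.
  have rev (x : nat -> R) : av H x = av H (fun a => x (H.-1 - a)%N).
    rewrite /av; congr (_ / _); rewrite (reindex_inj rev_ord_inj) /=.
    by apply: eq_bigr => i _; congr x; rewrite /=; lia.
  rewrite rev; apply: eq_av => a ha; rewrite rev; apply: eq_av => b hb.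
  rewrite -/(G _ _) -(GD (- c * H.-1)); congr G; rewrite !PoszM /d; nia.
have H00 : H%:R != 0 :> R by rewrite pnatr_eq0; lia.
have d00 : d%:R != 0 :> R by rewrite pnatr_eq0; lia.
have -> : Box ((d * H)%N :: K :: Hs) f = av (d * H) (fun i => av (d * H) (fun j => G i j)).
  rewrite [LHS]/= -/(Box (K :: Hs)); have -> : maxn (d * H) 1 = (d * H)%N by nia.
  by [].
rewrite /av -!mulr_suml natrM invfM.
have -> : d%:R ^+ 2 * ((\sum_(i < d * H) \sum_(j < d * H) G i j) *
   (d%:R^-1 / H%:R) * (d%:R^-1 / H%:R)) =
   (\sum_(i < d * H) \sum_(j < d * H) G i j) / H%:R / H%:R by field; rewrite H00.
do 2 (rewrite ler_wpM2r ?invr_ge0 //).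
apply: le_trans (@sum_sparse_le d H (fun i => \sum_(j < d * H) G i j) d0 _) => [|i].
  by apply: ler_sum => a _; apply: (@sum_sparse_le d H (fun j => G _ j)).
exact: sumr_ge0.
Qed.

(** Box norms bounded below uniformly in the scale: the obstruction to the decay of
    polynomial averages. *)
Definition structured (d : nat) f : Prop :=
  exists2 c : R, 0 < c & forall H, (0 < H)%N -> c <= Box (nseq d H) f.

Lemma structured_conj d f : structured d (fun x => (f x)^J) -> structured d f.
Proof. by move=> [c c0 h]; exists c => // H H0; rewrite -Box_conj h. Qed.

End Box.
Hint Extern 2 (le1 (dcube _ _ _ _)) => (apply: le1_dcube; intro) : core.

(** * Van der Corput's inequality and the linear case *)

Section VanDerCorput.
Variable R : realType.
Local Notation C := R[i].

Definition shift_invariant (m : mean R nat) :=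
  forall u, bdd u -> m (fun n => u n.+1) = m u.

Lemma shift_invariant_add m h u : shift_invariant m -> bdd u ->
  m (fun n => u (n + h)%N) = m u.
Proof.
move=> hm; elim: h u => [|h IH] u hu; first by apply: eq_mean => n; rewrite addn0.
rewrite -(hm u hu) -[RHS](IH (fun n => u n.+1)); last by case: hu => K hK; exists K.
by apply: eq_mean => n; rewrite addnS.
Qed.

Record ball (X : Type) := Ball { bfun :> X -> C; ballP : forall x, le1 (bfun x) }.

End VanDerCorput.
Hint Extern 1 (le1 _) => apply: ballP : core.

Section Ball.
Variable R : realType.
Local Notation C := R[i].
Variables X : Type.
Implicit Types f g : ball R X.

Definition ball1 : ball R X. Proof. by exists (fun=> 1) => x; auto. Defined.
Definition ballM f g : ball R X. Proof. by exists (fun x => f x * g x) => x; auto. Defined.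
Definition ballJ f : ball R X. Proof. by exists (fun x => (f x)^J) => x; auto. Defined.
Definition ball_comp (Y : Type) (r : Y -> X) f : ball R Y.
Proof. by exists (fun y => f (r y)) => y; auto. Defined.

End Ball.
Arguments ball1 {R X}.

Section Family.
Variable R : realType.
Local Notation C := R[i].
Variable S : system R.
Local Notation E := (cmean (smean S)).
Local Notation fam := (seq ({poly int} * ball R S)).
Implicit Types (f g : ball R S) (F : fam).

Definition invariant (g : S -> C) := forall a x, g (act a x) = g x.

Definition prodF F (n : nat) (x : S) : C := \prod_(a <- F) a.2 (act a.1.[n%:Z] x).

Lemma le1_prodF F n x : le1 (prodF F n x).
Proof. by apply: le1_prod => a _; auto. Qed.
Hint Extern 1 (le1 (prodF _ _ _)) => exact: le1_prodF : core.

Lemma prodF_cons a F n x : prodF (a :: F) n x = a.2 (act a.1.[n%:Z] x) * prodF F n x.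
Proof. exact: big_cons. Qed.

Lemma prodF_cat F G n x : prodF (F ++ G) n x = prodF F n x * prodF G n x.
Proof. exact: big_cat. Qed.

(** For a shift-invariant mean, van der Corput's inequality has no error term. *)
Lemma vdc (m : mean R nat) H (g : S -> C) (u : nat -> S -> C) : shift_invariant m ->
  (forall x, le1 (g x)) -> (forall n x, le1 (u n x)) -> (0 < H)%N ->
  m (fun n => E (fun x => g x * u n x)) ^+ 2 <=
  av H (fun h => av H (fun h' =>
    m (fun n => E (fun x => u (n + h)%N x * (u (n + h')%N x)^J)))).
Proof.
move=> hm hg hu H0.
pose m' := bind_mean m (fun n => map_mean (pair n) (smean S)).
have := cauchy_schwarz_av m' H (g := fun q => g q.2) (u := fun h q => u (q.1 + h)%N q.2).
move=> /(_ (fun q => hg q.2) (fun h q => hu _ q.2)); apply: le_trans.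
rewrite le_eqVlt; apply/orP; left; apply/eqP; congr (_ ^+ 2).
rewrite -[LHS](av_const _ H0); apply: eq_av => h _.
rewrite -(@shift_invariant_add _ m h) //.
by exists 1 => n; apply: cmean_norm => x; auto.
Qed.

Lemma mean_act_eq (m : mean R nat) (F G : nat -> S -> C) (a : nat -> int) :
  (forall n x, le1 (G n x)) -> (forall n x, F n x = G n (act (a n) x)) ->
  m (fun n => E (F n)) = m (fun n => E (G n)).
Proof.
move=> hG h; apply: eq_mean => n; rewrite -[RHS](cmean_act (a n)) //.
exact: eq_cmean.
Qed.

Definition ctrl f := exists d, structured d.+2 f.

(** For linear exponents every application of van der Corput removes one of the
    functions and adds one difference to the last one. *)
Lemma linear_bound (m : mean R nat) (cs : seq int) (c : int) :
  shift_invariant m -> c != 0 -> c \notin cs -> exists2 K : R, 0 < K &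
  forall (L : seq (int * ball R S)) (phi : nat -> ball R S) (f0 f : ball R S) H,
    map fst L = cs -> (forall n, invariant (phi n)) -> (0 < H)%N ->
    m (fun n => E (fun x => f0 x * (phi n x *
         ((\prod_(a <- L) a.2 (act (a.1 * n%:Z) x)) * f (act (c * n%:Z) x)))))
      ^+ (2 ^ (size cs).+2) <= K * Box (nseq (size cs).+2 H) f.
Proof.
move=> hm; move sE: (size cs) => s; elim: s cs c sE => [|s IH] cs c sE c0 ccs.
  exists ((`|c|%N)%:R ^+ 2); first by rewrite exprn_gt0 // ltr0n; lia.
  move=> L phi f0 f H Lcs hphi H0.
  have L0 : L = [::] by move: sE; rewrite -Lcs size_map => /size0nil.
  set x := m _.
  have hu n z : le1 (phi n z * f (act (c * n%:Z) z)) by auto.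
  have := vdc hm (ballP f0) hu H0.
  set xx := m _; have -> : xx = x.
    by apply: eq_mean => n; apply: eq_cmean => y; rewrite L0 big_nil mul1r.
  pose G h h' := ballM (ball_comp (act (c * h%:Z)) f) (ballJ (ball_comp (act (c * h'%:Z)) f)).
  pose y h h' := m (fun n => E (fun x => phi (n + h)%N x * (phi (n + h')%N x)^J * G h h' x)).
  have -> : av H (fun h => av H (fun h' => m (fun n => E (fun x =>
     phi (n + h)%N x * f (act (c * (n + h)%N%:Z) x) *
     (phi (n + h')%N x * f (act (c * (n + h')%N%:Z) x))^J)))) =
     av H (fun h => av H (y h)).
    apply: eq_av => h _; apply: eq_av => h' _.
    apply: (mean_act_eq _ (a := fun n => c * n%:Z)) => [n z|n z]; first by auto 6.
    rewrite !hphi /G /= -!actD -!mulrDr ![h%:Z + _]addrC ![h'%:Z + _]addrC.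
    by rewrite rmorphM /= -!PoszD; ring.
  move=> xy.
  have y1 h h' : `|y h h'| <= 1.
    by apply: mean_norm => n; apply: cmean_norm => z; auto 6.
  have yG h h' : y h h' ^+ 2 <= Box [:: H] (G h h').
    pose m' := bind_mean m (fun n => map_mean (pair n) (smean S)).
    rewrite Box1; last by move=> z; auto.
    have HE : maxn H 1 = H by lia.
    rewrite HE.
    have := @cmean_sqr R _ m' (fun q => phi (q.1 + h)%N q.2 * (phi (q.1 + h')%N q.2)^J)
      (fun q => av H (fun b => G h h' (act b%:Z q.2))).
    have -> : m' (fun q => normc (av H (fun b => G h h' (act b q.2))) ^+ 2) =
       smean S (fun z => normc (av H (fun b => G h h' (act b z))) ^+ 2).
      by rewrite -[RHS](mean_cst m).
    move=> h1; apply: le_trans (h1 _ _) => [|q|q]; [|by auto 6|by auto 6].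
    rewrite le_eqVlt; apply/orP; left; apply/eqP; congr (_ ^+ 2).
    apply: eq_mean => n.
    transitivity (E (fun z => av H (fun b =>
      phi (n + h)%N z * (phi (n + h')%N z)^J * G h h' (act b%:Z z)))).
      rewrite cmean_av => [|b z]; last by auto 6.
      rewrite -[LHS](av_const _ H0); apply: eq_av => b _.
      rewrite -[LHS](cmean_act b%:Z); last by auto 6.
      by apply: eq_cmean => z; rewrite !hphi.
    by apply: eq_cmean => z; rewrite avZ.
  rewrite (_ : (2 ^ 2 = 2 * 2)%N) // exprM.
  apply: (@le_trans _ _ (av H (fun h => av H (fun h' => Box [:: H] (G h h'))))).
    apply: (@le_trans _ _ (av H (fun h => av H (y h)) ^+ 2)).
      by rewrite lerXn2r ?nnegrE ?sqr_ge0 // (le_trans _ xy) ?sqr_ge0.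
    apply: le_trans (av_sqr _ H0) _; apply: le_av => h _.
    apply: le_trans (av_sqr _ H0) _; apply: le_av => h' _; exact: yG.
  apply: le_trans (Box_step _ _ c0 H0 (ballP f)) _.
  rewrite ler_wpM2l ?exprn_ge0 //; apply: (Box_mono (ballP f)) => //=.
    by rewrite muln_gt0 H0 !andbT; lia.
  by rewrite dvdn_mull ?dvdnn.
case: cs sE ccs => [|c1 cs] //= [sE]; rewrite inE negb_or => /andP[cc1 ccs].
have [|||K K0 hK] := IH [seq c' - c1 | c' <- cs] (c - c1).
- by rewrite size_map.
- by rewrite subr_eq0.
- by apply/negP => /mapP[c' h1 h2]; move: ccs; rewrite (_ : c = c') ?h1 //; lia.
exists (K * (`|c|%N)%:R ^+ 2); first by rewrite mulr_gt0 // exprn_gt0 // ltr0n; lia.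
move=> [|[c1' f1] L] // phi f0 f H /= [cE Lcs] hphi H0.
rewrite {c1'}cE; set x := m _.
have hu n z : le1 (phi n z * ((\prod_(a <- (c1, f1) :: L) a.2 (act (a.1 * n%:Z) z))
    * f (act (c * n%:Z) z))) by auto 7.
have := vdc hm (ballP f0) hu H0; rewrite -/x => {hu} xy.
pose G (d : int) (g : ball R S) h h' :=
  ballM (ball_comp (act (d * h%:Z)) g) (ballJ (ball_comp (act (d * h'%:Z)) g)).
pose L' h h' := [seq (a.1 - c1, G a.1 a.2 h h') | a <- L].
pose y h h' := m (fun n => E (fun x => G c1 f1 h h' x *
  (ballM (phi (n + h)%N) (ballJ (phi (n + h')%N)) x *
   ((\prod_(a <- L' h h') a.2 (act (a.1 * n%:Z) x)) *
   G c f h h' (act ((c - c1) * n%:Z) x))))).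
have hy n h h' z : le1 (G c1 f1 h h' z *
  (ballM (phi (n + h)%N) (ballJ (phi (n + h')%N)) z *
   ((\prod_(a <- L' h h') a.2 (act (a.1 * n%:Z) z)) *
   G c f h h' (act ((c - c1) * n%:Z) z)))) by auto 9.
have {}xy : x ^+ 2 <= av H (fun h => av H (y h)).
  apply: le_trans xy _; rewrite le_eqVlt; apply/orP; left; apply/eqP.
  apply: eq_av => h _; apply: eq_av => h' _.
  apply: (mean_act_eq _ (a := fun n => c1 * n%:Z)) => [n z|n z]; first exact: hy.
  have GE d g : G d g h h' (act ((d - c1) * n%:Z) (act (c1 * n%:Z) z)) =
      g (act (d * (n + h)%N%:Z) z) * (g (act (d * (n + h')%N%:Z) z))^J.
    by rewrite /G /= -!actD; congr (g (act _ z) * (g (act _ z))^J); rewrite PoszD; ring.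
  have G1 : G c1 f1 h h' (act (c1 * n%:Z) z) =
      f1 (act (c1 * (n + h)%N%:Z) z) * (f1 (act (c1 * (n + h')%N%:Z) z))^J.
    by rewrite -GE subrr mul0r act0.
  have pL : \prod_(a <- L' h h') a.2 (act (a.1 * n%:Z) (act (c1 * n%:Z) z)) =
     \prod_(a <- L) a.2 (act (a.1 * (n + h)%N%:Z) z) *
     (\prod_(a <- L) a.2 (act (a.1 * (n + h')%N%:Z) z))^J.
    rewrite big_map rmorph_prod -big_split; apply: eq_bigr => a _; exact: GE.
  rewrite G1 GE pL !big_cons /= !rmorphM /= !hphi; ring.
have y1 h h' : `|y h h'| <= 1.
  by apply: mean_norm => n; apply: cmean_norm => z; apply: hy.
rewrite expnS exprM.
apply: (@le_trans _ _ (av H (fun h => av H (fun h' => K * Box (nseq s.+2 H) (G c f h h'))))).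
  apply: (@le_trans _ _ (av H (fun h => av H (y h)) ^+ (2 ^ s.+2))).
    by rewrite lerXn2r ?nnegrE ?sqr_ge0 // (le_trans _ xy) ?sqr_ge0.
  rewrite -(unifE _ H0); apply: le_trans (mean_exp2 _ _ _) _.
    by exists 1 => h; rewrite -unifE //; apply: mean_norm.
  rewrite unifE //; apply: le_av => h _.
  rewrite -(unifE _ H0); apply: le_trans (mean_exp2 _ _ _) _; first by exists 1.
  rewrite unifE //; apply: le_av => h' _.
  apply: hK => //; last by move=> n a z; rewrite /= !hphi.
  by rewrite -Lcs -!map_comp; apply: eq_map.
under eq_av => h _ do rewrite avZ.
rewrite avZ -mulrA ler_wpM2l ?(ltW K0) //.
apply: le_trans (@Box_step _ S c H H (nseq s.+1 H) f c0 H0 (ballP f)) _.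
rewrite ler_wpM2l ?exprn_ge0 //; apply: (@Box_mono _ _ (_ :: nseq s.+2 H) (nseq s.+3 H) f (ballP f)).
- by rewrite /= size_nseq.
- by rewrite /= muln_gt0 H0 all_nseq H0 !andbT orbT andbT; lia.
- rewrite /= dvdn_mull ?dvdnn //=.
  by elim: s {sE IH hK} => //= s ->; rewrite andbT.
Qed.

End Family.

(** * Reduction of polynomial exponents to linear ones *)

Section Shift.
Implicit Types p q : {poly int}.

Definition shp (h : nat) p := p \Po ('X + (h%:Z)%:P).

Lemma horner_shp h p (n : nat) : (shp h p).[n%:Z] = p.[(n + h)%N%:Z].
Proof. by rewrite horner_comp !hornerE PoszD. Qed.

Lemma size_shp h p : size (shp h p) = size p.
Proof. by rewrite size_comp_poly2 // size_XaddC. Qed.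

Lemma lead_shp h p : lead_coef (shp h p) = lead_coef p.
Proof. by rewrite lead_coef_comp ?size_XaddC // lead_coefXaddC expr1n mulr1. Qed.

Lemma shpB h p q : shp h (p - q) = shp h p - shp h q.
Proof. exact: raddfB. Qed.

Lemma coef_XaddC_exp (c : int) i d :
  (('X + c%:P) ^+ i)`_d = c ^+ (i - d) *+ 'C(i, d).
Proof.
rewrite addrC exprDn coef_sum.
have E (j : 'I_i.+1) : ((c%:P ^+ (i - j) * 'X^j) *+ 'C(i, j))`_d =
    if (nat_of_ord j == d) then c ^+ (i - d) *+ 'C(i, d) else 0.
  rewrite coefMn -polyC_exp coefCM coefXn eq_sym.
  by case: eqP => [->|_]; rewrite ?mulr1 // mulr0 mul0rn.
under eq_bigr => j _ do rewrite E.
have [di|di] := ltnP i d.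
  rewrite bin_small // mulr0n; apply: big1 => j _; case: eqP => [jd|//].
  by rewrite -jd ltnNge -ltnS (valP j) in di.
rewrite (bigD1 (Ordinal (di : d < i.+1)%N)) //= eqxx big1 ?addr0 // => j.
by rewrite -val_eqE /= => /negbTE ->.
Qed.

Lemma coef_shp_pred h p d : (size p <= d.+2)%N ->
  (shp h p)`_d = p`_d + p`_d.+1 * (h%:Z *+ d.+1).
Proof.
move=> sp; rewrite /shp coef_comp_poly.
have -> : \sum_(i < size p) p`_i * (('X + h%:Z%:P) ^+ i)`_d =
          \sum_(i < d.+2) p`_i * (('X + h%:Z%:P) ^+ i)`_d.
  rewrite (big_ord_widen _ (fun i : nat => p`_i * (('X + h%:Z%:P) ^+ i)`_d) sp).
  rewrite big_mkcond /=; apply: eq_bigr => i _; case: ltnP => // hi.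
  by rewrite nth_default ?mul0r.
rewrite 2!big_ord_recr /= big1 ?add0r => [|i _]; last first.
  by rewrite coef_XaddC_exp bin_small // mulr0n mulr0.
rewrite !coef_XaddC_exp subnn binn expr0 mulr1n mulr1.
by rewrite subSnn expr1 binSn.
Qed.

Lemma size_shpB h h' p : h != h' -> (1 < size p)%N ->
  size (shp h p - shp h' p) = (size p).-1.
Proof.
move=> hh; case sp: (size p) => [|[|d]] // _ /=.
apply/eqP; rewrite eqn_leq; apply/andP; split.
  apply/leq_sizeP => j dj; rewrite coefB.
  have [jd|jd] := eqVneq j d.+1; last first.
    by rewrite !nth_default ?subrr // size_shp sp; lia.
  have := lead_shp h p; have := lead_shp h' p.
  by rewrite /lead_coef !size_shp sp /= jd => -> ->; rewrite subrr.
rewrite ltnNge; apply/negP => /leq_sizeP /(_ d (leqnn d)).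
rewrite coefB !coef_shp_pred ?sp //.
have : p`_d.+1 != 0 by have := lead_coef_eq0 p; rewrite /lead_coef sp /= => ->;
  rewrite -size_poly_eq0 sp.
rewrite -[h%:Z *+ _]mulr_natr -[h'%:Z *+ _]mulr_natr.
have : d.+1%:R != 0 :> int by rewrite pnatr_eq0.
move: p`_d.+1 p`_d (d.+1%:R) => a b D D0 a0 /eqP; apply/negP.
have -> : b + a * (h%:Z * D) - (b + a * (h'%:Z * D)) = a * ((h%:Z - h'%:Z) * D) by ring.
by rewrite !mulf_neq0 // subr_eq0.
Qed.

Lemma size_subl p q : (size q < size p)%N -> size (p - q) = size p /\ lead_coef (p - q) = lead_coef p.
Proof.
by move=> h; rewrite size_polyDl ?size_polyN // lead_coefDl ?size_polyN.
Qed.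

Lemma size_sub_eq p q : size p = size q -> lead_coef p != lead_coef q ->
  size (p - q) = size p /\ lead_coef (p - q) = lead_coef p - lead_coef q.
Proof.
move=> spq lpq.
have c0 : (p - q)`_(size p).-1 != 0.
  by rewrite coefB {2}spq subr_eq0.
have sz : size (p - q) = size p.
  apply/eqP; rewrite eqn_leq; apply/andP; split.
    by apply: leq_trans (size_polyD _ _) _; rewrite size_polyN -spq maxnn.
  case: (size p) c0 => // n; rewrite ltnNge /=; apply: contra => /leq_sizeP h.
  by rewrite h.
by split=> //; rewrite /lead_coef sz coefB {2}spq.
Qed.

Lemma size_sub_lt p q : size p = size q -> lead_coef p = lead_coef q -> p != 0 ->
  (size (p - q)%R < size p)%N.
Proof.
move=> spq lpq p0; rewrite -[size p]prednK ?size_poly_gt0 // ltnS.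
apply/leq_sizeP => j hj; rewrite coefB.
have [->|jd] := eqVneq j (size p).-1.
  by rewrite {2}spq; apply/eqP; rewrite subr_eq0; apply/eqP.
have hj' : (size p <= j)%N by move/eqP: jd; lia.
by rewrite !nth_default ?subrr // -spq.
Qed.

End Shift.

(** Lexicographic induction on the sequence of weights, read from index [B] down. *)
Lemma lex_ind (T : Type) (w : T -> nat -> nat) (B : nat) (P : T -> Prop) :
  (forall t, (forall t', (exists e, [/\ (e <= B)%N, (w t' e < w t e)%N &
       forall e', (e < e' <= B)%N -> (w t' e' <= w t e')%N]) -> P t') -> P t) ->
  forall t, P t.
Proof.
elim: B P => [|B IHB] P hP.
  suff h n t : (w t 0%N < n)%N -> P t by move=> t; apply: (h (w t 0%N).+1).
  elim: n t => [|n IH] t // ht; apply: hP => t' [[|e] [] // _ hlt _].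
  by apply: IH; lia.
suff h n t : (w t B.+1 < n)%N -> P t by move=> t; apply: (h (w t B.+1).+1).
elim: n t => [|n IH] // t; apply: (IHB (fun t => (w t B.+1 < n.+1)%N -> P t)) => {}t.
move=> ht htn; apply: hP => t' [e [eB hlt hle]].
have [eq_e|ne_e] := eqVneq e B.+1; first by apply: IH; rewrite eq_e in hlt; lia.
have hB : (w t' B.+1 <= w t B.+1)%N by apply: hle; move/eqP: ne_e; lia.
apply: ht; last by lia.
by exists e; split=> //; [move/eqP: ne_e; lia | move=> e' he'; apply: hle; lia].
Qed.

Section PET.
Variable R : realType.
Local Notation C := R[i].
Variable S : system R.
Local Notation E := (cmean (smean S)).
Local Notation fam := (seq ({poly int} * ball R S)).
Implicit Types (f : ball R S) (F : fam) (q r p : {poly int}) (phi : nat -> ball R S).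
Variable m : mean R nat.
Hypothesis m_inv : shift_invariant m.

Definition polyavg (phi : nat -> ball R S) f0 F q f : R :=
  m (fun n => E (fun x => f0 x * (phi n x * (prodF F n x * f (act q.[n%:Z] x))))).

Definition nonconst p := (1 < size p)%N.

(** Functions with constant exponents do not vary with [n] and join [f0]. *)
Lemma polyavg_absorb phi f0 F q f : exists f0',
  polyavg phi f0 F q f = polyavg phi f0' [seq a <- F | nonconst a.1] q f.
Proof.
pose f1 (x : S) := \prod_(a <- F | ~~ nonconst a.1) a.2 (act a.1.[0] x).
have hf x : le1 (f0 x * f1 x) by rewrite /f1; auto.
exists (Ball hf); apply: eq_mean => n; apply: eq_cmean => x /=.
rewrite /prodF (bigID (fun a => nonconst a.1)) /= -big_filter.
have -> : \prod_(a <- F | ~~ nonconst a.1) a.2 (act a.1.[n%:Z] x) = f1 x.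
  apply: eq_bigr => a; rewrite /nonconst -leqNgt => /size1_polyC ->.
  by rewrite !hornerC.
by ring.
Qed.

(** The exponents met after van der Corput's inequality with shifts [h] and [h'] and
    a translation by minus [r]. *)
Definition vdc_family F q r h h' f : fam :=
  [seq (shp h a.1 - shp h' r, a.2) | a <- F] ++
  [seq (shp h' a.1 - shp h' r, ballJ a.2) | a <- F] ++
  [:: (shp h' q - shp h' r, ballJ f)].

(** The pairs of shifts to be avoided are too few to carry the whole average. *)
Lemma vdc_polyavg phi f0 F q r f (bad : rel nat) K :
  (forall n, invariant (phi n)) -> 0 < polyavg phi f0 F q f ->
  (forall H h', (count (fun h => bad h h') (iota 0 H) <= K)%N) ->
  exists h h', ~~ bad h h' /\
    0 < polyavg (fun n => ballM (phi (n + h)%N) (ballJ (phi (n + h')%N))) ball1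
          (vdc_family F q r h h' f) (shp h q - shp h' r) f.
Proof.
move=> hphi; set e := polyavg _ _ _ _ _ => e0 hK.
pose y h h' := polyavg (fun n => ballM (phi (n + h)%N) (ballJ (phi (n + h')%N))) ball1
          (vdc_family F q r h h' f) (shp h q - shp h' r) f.
have y1 h h' : y h h' <= 1.
  apply: mean_le => [|n]; first by apply: bdd_cmean => n x; auto 8.
  by apply: cmean_le1 => x; auto 8.
have [//|hn] := pselect (exists h h', ~~ bad h h' /\ 0 < y h h').
have yle h h' : y h h' <= (bad h h')%:R.
  case bh: (bad h h'); first exact: y1.
  by rewrite leNgt; apply/negP => y0; apply: hn; exists h, h'; rewrite bh.
have hK' H h' : (\sum_(i < H) bad i h' <= K)%N.
  apply: leq_trans (hK H h'); apply: eq_leq; rewrite -sum1_count [RHS]big_mkcond /=.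
  rewrite -(big_mkord xpredT (fun i => bad i h' : nat)) /index_iota subn0.
  by apply: eq_bigr => i _; case: (bad i h').
pose H := (Num.bound (K%:R / e ^+ 2)).+1.
have H0 : (0 < H)%N by [].
have hu n x : le1 (phi n x * (prodF F n x * f (act q.[n%:Z] x))) by auto.
have := vdc m_inv (ballP f0) hu H0; rewrite -/(polyavg phi f0 F q f) -/e.
have -> : av H (fun h => av H (fun h' => m (fun n => E (fun x =>
     phi (n + h)%N x * (prodF F (n + h) x * f (act q.[(n + h)%N%:Z] x)) *
    (phi (n + h')%N x * (prodF F (n + h') x * f (act q.[(n + h')%N%:Z] x)))^J)))) =
  av H (fun h => av H (y h)).
  apply: eq_av => h _; apply: eq_av => h' _.
  apply: (mean_act_eq _ (a := fun n => (shp h' r).[n%:Z])) => [n x|n x]; first by auto 8.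
  have A g p : act (shp g p - shp h' r).[n%:Z] (act (shp h' r).[n%:Z] x) =
      act p.[(n + g)%N%:Z] x.
    by rewrite -actD hornerD hornerN addrNK horner_shp.
  have e1 : prodF [seq (shp h a.1 - shp h' r, a.2) | a <- F] n
      (act (shp h' r).[n%:Z] x) = prodF F (n + h) x.
    by rewrite /prodF big_map; apply: eq_bigr => a _; rewrite /= A.
  have e2 : prodF [seq (shp h' a.1 - shp h' r, ballJ a.2) | a <- F] n
      (act (shp h' r).[n%:Z] x) = (prodF F (n + h') x)^J.
    by rewrite /prodF big_map rmorph_prod; apply: eq_bigr => a _; rewrite /= A.
  have e3 : prodF [:: (shp h' q - shp h' r, ballJ f)] n (act (shp h' r).[n%:Z] x)
     = (f (act q.[(n + h')%N%:Z] x))^J by rewrite /prodF big_seq1 /= A.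
  by rewrite /= !hphi !prodF_cat e1 e2 e3 A !rmorphM /=; ring.
move=> hle; have e20 : 0 < e ^+ 2 by rewrite exprn_gt0.
have : e ^+ 2 <= K%:R / H%:R.
  apply: le_trans hle _.
  apply: (@le_trans _ _ (av H (fun h => av H (fun h' => (bad h h')%:R)))).
    by apply: le_av => h _; apply: le_av => h' _.
  rewrite exchange_av; apply: av_le => // h' _.
  by rewrite /av ler_wpM2r ?invr_ge0 // -natr_sum ler_nat.
rewrite ler_pdivlMr // mulrC -ler_pdivlMr //.
have := @archi_boundP R (K%:R / e ^+ 2); rewrite divr_ge0 ?(ltW e20) // => /(_ isT).
by rewrite /H -natr1; lra.
Qed.

Lemma count_le1 (T : eqType) (P : pred T) (s : seq T) : uniq s ->
  (forall x y, P x -> P y -> x = y) -> (count P s <= 1)%N.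
Proof.
move=> us h; rewrite -size_filter; have := filter_uniq P us.
have : all P (seq.filter P s) by apply: filter_all.
case: (seq.filter P s) => [|x [|y t]] //= /and3P[px py _].
by rewrite (h x y) // inE eqxx.
Qed.

Lemma count_has_le (T T' : Type) (P : T' -> pred T) (s : seq T) (l : seq T') :
  (forall i, count (P i) s <= 1)%N ->
  (count (fun x => has (fun i => P i x) l) s <= size l)%N.
Proof.
move=> h; elim: l => [|i l IH] /=; first by rewrite count_pred0.
apply: leq_trans (_ : count (P i) s + count (fun x => has (fun i => P i x) l) s <= _)%N.
  by rewrite -count_predUI leq_addr.
by rewrite -add1n leq_add.
Qed.

Lemma seq_min (T : eqType) (w : T -> nat) (s : seq T) : s != [::] ->
  exists2 x, x \in s & forall y, y \in s -> (w x <= w y)%N.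
Proof.
elim: s => [|x s IH] // _; have [s0|/IH[y ys hy]] := eqVneq s [::].
  by exists x; rewrite ?inE ?eqxx // s0 => y; rewrite inE => /eqP ->.
have [xy|yx] := leqP (w x) (w y).
  exists x; rewrite ?inE ?eqxx // => z; rewrite inE => /orP[/eqP -> //|/hy]; lia.
by exists y; rewrite ?inE ?ys ?orbT // => z; rewrite inE => /orP[/eqP -> |/hy //]; lia.
Qed.

Definition leads (e : nat) (P : seq {poly int}) :=
  [seq lead_coef p | p <- P & size p == e].

Lemma leadsP e (P : seq {poly int}) a :
  reflect (exists2 p, p \in P & size p = e /\ lead_coef p = a) (a \in leads e P).
Proof.
apply: (iffP mapP) => [[p]|[p pP [sp lp]]].
  by rewrite mem_filter => /andP[/eqP sp pP] ->; exists p.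
by exists p; rewrite // mem_filter sp eqxx.
Qed.

Lemma vdc_family_mem F q r h h' f p :
  p \in map fst (vdc_family F q r h h' f) ->
  exists2 a, a \in q :: map fst F &
    (p = shp h' a - shp h' r) \/ (a \in map fst F /\ p = shp h a - shp h' r).
Proof.
rewrite /vdc_family !map_cat !mem_cat -!map_comp => /orP[|/orP[]].
- move=> pF; have /mapP[a aF ->] : p \in map (fun a => shp h a - shp h' r) (map fst F).
    by rewrite -map_comp.
  by exists a; rewrite ?inE ?aF ?orbT //; right.
- move=> pF; have /mapP[a aF ->] : p \in map (fun a => shp h' a - shp h' r) (map fst F).
    by rewrite -map_comp.
  by exists a; rewrite ?inE ?aF ?orbT //; left.
- by rewrite inE => /eqP ->; exists q; rewrite ?inE ?eqxx //; left.
Qed.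

Lemma pet_linear F q phi f0 f : size q = 2 ->
  {in map fst F, forall p, size p <= size q}%N ->
  {in map fst F, forall p, nonconst (q - p)} ->
  (forall n, invariant (phi n)) -> 0 < polyavg phi f0 F q f -> ctrl f.
Proof.
move=> sq hsz hnc hphi hpos.
have hor p (x : int) : (size p <= 2)%N -> p.[x] = p`_1 * x + p`_0.
  move=> sp; rewrite (horner_coef_wide _ sp) big_ord_recl big_ord1 /=.
  by rewrite expr0 expr1 mulr1 addrC.
pose cs := [seq p`_1 | p : {poly int} <- map fst F].
have q1 : q`_1 != 0 by have := lead_coef_eq0 q; rewrite /lead_coef sq /= => ->;
  rewrite -size_poly_eq0 sq.
have qcs : q`_1 \notin cs.
  apply/negP => /mapP[p pF qp]; have := hnc p pF.
  rewrite /nonconst ltnNge => /negP; apply; apply/leq_sizeP => -[//|[|j]] _.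
    by rewrite coefB qp subrr.
  by rewrite coefB !nth_default ?subrr ?sq // (leq_trans (hsz p pF)) ?sq.
have [K K0 hK] := linear_bound S m_inv q1 qcs.
exists (size cs), (polyavg phi f0 F q f ^+ (2 ^ (size cs).+2) / K).
  by rewrite divr_gt0 // exprn_gt0.
move=> H H0; rewrite ler_pdivrMr // mulrC.
pose L := [seq (a.1`_1, ball_comp (act a.1`_0) a.2) | a : {poly int} * ball R S <- F].
have Lcs : map fst L = cs by rewrite /cs /L -!map_comp.
rewrite -(Box_act _ q`_0 (ballP f)).
apply: le_trans (hK L phi f0 (ball_comp (act q`_0) f) H Lcs hphi H0).
rewrite le_eqVlt; apply/orP; left; apply/eqP; congr (_ ^+ _).
apply: eq_mean => n; apply: eq_cmean => x; rewrite /prodF big_map /=.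
congr (_ * (_ * (_ * _))); last by rewrite -actD hor ?sq // addrC.
have {}hsz : {in map fst F, forall p, size p <= 2}%N by move=> p /hsz; rewrite sq.
elim: (F) hsz => [|a F' IH] hsz; first by rewrite !big_nil.
rewrite !big_cons /= -actD hor; last by apply: hsz; rewrite inE eqxx.
by rewrite IH 1?addrC // => p pF; apply: hsz; rewrite inE pF orbT.
Qed.

(** Induction on the numbers of leading coefficients of each degree, ordered
    lexicographically from the highest degree down: subtracting a polynomial of
    minimal degree removes its class and changes no class of higher degree.
    When only the class of the distinguished polynomial is left, subtracting the
    latter lowers the degree. *)
Lemma pet_maximal D F q phi f0 f : size q = D.+2 ->
  {in map fst F, forall p, size p <= size q}%N ->
  {in map fst F, forall p, nonconst (q - p)} ->
  (forall n, invariant (phi n)) -> 0 < polyavg phi f0 F q f -> ctrl f.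
Proof.
elim: D F q phi f0 f => [|D IHD]; first exact: pet_linear.
move=> F q phi f0 f.
pose w (t : fam * {poly int}) e := size (undup (leads e (t.2 :: map fst t.1))).
suff main : forall (t : fam * {poly int}) phi f0, size t.2 = D.+3 ->
    {in map fst t.1, forall p, size p <= size t.2}%N ->
    {in map fst t.1, forall p, nonconst (t.2 - p)} ->
    (forall n, invariant (phi n)) -> 0 < polyavg phi f0 t.1 t.2 f -> ctrl f.
  exact: (main (F, q)).
apply: (lex_ind (w := w) (B := D.+3)) => {F q phi f0}.
move=> [F q] IH phi f0 /= sq hsz hnc hphi.
have [f0' ->] := polyavg_absorb phi f0 F q f.
set F1 := seq.filter _ F => hpos.

have mF1 : map fst F1 = seq.filter nonconst (map fst F) by rewrite filter_map.
have nF1 p : p \in map fst F1 -> nonconst p /\ p \in map fst F.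
  by rewrite mF1 mem_filter => /andP.
set P1 := q :: map fst F1.
pose bad h h' := has (fun p => ~~ nonconst (shp h q - shp h' p)) P1.
have hbad H h' : (count (fun h => bad h h') (iota 0 H) <= size P1)%N.
  apply: count_has_le => p; apply: count_le1 => [|h1 h2]; first exact: iota_uniq.
  rewrite /nonconst -!leqNgt => s1 s2; apply/eqP; apply/negPn/negP => h12.
  have := size_shpB h12 (_ : 1 < size q)%N; rewrite sq => /(_ isT) /=.
  have -> : shp h1 q - shp h2 q = (shp h1 q - shp h' p) - (shp h2 q - shp h' p) by ring.
  move=> sz; have := size_polyD (shp h1 q - shp h' p) (- (shp h2 q - shp h' p)).
  by rewrite sz size_polyN leq_max => /orP[] h; [have := leq_trans h s1|have := leq_trans h s2].
have good r h h' : ~~ bad h h' ->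
  {in map fst (vdc_family F1 q r h h' f), forall p, nonconst (shp h q - shp h' r - p)}.
  move=> nb p /vdc_family_mem[a aP [->|[aF ->]]].
    rewrite (_ : _ - _ = shp h q - shp h' a); last by ring.
    by apply: contraNT nb => nc; apply/hasP; exists a.
  rewrite (_ : _ - _ = shp h (q - a)) ?shpB; last by ring.
  by rewrite -shpB /nonconst size_shp; apply: hnc; case: (nF1 a aF).
pose A := [seq p : {poly int} <- map fst F1 | (size p < size q)%N || (lead_coef p != lead_coef q)].
have szP1 a : a \in P1 -> (size a <= size q)%N.
  by rewrite inE => /orP[/eqP->//|/nF1[_ /hsz]].
have inv' h h' : forall n, invariant (ballM (phi (n + h)%N) (ballJ (phi (n + h')%N))).
  by move=> n a x; rewrite /= !hphi.
have [A0|/(seq_min (fun p : {poly int} => size p))[r rA rmin]] := eqVneq A [::].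
  have [h [h' [nb pos]]] := vdc_polyavg q hphi hpos hbad.
  have hh' : h != h'.
    apply: contraNneq nb => ->; apply/hasP; exists q; first by rewrite inE eqxx.
    by rewrite subrr /nonconst size_poly0.
  have sq' : size (shp h q - shp h' q) = D.+2 by rewrite size_shpB ?sq.
  apply: (IHD _ _ _ _ f sq' _ (good q h h' nb) (inv' h h') pos).
  have hA a : a \in P1 -> size a = size q /\ lead_coef a = lead_coef q.
    rewrite inE => /orP[/eqP->//|aF].
    have : a \notin A by rewrite A0.
    rewrite mem_filter aF andbT negb_or negbK -leqNgt => /andP[s1 /eqP s2].
    by split=> //; have := szP1 a; rewrite inE aF orbT; lia.
  move=> p /vdc_family_mem[a aP hp].
  have [g ->] : exists g, p = shp g a - shp h' q.
    by case: hp => [->|[_ ->]]; [exists h'|exists h].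
  have [sa la] := hA a aP.
  rewrite sq' -ltnS -sq -sa -(size_shp g a); apply: size_sub_lt.
  - by rewrite !size_shp.
  - by rewrite !lead_shp.
  - by rewrite -size_poly_eq0 size_shp sa sq.
have := rA; rewrite mem_filter => /andP[rq rF].
have rP a : a \in P1 -> (size r <= size a)%N.
  move=> aP; have := szP1 r; rewrite inE rF orbT => /(_ isT) rq1.
  have := aP; rewrite inE => /orP[/eqP->//|aF].
  have [/rmin//|] := boolP (a \in A).
  by rewrite mem_filter aF andbT negb_or -leqNgt => /andP[h _]; lia.
have [h [h' [nb pos]]] := vdc_polyavg r hphi hpos hbad.
have S1 g (a : {poly int}) : (size r < size a)%N ->
    size (shp g a - shp h' r) = size a /\ lead_coef (shp g a - shp h' r) = lead_coef a.
  by move=> ra; have := @size_subl (shp g a) (shp h' r); rewrite !size_shp lead_shp; apply.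
have S2 g (a : {poly int}) : size a = size r -> lead_coef a != lead_coef r ->
    size (shp g a - shp h' r) = size a /\
    lead_coef (shp g a - shp h' r) = lead_coef a - lead_coef r.
  by move=> ra la; have := @size_sub_eq (shp g a) (shp h' r);
    rewrite !size_shp !lead_shp; apply.
have S3 g (a : {poly int}) : size a = size r -> lead_coef a = lead_coef r ->
    (size (shp g a - shp h' r)%R < size r)%N.
  move=> ra la; have := @size_sub_lt (shp g a) (shp h' r).
  rewrite !size_shp !lead_shp ra; apply=> //.
  by rewrite -size_poly_eq0 size_shp ra; have [] := nF1 r rF; rewrite /nonconst; case: (size r).
have sq' : size (shp h q - shp h' r) = size q.
  have := szP1 r; rewrite inE rF orbT leq_eqVlt => /(_ isT) /orP[/eqP rq1|/S1 s1].
    move: rq; rewrite rq1 ltnn /= => lr.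
    by have [] := S2 h q; rewrite // eq_sym.
  by case: (s1 h).
have F'P p : p \in (shp h q - shp h' r) :: map fst (vdc_family F1 q r h h' f) ->
    exists g, exists2 a, a \in P1 & p = shp g a - shp h' r.
  rewrite inE => /orP[/eqP->|/vdc_family_mem[a aP hp]].
    by exists h, q; rewrite // inE eqxx.
  by case: hp => [->|[_ ->]]; [exists h', a|exists h, a].
apply: (IH (vdc_family F1 q r h h' f, shp h q - shp h' r) _ _ _ _ _ _ (inv' h h') pos) => /=.
- exists (size r); split.
  + by apply: leq_trans (szP1 r _) _; rewrite ?sq // inE rF orbT.
  + rewrite /w /=; set U := undup (leads _ (q :: map fst F)).
    have rU : lead_coef r \in U.
      rewrite mem_undup; apply/leadsP; exists r => //.
      by rewrite inE (proj2 (nF1 r rF)) orbT.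
    set U' := undup _.
    suff : (size [seq (x + lead_coef r)%R | x <- U'] <= size (rem (lead_coef r) U))%N.
      by rewrite size_map size_rem //; case: (U) rU => //= *; lia.
    apply: uniq_leq_size; first by rewrite map_inj_uniq ?undup_uniq //; apply: addIr.
    move=> y /mapP[x]; rewrite mem_undup => /leadsP[p /F'P[g [a aP ->]] [sz lz]] ->.
    rewrite (mem_rem_uniq _ (undup_uniq _)) inE /=.
    have := rP a aP; rewrite leq_eqVlt => /orP[/eqP ra|ra]; last first.
      by have [s1 _] := S1 g a ra; move: ra; rewrite -sz s1 ltnn.
    have [la|la] := eqVneq (lead_coef a) (lead_coef r).
      by have := S3 g a (esym ra) la; rewrite sz ltnn.
    have [s1 l1] := S2 g a (esym ra) la.
    rewrite -lz l1 addrNK la mem_undup; apply/leadsP; exists a => //.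
    by move: aP; rewrite !inE => /orP[->//|/nF1[_ ->]]; rewrite orbT.
  + move=> e' /andP[he' _]; rewrite /w /=; apply: uniq_leq_size (undup_uniq _) _.
    move=> y; rewrite !mem_undup => /leadsP[p /F'P[g [a aP ->]] [sz <-]].
    have := rP a aP; rewrite leq_eqVlt => /orP[/eqP ra|ra]; last first.
      have [s1 l1] := S1 g a ra; apply/leadsP; exists a; last by rewrite -sz s1 l1.
      by move: aP; rewrite !inE => /orP[->//|/nF1[_ ->]]; rewrite orbT.
    have [la|la] := eqVneq (lead_coef a) (lead_coef r).
      by have := S3 g a (esym ra) la; rewrite sz; lia.
    by have [s1 _] := S2 g a (esym ra) la; move: he'; rewrite -sz s1 -ra ltnn.
- by rewrite sq'.
- move=> p pF; have [|g [a aP ->]] := F'P p; first by rewrite inE pF orbT.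
  rewrite sq'; apply: leq_trans (size_polyD _ _) _.
  by rewrite size_polyN !size_shp geq_max !szP1 // inE rF orbT.
- exact: good.
Qed.

(** A function attached to a polynomial of lower degree is brought to the highest
    degree by translating by minus a polynomial of highest degree. *)
Lemma pet F q phi f0 f : nonconst q ->
  {in map fst F, forall p, nonconst (q - p)} ->
  (forall n, invariant (phi n)) -> 0 < polyavg phi f0 F q f -> ctrl f.
Proof.
move=> nq hnc hphi hpos.
have sz2 p : nonconst p -> exists D, size p = D.+2.
  by rewrite /nonconst; case: (size p) => [|[|D]] // _; exists D.
have [/(seq_min (fun p : {poly int} => (\max_(r <- map fst F) size r) - size p)%N)|F0] :=
   boolP (map fst F != [::]); last first.
  have [D sq] := sz2 q nq; apply: (pet_maximal sq _ hnc hphi hpos).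
  by move: F0; rewrite negbK => /eqP->.
move=> [r rF hr].
have {}hr p : p \in map fst F -> (size p <= size r)%N.
  move=> pF; have := hr p pF.
  have h1 := @leq_bigmax_seq _ (map fst F) xpredT (fun r : {poly int} => size r) p pF isT.
  move: h1; set B := (\max_(r <- _) _)%N; move: (size p) (size r) => a b; lia.
have [rq|qr] := leqP (size r) (size q).
  have [D sq] := sz2 q nq; apply: (pet_maximal sq _ hnc hphi hpos).
  by move=> p /hr; lia.
have sqr : size (q - r) = size r.
  by rewrite -size_polyN opprB; case: (size_subl qr).
pose G : fam := (- r, f0) :: [seq (a.1 - r, a.2) | a <- F].
have [D sD] : exists D, size (q - r) = D.+2 by rewrite sqr; case: (size r) qr nq => [|[|D]] //; [rewrite /nonconst; lia|exists D].
apply: (@pet_maximal D G (q - r) phi ball1 f sD) => //.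
- move=> p /=; rewrite inE => /orP[/eqP->|]; first by rewrite size_polyN sqr.
  rewrite -map_comp => pF; have /mapP[a aF ->] : p \in map (fun a => a - r) (map fst F).
    by rewrite -map_comp.
  apply: leq_trans (size_polyD _ _) _; rewrite size_polyN sqr geq_max leqnn andbT.
  exact: hr.
- move=> p /=; rewrite inE => /orP[/eqP->|]; first by rewrite opprK subrK.
  rewrite -map_comp => pF; have /mapP[a aF ->] : p \in map (fun a => a - r) (map fst F).
    by rewrite -map_comp.
  have -> : q - r - (a - r) = q - a by ring.
  exact: hnc a aF.
have <- : polyavg phi f0 F q f = polyavg phi ball1 G (q - r) f; last exact: hpos.
apply: (mean_act_eq _ (a := fun n => r.[n%:Z])) => [n x|n x]; first by auto 8.
rewrite /= /G prodF_cons /= hphi -!actD !hornerD !hornerN addNr act0 addrNK.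
have -> : prodF [seq (a.1 - r, a.2) | a <- F] n (act r.[n%:Z] x) = prodF F n x.
  rewrite /prodF big_map; apply: eq_bigr => a _.
  by rewrite /= -actD hornerD hornerN addrNK.
by ring.
Qed.

End PET.

(** * Limits along convex combinations *)

Section NearMinimizers.
Variable R : realType.
Local Notation C := R[i].
Variables (X : Type) (m : mean R X).
Implicit Types f g : X -> C.

Definition mix (t : R) f g : X -> C := fun x => t%:C * f x + (1 - t)%:C * g x.

Inductive conv (B : (X -> C) -> Prop) : (X -> C) -> Prop :=
| conv_base f of B f : conv B f
| conv_mix t f g of 0 <= t <= 1 & conv B f & conv B g : conv B (mix t f g).

Lemma le1_mix t f g x : 0 <= t <= 1 -> le1 (f x) -> le1 (g x) -> le1 (mix t f g x).
Proof.
move=> /andP[t0 t1] hf hg; apply: le_trans (le_normcD _ _) _.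
rewrite !normcM !normc_real !ger0_norm ?subr_ge0 //.
have h1 : t * normc (f x) <= t * 1 by rewrite ler_wpM2l.
have h2 : (1 - t) * normc (g x) <= (1 - t) * 1 by rewrite ler_wpM2l // subr_ge0.
by lra.
Qed.

Lemma le1_conv (B : (X -> C) -> Prop) : (forall f, B f -> forall x, le1 (f x)) ->
  forall f, conv B f -> forall x, le1 (f x).
Proof. by move=> hB f; elim=> [|t {}f g ht _ IHf _ IHg x]; [exact: hB | exact: le1_mix]. Qed.

Lemma conv_mono (B B' : (X -> C) -> Prop) : (forall f, B f -> B' f) ->
  forall f, conv B f -> conv B' f.
Proof. by move=> h f; elim=> *; [apply: conv_base; auto | apply: conv_mix]. Qed.

Lemma conv_le (P : Type) (m' : mean R P) (r : P -> X) (G : P -> C) (B : (X -> C) -> Prop) a :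
  (forall f, B f -> forall x, le1 (f x)) -> (forall p, le1 (G p)) ->
  (forall f, B f -> cmean m' (fun p => f (r p) * G p) <= a) ->
  forall f, conv B f -> cmean m' (fun p => f (r p) * G p) <= a.
Proof.
move=> hB hG ha f; elim=> [|t {}f g ht hf IHf hg IHg]; first exact: ha.
have lf x : le1 (f x) := le1_conv hB hf x.
have lg x : le1 (g x) := le1_conv hB hg x.
rewrite /cmean (eq_mean _ (g := fun p => t * Re (f (r p) * G p) + (1 - t) * Re (g (r p) * G p))).
  rewrite mean_lin; [|bd|bd]; rewrite meanZ; last bd.
  case/andP: ht => t0 t1.
  have h1 := ler_wpM2l t0 IHf.
  have t2 : 0 <= 1 - t by rewrite subr_ge0.
  have h2 := ler_wpM2l t2 IHg.
  by rewrite /cmean in h1 h2; lra.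
by move=> p; rewrite /mix mulrDl -!mulrA ReD !Re_scale.
Qed.

Definition nrm2 f : R := m (fun x => normc (f x) ^+ 2).

Lemma normcB_sqr (z w : C) :
  normc (z - w) ^+ 2 = normc z ^+ 2 + normc w ^+ 2 - 2 * Re (z * w^J).
Proof. by rewrite Re_mulJ !normc_sqr; case: z => a b; case: w => c d /=; ring. Qed.

Lemma normc_mix_sqr (t : R) (z w : C) :
  normc (t%:C * z + (1 - t)%:C * w) ^+ 2 =
  normc w ^+ 2 + 2 * t * (Re (z * w^J) - normc w ^+ 2) + t ^+ 2 * normc (z - w) ^+ 2.
Proof. by rewrite Re_mulJ !normc_sqr; case: z => a b; case: w => c d /=; ring. Qed.

Lemma nrm2_ge0 f : (forall x, le1 (f x)) -> 0 <= nrm2 f.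
Proof. by move=> hf; apply: mean_ge0 => [|x]; [bd | exact: sqr_ge0]. Qed.

Lemma nrm2_le1 f : (forall x, le1 (f x)) -> nrm2 f <= 1.
Proof.
by move=> hf; apply: mean_le => [|x]; [bd | rewrite exprn_ile1 ?normc_ge0 //; apply: hf].
Qed.

Lemma nrm2_mix t f g : (forall x, le1 (f x)) -> (forall x, le1 (g x)) ->
  nrm2 (mix t f g) = nrm2 g + 2 * t * (cmean m (fun x => f x * (g x)^J) - nrm2 g)
     + t ^+ 2 * m (fun x => normc (f x - g x) ^+ 2).
Proof.
move=> hf hg; rewrite /nrm2 (eq_mean _ (g := fun x => _) (fun x => normc_mix_sqr _ _ _)).
rewrite meanD; [|bd|bd]; rewrite meanD; [|bd|bd]; rewrite !meanZ; [|bd|bd].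
by rewrite meanB //; bd.
Qed.

Lemma nrm2B f g : (forall x, le1 (f x)) -> (forall x, le1 (g x)) ->
  m (fun x => normc (f x - g x) ^+ 2) = nrm2 f + nrm2 g - 2 * cmean m (fun x => f x * (g x)^J).
Proof.
move=> hf hg; rewrite (eq_mean _ (g := fun x => _) (fun x => normcB_sqr _ _)).
rewrite meanB; [|bd|bd]; rewrite meanD; [|bd|bd]; by rewrite meanZ //; bd.
Qed.

(** Near-minimizers of the norm on a decreasing sequence of convex sets form a
    Cauchy sequence, by the parallelogram identity; moving from a near-minimizer
    towards another point of the set cannot decrease the norm, which bounds the
    inner product of the two from below. *)
Lemma near_minimizers (K : nat -> (X -> C) -> Prop) :
  (forall r f, K r.+1 f -> K r f) -> (forall r f, K r f -> forall x, le1 (f x)) ->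
  (forall r t f g, 0 <= t <= 1 -> K r f -> K r g -> K r (mix t f g)) ->
  (forall r, exists f, K r f) ->
  exists (w : nat -> X -> C) (rho : nat -> R),
  [/\ forall r, K r (w r),
      forall e, 0 < e -> exists r0, forall r, (r0 <= r)%N -> rho r <= e,
      forall r s, (r <= s)%N -> m (fun x => normc (w s x - w r x) ^+ 2) <= rho r,
      forall r v, K r v -> nrm2 (w r) - rho r <= cmean m (fun x => v x * (w r x)^J) &
      forall r v, K r v -> nrm2 v <= nrm2 (w r) ->
        m (fun x => normc (v x - w r x) ^+ 2) <= rho r].
Proof.
move=> Kdec K1 Kmix Kne.
have Kle r s f : (r <= s)%N -> K s f -> K r f.
  by move=> /subnK <-; elim: (s - r)%N => // n IH /Kdec.
pose A r := [set nrm2 f | f in K r]%classic.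
have An r : (A r !=set0)%classic by have [f hf] := Kne r; exists (nrm2 f), f.
have Alb r : has_lbound (A r) by exists 0 => _ [f hf <-]; exact: nrm2_ge0 (K1 r f hf).
pose d r := inf (A r).
have dle r f : K r f -> d r <= nrm2 f by move=> hf; apply: ge_inf => //; exists f.
have dmono r s : (r <= s)%N -> d r <= d s.
  move=> rs; apply: lb_le_inf => // _ [f hf <-]; apply: dle; exact: Kle rs hf.
have d1 r : d r <= 1.
  by have [f hf] := Kne r; apply: le_trans (dle r f hf) (nrm2_le1 (K1 r f hf)).
pose t r : R := r.+1%:R^-1.
have t0 r : 0 < t r by rewrite invr_gt0.
have t1 r : t r <= 1 by rewrite invf_le1 // ler1n.
have tmono r s : (r <= s)%N -> t s <= t r by move=> rs; rewrite lef_pV2 ?posrE // ler_nat.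
have /choice[w hw] : forall r, exists f, K r f /\ nrm2 f <= d r + t r ^+ 2.
  move=> r; have [_ [f hf <-] hlt] : exists2 x, A r x & x < inf (A r) + t r ^+ 2.
    by apply: inf_adherent; [rewrite exprn_gt0|split].
  by exists f; split=> //; apply: ltW.
have wK r : K r (w r) by case: (hw r).
have wd r : nrm2 (w r) <= d r + t r ^+ 2 by case: (hw r).
have w1 r x : le1 (w r x) := K1 r _ (wK r) x.
pose D := sup [set d r | r in [set: nat]]%classic.
have Dub : has_ubound [set d r | r in [set: nat]]%classic by exists 1 => _ [r _ <-].
have dD r : d r <= D by apply: ub_le_sup => //; exists r.
have t2 r : t r ^+ 2 <= t r by rewrite expr2 ler_piMl // ltW.
have quad r u v : K r u -> K r v ->
    m (fun x => normc (u x - v x) ^+ 2) <= 2 * (nrm2 u - d r) + 2 * (nrm2 v - d r).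
  move=> hu hv; have h : 0 <= (2^-1 : R) <= 1 by rewrite invr_ge0 ler0n invf_le1 ?ler1n.
  have := dle r _ (Kmix r _ _ _ h hu hv).
  have u1 := K1 r u hu; have v1 := K1 r v hv.
  rewrite nrm2_mix //; have := nrm2B u1 v1.
  by set Y := m _; set I := cmean m _; lra.
exists w, (fun r => 2 * (D - d r) + 5 * t r); split=> //.
- move=> e e0; have e4 : 0 < e / 4 by rewrite divr_gt0.
  have [_ [r1 _ <-] hr1] : exists2 x, [set d r | r in [set: nat]]%classic x & D - e / 4 < x.
    by apply: sup_adherent => //; split=> //; exists (d 0%N), 0%N.
  pose r2 := Num.bound (10 / e); exists (maxn r1 r2) => r hr.
  have h1 : d r1 <= d r by apply: dmono; lia.
  have h2 : t r <= t r2 by apply: tmono; lia.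
  have h3 : 10 / e < r2.+1%:R.
    have := @archi_boundP R (10 / e); rewrite divr_ge0 ?(ltW e0) // => /(_ isT).
    by move=> h; apply: lt_trans h _; rewrite ltr_nat.
  have h4 : t r2 <= e / 10.
    by rewrite /t -[e / 10]invrK lef_pV2 ?posrE ?invr_gt0 ?divr_gt0 // invf_div ltW.
  by lra.
- move=> r s rs; apply: le_trans (quad r _ _ (Kle r s _ rs (wK s)) (wK r)) _.
  have := wd s; have := wd r; have := t2 r; have := t2 s; have := tmono r s rs.
  by have := dD s; have := t0 r; lra.
- move=> r v hv; have v1 := K1 r v hv.
  have h : 0 <= t r <= 1 by rewrite t1 ltW.
  have := dle r _ (Kmix r _ _ _ h hv (wK r)).
  rewrite nrm2_mix //; have := nrm2B v1 (w1 r).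
  set Y := m _; set I := cmean m _ => hY hd.
  have I1 : - 1 <= I.
    have : `|I| <= 1 by apply: cmean_norm => x; auto.
    by rewrite ler_norml; lra.
  have Y4 : Y <= 4 by have := nrm2_le1 v1; have := nrm2_le1 (w1 r); lra.
  have hY' : t r ^+ 2 * Y <= t r ^+ 2 * 4 by rewrite ler_wpM2l // sqr_ge0.
  have hh : 2 * t r * (I - nrm2 (w r)) >= - (5 * t r ^+ 2).
    by have := wd r; lra.
  have {}hh : t r * (2 * (I - nrm2 (w r)) + 5 * t r) >= 0 by lra.
  rewrite pmulr_rge0 // in hh.
  by have := dD r; have := t0 r; lra.
- move=> r v hv hle; apply: le_trans (quad r _ _ hv (wK r)) _.
  by have := wd r; have := t2 r; have := dD r; have := t0 r; lra.
Qed.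

End NearMinimizers.

Section DualLimit.
Variable R : realType.
Local Notation C := R[i].

(** Functions of a parameter [t] that stand for the limit as [t] grows. *)
Definition limit_system (S : system R) : system R.
Proof.
refine (@System R (S * nat)%type (fun a q => (act a q.1, q.2))
   (bind_mean LIM (fun t => map_mean (fun x => (x, t)) (smean S))) _ _ _).
- by case=> x t; rewrite /= act0.
- by move=> a b [x t]; rewrite /= actD.
- move=> a f [K hK].
  change (LIM (fun t => smean S (fun x => f (act a x, t))) =
          LIM (fun t => smean S (fun x => f (x, t)))).
  apply: eq_mean => t; by rewrite (smean_act (s := S) a (f := fun x => f (x, t))) //; exists K.
Defined.

(** [f] can be replaced by some [v M] with [M] large wherever it enters a
    correlation linearly. *)
Definition approximable (S : system R) (f : S -> C) (v : nat -> S -> C) :=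
  forall (P : Type) (m : mean R P) (r : P -> S) (G : P -> C) (c : R),
  (forall F, bdd F -> m (fun p => F (r p)) = smean S F) ->
  (forall p, le1 (G p)) -> 0 < c -> c <= cmean m (fun p => f (r p) * G p) ->
  forall k, exists2 M, (k <= M)%N & c / 2 <= cmean m (fun p => v M (r p) * G p).

(** If averages [v M] keep correlating with a fixed function, the elements of
    small norm in the convex hulls of their tails converge to a function that
    correlates with the [v M] themselves. *)
Lemma dual_limit (S : system R) (v : nat -> S -> C) (g : S -> C) (e : R) :
  (forall M x, le1 (v M x)) -> (forall x, le1 (g x)) -> 0 < e ->
  (forall k, exists2 M, (k <= M)%N & e <= cmean (smean S) (fun x => v M x * g x)) ->
  exists f : ball R (limit_system S),
    approximable f (fun M (q : limit_system S) => v M q.1) /\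
    exists2 e', 0 < e' & forall k, exists2 M, (k <= M)%N &
      e' <= cmean (smean (limit_system S)) (fun q => v M q.1 * (f q)^J).
Proof.
move=> v1 g1 e0 hv.
pose B r (f : S -> C) := exists M, [/\ (r <= M)%N,
   e <= cmean (smean S) (fun x => v M x * g x) & f = v M].
have B1 r f : B r f -> forall x, le1 (f x) by move=> [M [_ _ ->]].
have Bdec r f : conv (B r.+1) f -> conv (B r) f.
  by apply: conv_mono => h [M [rM eM ->]]; exists M; split=> //; apply: ltnW.
have Bne r : exists f, conv (B r) f.
  by have [M rM eM] := hv r; exists (v M); apply: conv_base; exists M.
have [w [rho [wK hrho wcau winn _]]] := near_minimizers (smean S) Bdec
  (fun r => le1_conv (B1 r)) (fun r t f g ht hf hg => conv_mix ht hf hg) Bne.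
have w1 r x : le1 (w r x) := le1_conv (B1 r) (wK r) x.
have e1 : e <= 1.
  have [M _ eM] := hv 0%N; apply: le_trans eM _; apply: cmean_le1 => x; auto.
have wg r : e <= cmean (smean S) (fun x => w r x * g x).
  rewrite -lerN2 -meanN; last bd.
  have := @conv_le R S S (smean S) id (fun x => - g x) (B r) (- e) (B1 r).
  rewrite /cmean => h; apply: le_trans (h _ _ _ (wK r)) => [|x|f [M [_ eM ->]]].
  - by rewrite le_eqVlt; apply/orP; left; apply/eqP; apply: eq_mean => x; rewrite mulrN ReN.
  - by rewrite /le1 normcN; apply: g1.
  - rewrite (eq_mean _ (g := fun x => - Re (v M x * g x))) => [|x]; last by rewrite mulrN ReN.
    by rewrite meanN ?lerN2 //; bd.
have wn r : e ^+ 2 <= nrm2 (smean S) (w r).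
  apply: le_trans _ (cmean_sqr (smean S) g1 (w1 r)); rewrite lerXn2r ?nnegrE ?(ltW e0) //.
    by apply: le_trans (ltW e0) _; apply: le_trans (wg r) _; under eq_cmean do rewrite mulrC.
  by apply: le_trans (wg r) _; under eq_cmean do rewrite mulrC.
exists (Ball (fun q : limit_system S => w1 q.2 q.1)); split.
  move=> P m r G c hm G1 c0 hc k; set eta := c / 4.
  have eta0 : 0 < eta by rewrite divr_gt0.
  have [r1 hr1] := hrho (eta ^+ 2) (exprn_gt0 2 eta0).
  set s := maxn r1 k.
  have sE : m (fun p => normc (w (r p).2 (r p).1 - w s (r p).1) ^+ 2) <= eta ^+ 2.
    rewrite (hm (fun q => normc (w q.2 q.1 - w s q.1) ^+ 2)); last bd.
    apply: (@le_trans _ _ (rho s)); last by apply: hr1; rewrite /s; lia.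
    apply: (LIM_le (N := s)) => [|n hn]; last exact: wcau.
    exists ((1 + 1) ^+ 2) => n; apply: mean_norm => x.
    rewrite ger0_norm ?sqr_ge0 //; apply: lerXn2r; rewrite ?nnegrE ?normc_ge0 ?addr_ge0 //.
    apply: le_trans (le_normcD _ _) _; rewrite normcN; apply: lerD; exact: w1.
  have sE' : m (fun p => normc (w (r p).2 (r p).1 - w s (r p).1)) <= eta.
    by apply: mean_le_root => //; [bd | exact: ltW].
  have [//|hn] := pselect (exists2 M, (k <= M)%N & c / 2 <= cmean m (fun p => v M (r p).1 * G p)).
  have : cmean m (fun p => w s (r p).1 * G p) <= c / 2.
    apply: (@conv_le R S P m (fun p => (r p).1) G (B s) (c / 2) (B1 s) G1 _ (w s) (wK s)).
    move=> f [M [sM _ ->]]; rewrite leNgt; apply/negP => h; apply: hn.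
    by exists M; [move: sM; rewrite /s; lia | exact: ltW].
  have : c <= cmean m (fun p => w s (r p).1 * G p) + eta.
    apply: le_trans hc _; apply: le_trans (cmean_lipschitz m
      (F := fun p => w (r p).2 (r p).1 * G p) (G := fun p => w s (r p).1 * G p) _ _) _.
    - by move=> p; auto.
    - by move=> p; auto.
    rewrite lerD2l; apply: le_trans _ sE'; apply: le_mean => [||p]; [bd|bd|].
    by rewrite -mulrBl normcM ler_piMr ?normc_ge0 //; apply: G1.
  by rewrite /eta; lra.
set eta := e ^+ 2 / 4.
have eta0 : 0 < eta by rewrite divr_gt0 // exprn_gt0.
have eta1 : eta ^+ 2 <= eta.
  rewrite expr2 ler_piMl ?(ltW eta0) //.
  by have : e ^+ 2 <= 1; [rewrite exprn_ile1 // ltW | rewrite /eta; lra].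
have [r0 hr0] := hrho (eta ^+ 2) (exprn_gt0 2 eta0).
exists (e ^+ 2 / 2); first by rewrite divr_gt0 // exprn_gt0.
move=> k; have [M hM eM] := hv (maxn k r0); exists M; first by lia.
apply: (@LIM_ge _ _ _ r0) => [|s hs].
  by exists 1 => s; apply: cmean_norm => x; auto.
have vM : conv (B r0) (v M) by apply: conv_base; exists M; split=> //; lia.
have h1 := winn r0 _ vM; have h2 := wn r0; have h3 := hr0 r0 (leqnn _).
change (e ^+ 2 / 2 <= cmean (smean S) (fun x => v M x * (w s x)^J)).
have : cmean (smean S) (fun x => v M x * (w r0 x)^J) <=
       cmean (smean S) (fun x => v M x * (w s x)^J) + eta.
  apply: le_trans (cmean_lipschitz _ (F := fun x => v M x * (w r0 x)^J)
     (G := fun x => v M x * (w s x)^J) _ _) _.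
  - by move=> x; auto.
  - by move=> x; auto.
  rewrite lerD2l; apply: (@le_trans _ _ (smean S (fun x => normc (w s x - w r0 x)))).
    apply: le_mean => [||x]; [bd|bd|].
    rewrite -mulrBr -rmorphB normcM normc_conj normcB ler_piMl ?normc_ge0 //; exact: v1.
  apply: mean_le_root; [bd | exact: ltW|].
  exact: le_trans (wcau r0 s hs) h3.
have : e ^+ 2 = 4 * eta by rewrite /eta; field.
by lra.
Qed.

End DualLimit.

(** * Finite Fourier analysis *)

Section Fourier.
Variable R : realType.
Local Notation C := R[i].

Lemma prim_root_exists n : (0 < n)%N -> exists z : C, n.-primitive_root z.
Proof.
pose p : {poly C} := 'X^n - 1; have [r Dp] := closed_field_poly_normal p.
move=> n0; rewrite (monicP _) ?monicXnsubC // scale1r in Dp.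
have rn1 : all n.-unity_root r by apply/allP => z; rewrite -root_prod_XsubC -Dp.
have sz_r : (n < (size r).+1)%N by rewrite -(size_prod_XsubC r id) -Dp size_XnsubC.
have [|z] := hasP (has_prim_root n0 rn1 _ sz_r); last by exists z.
by rewrite -separable_prod_XsubC -Dp separable_Xn_sub_1 // pnatr_eq0 -lt0n.
Qed.

Lemma normc_unity n (z : C) : (0 < n)%N -> z ^+ n = 1 -> normc z = 1.
Proof.
move=> n0 zn; apply/eqP; rewrite -(@pexpr_eq1 _ _ n) ?normc_ge0 //.
by rewrite -normcX zn normc1.
Qed.

Lemma mulcJ1 (z : C) : normc z = 1 -> z * z^J = 1.
Proof. by move=> hz; rewrite mulcJ hz expr1n. Qed.

Variables (N : nat) (w : C).
Hypothesis w_prim : N.-primitive_root w.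

Let N0 : (0 < N)%N. Proof. exact: prim_order_gt0 w_prim. Qed.
Let w1 : normc w = 1. Proof. exact: normc_unity N0 (prim_expr_order w_prim). Qed.

Lemma fourier_orthogonality c d : (c < N)%N -> (d < N)%N ->
  \sum_(k < N) (w ^+ c) ^+ k * ((w^J) ^+ d) ^+ k = if c == d then N%:R else 0.
Proof.
move=> cN dN; set z := w ^+ c * (w^J) ^+ d.
have -> : \sum_(k < N) (w ^+ c) ^+ k * ((w^J) ^+ d) ^+ k = \sum_(k < N) z ^+ k.
  by apply: eq_bigr => k _; rewrite exprMn.
have zE : z * w ^+ d = w ^+ c by rewrite -mulrA -exprMn [_^J * _]mulrC mulcJ1 // expr1n mulr1.
have [cd|cd] := eqVneq c d.
  have -> : z = 1 by rewrite /z cd -exprMn mulcJ1 // expr1n.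
  rewrite (eq_bigr (fun=> 1)) => [|k _]; last by rewrite expr1n.
  by rewrite sumr_const card_ord.
have z1 : z != 1.
  apply: contraNneq cd => z1; move: zE; rewrite z1 mul1r => /eqP.
  by rewrite (eq_prim_root_expr w_prim) !modn_small // eq_sym.
apply/eqP; rewrite -(mulrI_eq0 _ (mulfI (_ : z - 1 != 0))) ?subr_eq0 //.
rewrite -subrX1 subr_eq0 /z exprMn -!exprM ![(_ * N)%N]mulnC !exprM.
rewrite -rmorphXn /= (prim_expr_order w_prim) rmorph1 !expr1n mulr1 //.
Qed.

Lemma fourier_parseval H (x : nat -> C) : (H <= N)%N ->
  \sum_(k < N) normc (\sum_(a < H) x a * ((w^J) ^+ a) ^+ k) ^+ 2 =
  N%:R * \sum_(a < H) normc (x a) ^+ 2.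
Proof.
move=> HN; apply: (@complexI R); rewrite rmorphM !rmorph_sum /= rmorph_nat.
transitivity (\sum_(k < N) \sum_(a < H) \sum_(b < H)
   (x a * (x b)^J) * ((w ^+ b) ^+ k * ((w^J) ^+ a) ^+ k)).
  apply: eq_bigr => k _; rewrite -mulcJ rmorph_sum /= mulr_suml; apply: eq_bigr => a _.
  rewrite mulr_sumr; apply: eq_bigr => b _.
  by rewrite rmorphM !rmorphXn /= conjcK; ring.
rewrite exchange_big mulr_sumr; apply: eq_bigr => a _ /=.
rewrite exchange_big (bigD1 a) //= [X in _ + X]big1 ?addr0 => [|b ba].
  by rewrite -mulr_sumr fourier_orthogonality ?eqxx ?(leq_trans (ltn_ord a)) // mulcJ mulrC.
rewrite -mulr_sumr fourier_orthogonality ?(leq_trans (ltn_ord _)) //.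
by rewrite -val_eqE /= in ba; rewrite (negbTE ba) mulr0.
Qed.

(** The sum is a convolution, hence diagonal on characters; the inequality of
    Cauchy--Schwarz and Parseval's identity bound the other two factors. *)
Lemma fourier_bilinear H (g x y : nat -> C) (B : R) : N = (2 * H)%N ->
  (forall a, le1 (x a)) -> (forall a, le1 (y a)) ->
  (forall k, (k < N)%N -> normc (\sum_(c < N) g c * (w ^+ c) ^+ k) <= B) ->
  normc (\sum_(a < H) \sum_(b < H) g (a + b)%N * (x a * y b)) <= H%:R * B.
Proof.
move=> NH hx hy hB.
pose G (k : nat) := \sum_(c < N) g c * (w ^+ c) ^+ k.
pose X (k : nat) := \sum_(a < H) x a * ((w^J) ^+ a) ^+ k.
pose Y (k : nat) := \sum_(a < H) y a * ((w^J) ^+ a) ^+ k.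
have HN : (H <= N)%N by lia.
have E : N%:R * \sum_(a < H) \sum_(b < H) g (a + b)%N * (x a * y b) =
    \sum_(k < N) G k * (X k * Y k).
  transitivity (\sum_(k < N) \sum_(a < H) \sum_(b < H) \sum_(c < N)
     g c * (x a * y b) * ((w ^+ c) ^+ k * ((w^J) ^+ (a + b)) ^+ k)); last first.
    apply: eq_bigr => k _; have -> : G k * (X k * Y k) = X k * (Y k * G k) by ring.
    rewrite {1}/X mulr_suml; apply: eq_bigr => a _.
    rewrite {1}/Y mulr_suml mulr_sumr; apply: eq_bigr => b _; rewrite {1}/G 2!mulr_sumr.
    by apply: eq_bigr => c _; rewrite exprD exprMn; ring.
  rewrite [RHS]exchange_big mulr_sumr; apply: eq_bigr => a _ /=.
  rewrite [RHS]exchange_big mulr_sumr; apply: eq_bigr => b _ /=.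
  have abN : (a + b < N)%N by have := ltn_ord a; have := ltn_ord b; lia.
  rewrite exchange_big (bigD1 (Ordinal abN)) //= [X in _ + X]big1 ?addr0 => [|c ca].
    by rewrite -mulr_sumr fourier_orthogonality // eqxx mulrC.
  rewrite -mulr_sumr fourier_orthogonality //.
  by rewrite -val_eqE /= in ca; rewrite (negbTE ca) mulr0.
have N0' : 0 < N%:R :> R by rewrite ltr0n.
rewrite -(ler_pM2l N0') -{1}[N%:R]normc_natr -normcM E.
have S (u : nat -> C) : (forall a, le1 (u a)) ->
    \sum_(k < N) normc (\sum_(a < H) u a * ((w^J) ^+ a) ^+ k) ^+ 2 <= N%:R * H%:R.
  move=> hu; rewrite fourier_parseval // ler_wpM2l //.
  apply: le_trans (_ : \sum_(a < H) 1 <= _); last by rewrite sumr_const card_ord.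
  by apply: ler_sum => a _; rewrite exprn_ile1 ?normc_ge0 //; apply: hu.
apply: le_trans (normc_sum _ _ _) _.
apply: (@le_trans _ _ (\sum_(k < N) B * (2^-1 * (normc (X k) ^+ 2 + normc (Y k) ^+ 2)))).
  apply: ler_sum => k _; rewrite !normcM.
  have h : normc (X k) * normc (Y k) <= 2^-1 * (normc (X k) ^+ 2 + normc (Y k) ^+ 2).
    by have := sqr_ge0 (normc (X k) - normc (Y k)); rewrite sqrrB; lra.
  have B0 : 0 <= B by apply: le_trans (normc_ge0 _) (hB k _).
  apply: ler_pM => //; [exact: normc_ge0 | by rewrite mulr_ge0 ?normc_ge0 | exact: hB].
have B0 : 0 <= B by apply: le_trans (normc_ge0 _) (hB 0%N _).
rewrite -mulr_sumr -mulr_sumr big_split /=.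
have SXY : 2^-1 * (\sum_(k < N) normc (X k) ^+ 2 + \sum_(k < N) normc (Y k) ^+ 2) <=
    N%:R * H%:R by have := S x hx; have := S y hy; rewrite -/X -/Y; lra.
by apply: le_trans (ler_wpM2l B0 SXY) _; rewrite mulrC mulrA.
Qed.

Lemma fourier_periodic (f : nat -> C) : (forall n, f n = f (n %% N)%N) ->
  (forall n, le1 (f n)) ->
  exists c : nat -> C, (forall a, le1 (c a)) /\
    forall n, f n = \sum_(a < N) c a * (w ^+ a) ^+ n.
Proof.
move=> fper f1; exists (fun a => av N (fun s => f s * ((w^J) ^+ s) ^+ a)).
have wX : forall a s, le1 (((w^J) ^+ s) ^+ a) by move=> a s; do 2 apply: le1X; rewrite /le1 normc_conj w1.
split=> [a|n]; first by auto.
have nN : (n %% N < N)%N by rewrite ltn_mod.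
have wn a : (w ^+ a) ^+ n = (w ^+ (n %% N)) ^+ a.
  by rewrite -exprM mulnC exprM (expr_mod (n) (prim_expr_order w_prim)).
rewrite fper /av; under eq_bigr => a _ do rewrite wn mulrAC mulr_suml.
rewrite -mulr_suml exchange_big /= (bigD1 (Ordinal nN)) //= [X in _ + X]big1 ?addr0 => [|s sn].
  under eq_bigr => a _ do rewrite -mulrA [_ * ((w ^+ _) ^+ _)]mulrC.
  by rewrite -mulr_sumr fourier_orthogonality // eqxx mulfK // pnatr_eq0 -lt0n.
under eq_bigr => a _ do rewrite -mulrA [_ * ((w ^+ _) ^+ _)]mulrC.
rewrite -mulr_sumr fourier_orthogonality //.
by rewrite -val_eqE /= eq_sym in sn; rewrite (negbTE sn) mulr0.
Qed.

End Fourier.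

Section U2Inverse.
Variable R : realType.
Local Notation C := R[i].

(** For fixed [a'] and [b'], the sum over [a] and [b] is bounded by the largest
    Fourier coefficient of [g] on the cyclic group of order [2 * H], in which sums of
    two elements of the interval do not wrap around. *)
Lemma box2_inverse H (g : int -> C) : (0 < H)%N -> (forall i, le1 (g i)) ->
  exists2 z : C, normc z = 1 &
  av H (fun a => av H (fun a' => av H (fun b => av H (fun b' =>
     Re ((g (a + b)%N%:Z * (g (a' + b)%N%:Z)^J) * (g (a + b')%N%:Z * (g (a' + b')%N%:Z)^J)^J)))))
  <= 2 * normc (av (2 * H) (fun i => g i%:Z * z ^+ i)).
Proof.
move=> H0 hg; have N0 : (0 < 2 * H)%N by lia.
have [w wp] := prim_root_exists R N0.
pose G (k : nat) := normc (\sum_(c < 2 * H) g c%:Z * (w ^+ c) ^+ k).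
pose k0 := [arg max_(k > (Ordinal N0) ) G k]%O.
have hk k : (k < 2 * H)%N -> G k <= G k0.
  by move=> hk; rewrite /k0; case: arg_maxP => // i _ /(_ (Ordinal hk) isT).
exists (w ^+ k0); first by rewrite normcX (normc_unity N0 (prim_expr_order wp)) expr1n.
have -> : normc (av (2 * H) (fun i => g i%:Z * (w ^+ k0) ^+ i)) = G k0 / (2 * H)%N%:R.
  rewrite /av normcM normcV normc_natr; congr (normc _ / _).
  by apply: eq_bigr => i _; congr (_ * _); rewrite exprAC.
pose T a a' b b' := Re ((g (a + b)%N%:Z * (g (a' + b)%N%:Z)^J) *
   (g (a + b')%N%:Z * (g (a' + b')%N%:Z)^J)^J).
have bound a' b' : av H (fun a => av H (fun b => T a a' b b')) <= 2 * (G k0 / (2 * H)%N%:R).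
  pose x a := (g (a + b')%N%:Z)^J; pose y b := (g (a' + b)%N%:Z)^J * g (a' + b')%N%:Z.
  have x1 a : le1 (x a) by rewrite /x; auto.
  have y1 b : le1 (y b) by rewrite /y; auto.
  have := fourier_bilinear wp (g := fun c => g c%:Z) erefl x1 y1 hk.
  have Hn0 : H%:R != 0 :> R by rewrite pnatr_eq0 -lt0n.
  have -> : av H (fun a => av H (fun b => T a a' b b')) =
     Re (\sum_(a < H) \sum_(b < H) g (a + b)%N%:Z * (x a * y b)) / H%:R / H%:R.
    rewrite /av -mulr_suml; congr (_ / _ / _); rewrite Re_sum; apply: eq_bigr => a _.
    rewrite Re_sum; apply: eq_bigr => b _; congr complex.Re.
    by rewrite /x /y rmorphM /= conjcK; ring.
  move=> h; rewrite natrM.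
  have -> : 2 * (G k0 / (2 * H%:R)) = (H%:R * G k0) / H%:R / H%:R by field.
  do 2 (rewrite ler_wpM2r ?invr_ge0 //).
  exact: le_trans (Re_le _) h.
have -> : av H (fun a => av H (fun a' => av H (fun b => av H (fun b' => T a a' b b')))) =
   av H (fun a' => av H (fun b' => av H (fun a => av H (fun b => T a a' b b')))).
  rewrite exchange_av; apply: eq_av => a' _.
  rewrite -[RHS]exchange_av; apply: eq_av => a _; exact: exchange_av.
by apply: av_le => // a' _; apply: av_le.
Qed.

End U2Inverse.

(** * Weyl equidistribution *)

Section Phases.
Variable R : realType.
Local Notation C := R[i].
Implicit Types z u : C.

Definition unimod z := normc z = 1.

Lemma unimod_le1 z : unimod z -> le1 z. Proof. by rewrite /le1 => ->. Qed.
Lemma unimod_neq0 z : unimod z -> z != 0.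
Proof. by move=> hz; rewrite -normc_eq0 hz oner_neq0. Qed.
Lemma unimodM z u : unimod z -> unimod u -> unimod (z * u).
Proof. by rewrite /unimod normcM => -> ->; rewrite mulr1. Qed.
Lemma unimodX z n : unimod z -> unimod (z ^+ n).
Proof. by rewrite /unimod normcX => ->; rewrite expr1n. Qed.
Lemma unimodJ z : unimod z -> unimod z^J.
Proof. by rewrite /unimod normc_conj. Qed.
Lemma unimodV z : unimod z -> z^-1 = z^J.
Proof. by move=> hz; apply: (mulfI (unimod_neq0 hz)); rewrite mulfV ?unimod_neq0 // mulcJ1. Qed.
Lemma unimodXz z (n : int) : unimod z -> unimod (z ^ n).
Proof.
case: n => n hz; first exact: unimodX.
by rewrite NegzE -exprnN -exprVn unimodV //; apply/unimodX/unimodJ.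
Qed.
Lemma unimod_prod (I : Type) (r : seq I) (P : pred I) (F : I -> C) :
  (forall i, P i -> unimod (F i)) -> unimod (\prod_(i <- r | P i) F i).
Proof. by move=> h; apply: big_ind => //; [rewrite /unimod normc1 | exact: unimodM]. Qed.

Definition close (B : nat) z : bool := normc (z - 1) * B%:R <= 1.

Lemma close_le B B' z : (B <= B')%N -> close B' z -> close B z.
Proof.
rewrite /close => h h1; apply: le_trans h1; rewrite ler_wpM2l ?normc_ge0 // ler_nat //.
Qed.

Lemma dist1_M z u : unimod z -> normc (z * u - 1) <= normc (z - 1) + normc (u - 1).
Proof.
move=> hz; have -> : z * u - 1 = z * (u - 1) + (z - 1) by ring.
by apply: le_trans (le_normcD _ _) _; rewrite normcM hz mul1r addrC.
Qed.

Lemma dist1_X z n : unimod z -> normc (z ^+ n - 1) <= n%:R * normc (z - 1).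
Proof.
move=> hz; elim: n => [|n IH]; first by rewrite expr0 subrr normc0 mul0r.
rewrite exprS -natr1 mulrDl mul1r [leRHS]addrC; apply: le_trans (dist1_M _ hz) _.
by rewrite lerD2l.
Qed.

Lemma dist1_J z : normc (z^J - 1) = normc (z - 1).
Proof. by rewrite -(normc_conj (z - 1)) rmorphB rmorph1. Qed.

Lemma dist1_Xz z (n : int) : unimod z -> normc (z ^ n - 1) <= `|n|%N%:R * normc (z - 1).
Proof.
case: n => n hz; first exact: dist1_X.
rewrite NegzE -exprnN -exprVn unimodV // -rmorphXn dist1_J; exact: dist1_X.
Qed.

Lemma dist_X z u n : unimod z -> unimod u -> normc (z ^+ n - u ^+ n) <= n%:R * normc (z - u).
Proof.
move=> hz hu; elim: n => [|n IH]; first by rewrite !expr0 subrr normc0 mul0r.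
have -> : z ^+ n.+1 - u ^+ n.+1 = z * (z ^+ n - u ^+ n) + (z - u) * u ^+ n by rewrite !exprS; ring.
apply: le_trans (le_normcD _ _) _; rewrite !normcM hz (unimodX n hu) mul1r mulr1.
by rewrite -natr1 mulrDl mul1r lerD2r.
Qed.

Lemma close_X B k z : unimod z -> close (k * B) z -> close B (z ^+ k).
Proof.
move=> hz; rewrite /close natrM => h.
apply: le_trans h; rewrite mulrA ler_wpM2r // [leRHS]mulrC; exact: dist1_X.
Qed.

Lemma close_J B z : close B z^J = close B z.
Proof. by rewrite /close dist1_J. Qed.

Definition phase (I : Type) (ls : seq I) (p : I -> {poly int}) (l : I -> C) (n : nat) : C :=
  \prod_(i <- ls) l i ^ (p i).[n%:Z].

(** Phases along several polynomials are regrouped by powers of [n]. *)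
Lemma phase_coef (I : Type) (ls : seq I) (p : I -> {poly int}) (l : I -> C) D n :
  (forall i, unimod (l i)) -> (forall i, (size (p i) <= D)%N) ->
  phase ls p l n = \prod_(j < D) (\prod_(i <- ls) l i ^ (p i)`_j) ^+ (n ^ j).
Proof.
move=> hl hp.
transitivity (\prod_(i <- ls) \prod_(j < D) (l i ^ (p i)`_j) ^+ (n ^ j)); last first.
  by rewrite exchange_big; apply: eq_bigr => j _; rewrite prodrXl.
apply: eq_bigr => i _; have l0 := unimod_neq0 (hl i).
rewrite (horner_coef_wide _ (hp i)).
elim: D {hp} => [|D IH]; first by rewrite !big_ord0.
rewrite !big_ord_recr /= expfzDr // IH; congr (_ * _).
by rewrite -exprz_exp -[n%:Z]natz -natrX natz -exprnP.
Qed.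

Definition mono (d : nat) (mu : nat -> C) (n : nat) : C :=
  \prod_(j < d.+1) mu j ^+ (n ^ j.+1).

Lemma mono_recr d mu n : mono d.+1 mu n = mono d mu n * mu d.+1 ^+ (n ^ d.+2).
Proof. exact: big_ord_recr. Qed.

Lemma unimod_mono d mu n : (forall j, unimod (mu j)) -> unimod (mono d mu n).
Proof. by move=> h; apply: unimod_prod => j _; apply: unimodX. Qed.

End Phases.

Definition frequently (P : nat -> Prop) := forall k, exists2 M, (k <= M)%N & P M.

Lemma frequently_or (P Q : nat -> Prop) :
  frequently (fun M => P M \/ Q M) -> frequently P \/ frequently Q.
Proof.
move=> h; have [?|nP] := pselect (frequently P); first by left.
right=> k; move/existsNP : nP => [k0 hk0].
have [M hM [PM|QM]] := h (maxn k k0); last by exists M => //; lia.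
by exfalso; apply: hk0; exists M => //; lia.
Qed.

Lemma frequently_fin (N : nat) (P : nat -> nat -> Prop) :
  frequently (fun M => exists2 a, (a < N)%N & P a M) ->
  exists2 a, (a < N)%N & frequently (P a).
Proof.
elim: N => [|N IH] h; first by have [M _ [a]] := h 0%N.
have /frequently_or[h1|h1] : frequently (fun M => (exists2 a, (a < N)%N & P a M) \/ P N M).
- move=> k; have [M hM [a aN Pa]] := h k; exists M => //.
  have [aN'|aN'] := ltnP a N; first by left; exists a.
  by right; have <- : a = N by lia.
- by have [a aN Pa] := IH h1; exists a => //; lia.
- by exists N.
Qed.

Section CesaroMean.
Variable R : realType.
Local Notation C := R[i].

(** Frequently large averages are turned into one invariant mean. *)
Lemma cesaro_mean (c : nat -> R) (e : R) : bdd c -> frequently (fun M => e <= av M c) ->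
  exists m : mean R nat, [/\ shift_invariant m, e <= m c &
    forall d b, bdd d -> b < m d -> frequently (fun M => b <= av M d)].
Proof.
move=> hc he; have [M hM] : exists M : nat -> nat, forall k, (k < M k)%N /\ e <= av (M k) c.
  have /choice[M hM] : forall k, exists M, (k < M)%N /\ e <= av M c.
    by move=> k; have [M kM eM] := he k.+1; exists M.
  by exists M.
exists (bind_mean LIM (fun k => unif (M k))); split.
- move=> u hu; have [K hK] := hu.
  have hb (v : nat -> R) : bdd v -> bdd (fun k => unif (M k) v).
    by move=> [L hL]; exists L => k; apply: mean_norm.
  have hu1 : bdd (fun n => u n.+1) by exists K.
  apply/eqP; rewrite -subr_eq0.
  change (LIM (fun k => unif (M k) (fun n => u n.+1)) - LIM (fun k => unif (M k) u) == 0).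
  rewrite -meanB; [|exact: hb|exact: hb].
  have K0 : 0 <= K by apply: le_trans (hK 0%N).
  apply/eqP; apply: (LIM_small (K := 2 * K)) => k; have [kM _] := hM k.
  rewrite !unifE; [|lia|lia].
  have := av_shift (M k) 1 hK; rewrite mulr1.
  rewrite (eq_av (d := fun n => u n.+1)) => [|n _]; last by rewrite addn1.
  move=> h; apply: le_trans h _; rewrite ler_wpM2l ?mulr_ge0 //.
  by rewrite lef_pV2 ?posrE ?ltr0n ?ler_nat //; lia.
- apply: (LIM_ge (N := 0)); first by case: hc => K hK; exists K => k; apply: mean_norm.
  by move=> k _; have [kM ek] := hM k; rewrite unifE //; lia.
- move=> d b hd hb k.
  have := @LIM_frequently R (fun k => unif (M k) d) _ b k _ (lexx _) hb.
  case; first by case: hd => K hK; exists K => j; apply: mean_norm.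
  move=> j kj bj; have [jM _] := hM j; exists (M j); first by lia.
  by move: bj; rewrite unifE //; lia.
Qed.

Definition trivial_system (X : Type) (m : mean R X) : system R.
Proof. by refine (@System R X (fun _ x => x) m _ _ _). Defined.

End CesaroMean.

Section Weyl.
Variable R : realType.
Local Notation C := R[i].

Definition all_close (d : nat) (B q : nat) (mu : nat -> C) : bool :=
  [forall j : 'I_d.+1, close B (mu j ^+ q)].

(** Weyl's theorem in a form that is uniform over all means and amplitudes: the
    denominators, and the measure of the set where the coefficients are almost
    rational, depend on the size of the averages only. *)
Definition weyl_property (d : nat) := forall e : R, 0 < e ->
  exists q, exists2 c : R, (0 < q)%N /\ 0 < c &
  forall (X : Type) (m : mean R X) (g : ball R X) (mu : nat -> X -> C),
    (forall j x, unimod (mu j x)) ->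
    frequently (fun M => e <= av M (fun n => cmean m (fun x => g x * mono d (mu^~ x) n))) ->
    forall B, c <= m (fun x => normc (g x) * (all_close d B q (mu^~ x))%:R).

Lemma le1_mono d (mu : nat -> C) n : (forall j, unimod (mu j)) -> le1 (mono d mu n).
Proof. by move=> h; apply/unimod_le1/unimod_mono. Qed.
Hint Extern 2 (le1 (mono _ _ _)) => (apply: le1_mono; intro) : core.

Lemma archi_lt (x : R) : 0 <= x -> exists n, (0 < n)%N /\ x < n%:R.
Proof.
move=> x0; exists (Num.bound x).+1; split=> //.
by apply: lt_trans (archi_boundP x0) _; rewrite ltr_nat.
Qed.

(** A geometric sum of ratio [z] is at most [2 / normc (z - 1)]. *)
Lemma weyl_linear : weyl_property 0.
Proof.
move=> e e0; exists 1%N, (e / 2); first by rewrite divr_gt0.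
move=> X m g mu hmu hf B.
have [N [N0 hN]] := @archi_lt (4 * B%:R / e) (divr_ge0 (mulr_ge0 (ler0n _ _) (ler0n _ _)) (ltW e0)).
have [M NM] := hf N.
have M0 : (0 < M)%N by lia.
rewrite -cmean_av => [|n x]; last by auto 6.
pose K : R := 2 * B%:R / M%:R; move=> hM.
have hK : K <= e / 2.
  rewrite /K ler_pdivrMr ?ltr0n // mulrAC ler_pdivlMr //.
  have : N%:R <= M%:R :> R by rewrite ler_nat.
  by move: hN; rewrite ltr_pdivrMr //; nra.
have : cmean m (fun x => av M (fun n => g x * mono 0 (mu^~ x) n)) <=
       m (fun x => normc (g x) * (all_close 0 B 1 (mu^~ x))%:R + K).
  apply: le_mean => [||x]; [bd|bd|].
  rewrite avZ; apply: le_trans (Re_le _) _; rewrite normcM.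
  have K0 : 0 <= K by rewrite divr_ge0 ?mulr_ge0.
  have -> : all_close 0 B 1 (mu^~ x) = close B (mu 0%N x).
    apply/forallP/idP => [/(_ ord0)|h j]; first by rewrite expr1.
    by rewrite (ord1 j) expr1.
  have h1 : normc (av M (fun n => mono 0 (mu^~ x) n)) <= 1.
    by apply: le1_av => n; auto.
  case: (boolP (close B (mu 0%N x))) => [_|].
    rewrite mulr1; apply: le_trans (_ : normc (g x) * 1 <= _).
      by rewrite ler_wpM2l ?normc_ge0.
    by rewrite mulr1 lerDl.
  rewrite /close -ltNge mulr0 add0r => hc.
  apply: (@le_trans _ _ (1 * normc (av M (fun n => mono 0 (mu^~ x) n)))).
    by rewrite ler_wpM2r ?normc_ge0 //; apply: ballP.
  rewrite mul1r; set z := mu 0%N x in hc *.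
  have E : (z - 1) * av M (fun n => mono 0 (mu^~ x) n) = (z ^+ M - 1) / M%:R.
    rewrite subrX1 /av mulrA; congr (_ * _ / _); apply: eq_bigr => n _.
    by rewrite /mono big_ord1 expn1.
  have : normc (z - 1) * normc (av M (fun n => mono 0 (mu^~ x) n)) <= 2 / M%:R.
    rewrite -normcM E normcM normcV normc_natr ler_wpM2r ?invr_ge0 //.
    apply: le_trans (le_normcD _ _) _; rewrite normcN normc1 (unimodX M (hmu _ _)); lra.
  move=> h2; rewrite /K mulrAC.
  set A := normc (av _ _) in h1 h2 *.
  have A0 : 0 <= A by exact: normc_ge0.
  have B0 : 0 <= B%:R :> R by [].
  apply: (@le_trans _ _ (normc (z - 1) * B%:R * A)).
    by rewrite -[leLHS]mul1r ler_wpM2r // ltW.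
  by rewrite [leLHS]mulrAC ler_wpM2r.
by rewrite meanD ?mean_cst; [lra|bd|bd].
Qed.

(** Van der Corput's inequality lowers the degree by one, and the top coefficient of
    the differenced phase is a multiple of the original one. *)
Lemma weyl_top d : weyl_property d -> forall e : R, 0 < e ->
  exists q, exists2 c : R, (0 < q)%N /\ 0 < c &
  forall (X : Type) (m : mean R X) (g : ball R X) (mu : nat -> X -> C),
    (forall j x, unimod (mu j x)) ->
    frequently (fun M => e <= av M (fun n => cmean m (fun x => g x * mono d.+1 (mu^~ x) n))) ->
    forall B, c <= m (fun x => normc (g x) * (close B (mu d.+1 x ^+ q))%:R).
Proof.
move=> IH e e0; have e20 : 0 < e ^+ 2 by rewrite exprn_gt0.
have [H [H0 hH]] := @archi_lt (2 / e ^+ 2) (divr_ge0 (ler0n _ _) (ltW e20)).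
have [q' [c' [q0 c0] hIH]] := IH (e ^+ 2 / 4) (divr_gt0 e20 (ltr0n R 4)).
exists (d.+2 * H`! * q')%N, c'; first by split=> //; rewrite !muln_gt0 fact_gt0 q0.
move=> X m g mu hmu hf B.
pose S := trivial_system m.
pose c n := cmean m (fun x => g x * mono d.+1 (mu^~ x) n).
have bc : bdd c by apply: bdd_cmean => n x; auto 6.
have [mm [mm_inv mme mmf]] := cesaro_mean bc hf.
pose ga x : C := (Num.sqrt (normc (g x)))%:C.
have ga2 x : ga x * (ga x)^J = (normc (g x))%:C.
  by rewrite mulcJ /ga normc_real ger0_norm ?sqrtr_ge0 // sqr_sqrtr ?normc_ge0.
have ga1 x : le1 (ga x).
  by rewrite /le1 /ga normc_real ger0_norm ?sqrtr_ge0 // -sqrtr1 ler_wsqrtr //; apply: ballP.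
pose g' x : C := g x / ga x.
have g'E x : g x = g' x * ga x.
  have [gx|gx] := eqVneq (g x) 0; first by rewrite /g' gx !mul0r.
  by rewrite /g' divfK // /ga fmorph_eq0 sqrtr_eq0 -ltNge lt_def normc_ge0 normc_eq0 gx.
have g'1 x : le1 (g' x).
  have [gx|gx] := eqVneq (g x) 0; first by rewrite /g' gx mul0r; auto.
  have gn : 0 < normc (g x) by rewrite lt_def normc_ge0 normc_eq0 gx.
  rewrite /le1 /g' normcM normcV /ga normc_real ger0_norm ?sqrtr_ge0 //.
  rewrite -{1}(sqr_sqrtr (normc_ge0 (g x))) expr2 mulfK ?gt_eqF ?sqrtr_gt0 //.
  by rewrite -sqrtr1 ler_wsqrtr //; apply: ballP.
pose u n (x : S) := ga x * mono d.+1 (mu^~ x) n.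
have u1 n x : le1 (u n x) by rewrite /u; auto 6.
have := vdc (S := S) (m := mm) mm_inv g'1 u1 H0.
have -> : mm (fun n => cmean (smean S) (fun x => g' x * u n x)) = mm c.
  by apply: eq_mean => n; apply: eq_cmean => x; rewrite /u mulrA -g'E.
pose y h h' := mm (fun n => cmean m (fun x => u (n + h)%N x * (u (n + h')%N x)^J)).
rewrite -/(av H (fun h => av H (y h))) => xy.
have yy : e ^+ 2 <= av H (fun h => av H (y h)).
  by apply: le_trans xy; rewrite lerXn2r ?nnegrE ?(ltW e0) // (le_trans (ltW e0)).
have y1 h h' : y h h' <= 1.
  apply: mean_le => [|n]; first by apply: bdd_cmean => n x; auto.
  by apply: cmean_le1 => x; auto.
have [h [h' [hH1 hH2 hh' yh]]] : exists h h', [/\ (h < H)%N, (h' < H)%N, h != h' & e ^+ 2 / 2 <= y h h'].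
  apply/not_existsP => hn.
  have : av H (fun h => av H (y h)) <= e ^+ 2 / 2 + H%:R^-1.
    apply: av_le => // h hH1; rewrite -[e ^+ 2 / 2](av_const _ H0).
    have -> : H%:R^-1 = av H (fun h' => (h == h')%:R) :> R.
      rewrite /av (bigD1 (Ordinal hH1)) //= eqxx [X in _ + X]big1 ?addr0 ?mul1r // => i ih.
      by rewrite -val_eqE eq_sym /= in ih; rewrite (negbTE ih).
    rewrite -avD; apply: le_av => h' hH2; case: eqVneq => [<-|hh'].
      by rewrite mulr1n; have := y1 h h; have := e20; set z := e ^+ 2; set w := y _ _; lra.
    rewrite addr0 leNgt; apply/negP => hlt; apply: (hn h); exists h'.
    by split=> //; apply: ltW.
  have : H%:R^-1 < e ^+ 2 / 2.
    by rewrite -[e ^+ 2 / 2]invrK ltf_pV2 ?posrE ?invr_gt0 ?divr_gt0 ?ltr0n // invf_div.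
  by lra.
have e22 : 0 < e ^+ 2 / 2 by rewrite divr_gt0.
have {}mmf := mmf (fun n => cmean m (fun x => u (n + h)%N x * (u (n + h')%N x)^J)) (e ^+ 2 / 4).
have {}mmf : frequently (fun M => e ^+ 2 / 4 <= av M (fun n =>
    cmean m (fun x => u (n + h)%N x * (u (n + h')%N x)^J))).
  apply: mmf; first by apply: bdd_cmean => n x; auto.
  by apply: (@lt_le_trans _ _ (e ^+ 2 / 2)) => //; lra.
pose p (i : 'I_d.+2) : {poly int} := shp h 'X^(i.+1) - shp h' 'X^(i.+1).
have sp i : (size (p i) <= d.+2)%N by rewrite size_shpB ?size_polyXn ?ltn_ord.
pose nu j x := \prod_(i <- index_enum 'I_d.+2) mu i x ^ (p i)`_j.
have nu1 j x : unimod (nu j x) by apply: unimod_prod => i _; apply: unimodXz.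
have PX (a k : nat) : (Posz a) ^+ k = Posz (a ^ k) by rewrite -[Posz a]natz -natrX natz.
have uE n x : u (n + h)%N x * (u (n + h')%N x)^J =
    ((normc (g x))%:C * nu 0%N x) * mono d (fun j => nu j.+1 x) n.
  transitivity ((normc (g x))%:C * phase (index_enum 'I_d.+2) p (fun i => mu i x) n).
    rewrite -ga2 /u rmorphM mulrACA /mono /phase rmorph_prod -big_split /=.
    congr (_ * _); apply: eq_bigr => i _; have l0 := unimod_neq0 (hmu i x).
    rewrite /p hornerD hornerN !horner_shp !hornerXn !PX expfzDr //.
    congr (_ * _); rewrite rmorphXn /= -unimodV; last exact: hmu.
    by rewrite exprVn -exprnN.
  rewrite (phase_coef _ (D := d.+2)) // big_ord_recl expr1 mulrA; congr (_ * _).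
have G2P x : le1 ((normc (g x))%:C * nu 0%N x) by rewrite -ga2; auto using unimod_le1.
pose G2 : ball R X := Ball G2P.
have := hIH X m G2 (fun j => nu j.+1) (fun j => nu1 j.+1).
have E1 M : av M (fun n => cmean m (fun x => u (n + h)%N x * (u (n + h')%N x)^J)) =
    av M (fun n => cmean m (fun x => G2 x * mono d (fun j => nu j.+1 x) n)).
  by apply: eq_av => n _; apply: eq_cmean => x; rewrite uE.
under [X in frequently X -> _]eq_fun => M do rewrite -E1.
move=> /(_ mmf (H`! * B)%N) hc; apply: le_trans hc _; apply: le_mean => [||x]; [bd|bd|].
have -> : normc (G2 x) = normc (g x).
  by rewrite /= normcM (nu1 0%N x) mulr1 normc_real ger0_norm ?normc_ge0.
rewrite ler_wpM2l ?normc_ge0 // ler_nat.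
case: (boolP (all_close _ _ _ _)) => // /forallP/(_ ord_max) /=.
have -> : nu d.+1 x = mu d.+1 x ^ ((h%:Z - h'%:Z) *+ d.+2).
  rewrite /nu big_ord_recr /= big1 ?mul1r => [|i _].
    congr (_ ^ _); rewrite coefB !coef_shp_pred ?size_polyXn //= !coefXn !eqxx.
    by rewrite !mul1r opprD addrACA subrr add0r mulrnBl.
  rewrite coefB !coef_shp_pred ?size_polyXn ?ltnS ?(ltnW (ltn_ord i)) //=.
  rewrite !coefXn; have /negbTE -> : (d.+2 != i.+1)%N by have := ltn_ord i; lia.
  by rewrite !mul0r !addr0 subrr expr0z.
have k0 : (0 < `|h%:Z - h'%:Z|)%N by lia.
have kH : (`|h%:Z - h'%:Z| <= H)%N by lia.
have /dvdnP[l lE] : (`|h%:Z - h'%:Z| %| H`!)%N by apply: dvdn_fact; rewrite k0.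
have l0 : (l <= H`!)%N by rewrite lE leq_pmulr.
set k := `|_|%N in k0 kH lE.
have hz := hmu d.+1 x; set z := mu d.+1 x in hz *.
have -> : close (H`! * B) ((z ^ ((h%:Z - h'%:Z) *+ d.+2)) ^+ q') = close (H`! * B) (z ^+ (k * d.+2 * q')).
  rewrite exprnP exprz_exp -mulr_natr.
  have [hk|hk] : h%:Z - h'%:Z = k%:Z \/ h%:Z - h'%:Z = - k%:Z by rewrite /k; lia.
    by rewrite hk natz -!PoszM exprnP.
  by rewrite hk natz !mulNr -!PoszM -exprnN -exprVn unimodV // -rmorphXn close_J.
move=> hcl; have {hcl} : close (l * B) (z ^+ (k * d.+2 * q')) by apply: close_le hcl; rewrite leq_mul2r l0 orbT.
move=> /close_X; rewrite -exprM => hcl.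
have -> : (d.+2 * H`! * q' = k * d.+2 * q' * l)%N by rewrite lE; ring.
by rewrite hcl //; apply: unimodX.
Qed.

End Weyl.
Hint Extern 2 (le1 (mono _ _ _)) => (apply: le1_mono; intro) : core.

(** A nonincreasing sequence bounded below cannot drop by [k] infinitely often. *)
Lemma stable_index (R : realType) (a : nat -> R) (k : R) : 0 < k ->
  (forall i j, (i <= j)%N -> a j <= a i) -> (forall i, 0 <= a i) ->
  exists i, forall j, (i <= j)%N -> a i - a j <= k.
Proof.
move=> k0 amon a0; apply/not_existsP => hn.
have H i : exists j, (i <= j)%N /\ k < a i - a j.
  apply/not_existsP => h1; apply: (hn i) => j ij; rewrite leNgt; apply/negP => h2.
  by apply: (h1 j).
have H2 n : exists j, a j <= a 0%N - n%:R * k.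
  elim: n => [|n [j hj]]; first by exists 0%N; rewrite mul0r subr0.
  have [j' [_ hj']] := H j; exists j'.
  by rewrite -natr1 mulrDl mul1r; lra.
have [j] := H2 (Num.bound (a 0%N / k)).
have := archi_boundP (divr_ge0 (a0 0%N) (ltW k0)).
rewrite ltr_pdivrMr // => h1 h2.
by have := a0 j; lra.
Qed.

Section WeylStep.
Variable R : realType.
Local Notation C := R[i].

(** The [Q] factors of [z ^+ Q - 1] show that [z] is near one of the roots. *)
Lemma near_root Q (w z : C) : Q.-primitive_root w ->
  exists k, normc (z - w ^+ k) ^+ Q <= normc (z ^+ Q - 1).
Proof.
move=> hw; have Q0 := prim_order_gt0 hw.
have [k _ hk] := @Order.TotalTheory.arg_minP _ R 'I_Q (Ordinal Q0) xpredT
  (fun k : 'I_Q => normc (z - w ^+ k)) isT.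
exists k; have -> : z ^+ Q - 1 = \prod_(i < Q) (z - w ^+ i).
  have := congr1 (horner^~ z) (factor_Xn_sub_1 hw).
  have -> : (1 : {poly C}) = 1%:P by [].
  rewrite big_mkord horner_prod hornerD hornerN hornerXn hornerC => <-.
  by apply: eq_bigr => i _; rewrite hornerD hornerN hornerX hornerC.
rewrite (big_morph (@normc R) (@normcM R) (@normc1 R)) -{2}[Q]card_ord -prodr_const.
by apply: ler_prod => i _; rewrite normc_ge0 hk.
Qed.

(** The top coefficient is close to a root of unity, up to a set of small measure:
    passing to a finer scale loses little as soon as the scale is stable in the sense
    of [stable_index]. The powers of a root of unity are periodic in [n], so that
    finitely many characters absorb them and the degree drops. *)
Lemma weyl_step d : weyl_property R d -> weyl_property R d.+1.
Proof.
move=> IH e e0; have e40 : 0 < e / 4 by rewrite divr_gt0.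
have [Q [cT [Q0 cT0] hT]] := weyl_top IH e40.
have eQ0 : 0 < e / (2 * Q%:R) by rewrite divr_gt0 ?mulr_gt0 ?ltr0n.
have [q1 [c1 [q10 c10] hI]] := IH _ eQ0.
have [w hw] := @prim_root_exists R Q Q0.
have w1 : unimod w by apply: normc_unity Q0 (prim_expr_order hw).
exists (q1 * Q)%N, (c1 / 2); first by rewrite muln_gt0 q10 Q0 divr_gt0.
move=> X m g mu hmu hf B.
pose cl b x := close b (mu d.+1 x ^+ Q).
pose a b := m (fun x => normc (g x) * (cl b x)%:R).
pose k : R := Num.min (e / 16) (c1 / 2).
have k0 : 0 < k by rewrite lt_min !divr_gt0.
have [ke kc] : k <= e / 16 /\ k <= c1 / 2 by rewrite /k !ge_min !lexx orbT.
have acl i j x : (i <= j)%N -> (cl j x)%:R <= (cl i x)%:R :> R.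
  by move=> ij; rewrite ler_nat /cl; case: (boolP (close j _)) => // /(close_le ij)->.
have [B0 hB0] : exists i, forall j, (i <= j)%N -> a i - a j <= k.
  apply: stable_index => // [i j ij|i].
    by apply: le_mean => [||x]; [bd|bd|]; rewrite ler_wpM2l ?normc_ge0 ?acl.
  by apply: mean_ge0 => [|x]; [bd|]; rewrite mulr_ge0 ?normc_ge0.
have le1b (b : bool) : le1 (b%:R : C) by case: b; auto.
pose gc : ball R X := Ball (fun x => le1M (ballP g x) (le1b (cl B0 x))).
pose gn : ball R X := Ball (fun x => le1M (ballP g x) (le1b (~~ cl B0 x))).
(* Away from the rational points the averages tend to zero. *)
have [k1 hk1] : exists k1, forall M, (k1 <= M)%N ->
    av M (fun n => cmean m (fun x => gn x * mono d.+1 (mu^~ x) n)) < e / 4.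
  apply/not_existsP => hn.
  have fr : frequently (fun M => e / 4 <=
      av M (fun n => cmean m (fun x => gn x * mono d.+1 (mu^~ x) n))).
    move=> k1; apply: contrapT => h; apply: (hn k1) => M kM.
    by rewrite ltNge; apply/negP => h1; apply: h; exists M.
  have := hT X m gn mu hmu fr B0; rewrite leNgt (_ : m _ = 0) ?cT0 //.
  rewrite -[RHS](mean_cst m); apply: eq_mean => x /=.
  by rewrite /cl; case: (close _ _); rewrite ?mulr0 // normc0 mul0r.
have hf1 : frequently (fun M => 3 / 4 * e <=
    av M (fun n => cmean m (fun x => gc x * mono d.+1 (mu^~ x) n))).
  move=> k2; have [M kM eM] := hf (maxn k1 k2); exists M; first by apply: leq_trans kM; rewrite leq_maxr.
  have := hk1 M (leq_trans (leq_maxl _ _) kM).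
  suff : av M (fun n => cmean m (fun x => g x * mono d.+1 (mu^~ x) n)) =
    av M (fun n => cmean m (fun x => gc x * mono d.+1 (mu^~ x) n)) +
    av M (fun n => cmean m (fun x => gn x * mono d.+1 (mu^~ x) n)) by lra.
  rewrite -avD; apply: eq_av => n _; rewrite /cmean -meanD; [|bd|bd].
  apply: eq_mean => x; rewrite -ReD -mulrDl; congr (Re (_ * _)) => /=.
  by rewrite -mulrDr; case: (cl _ _); rewrite ?addr0 ?add0r mulr1.
(* On the surviving set the top coefficient is replaced by a root of unity,
   whose powers are periodic. *)
have /choice[r hr] : forall x, exists k, normc (mu d.+1 x - w ^+ k) ^+ Q <= normc (mu d.+1 x ^+ Q - 1).
  by move=> x; apply: near_root.
pose ro x := w ^+ r x.
have ro1 x : unimod (ro x) by apply: unimodX.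
have hf2 : frequently (fun M => e / 2 <=
    av M (fun n => cmean m (fun x => gc x * (mono d (mu^~ x) n * ro x ^+ (n ^ d.+2))))).
  move=> k2; have [M kM eM] := hf1 k2; exists M => //.
  pose del : R := e / 8 / (M ^ d.+2).+1%:R.
  have del0 : 0 < del by rewrite !divr_gt0 // ltr0n.
  have [B1 [B10 hB1]] := archi_lt (ltW (exprn_gt0 Q (divr_gt0 ltr01 del0))).
  pose b := maxn B0 B1.
  have hb : m (fun x => normc (g x) * (cl B0 x)%:R) - m (fun x => normc (g x) * (cl b x)%:R) <= k.
    by apply: hB0; rewrite leq_maxl.
  have near x : cl b x -> normc (mu d.+1 x - ro x) <= del.
    move=> hb1; rewrite -(ler_pXn2r Q0) ?nnegrE ?normc_ge0 ?(ltW del0) //.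
    apply: le_trans (hr x) _; have {hb1} : cl B1 x by apply: close_le hb1; rewrite leq_maxr.
    rewrite /cl /close -ler_pdivlMr ?ltr0n // => h; apply: le_trans h _.
    rewrite ler_pdivrMr ?ltr0n // -ler_pdivrMl ?exprn_gt0 //.
    by move: hB1; rewrite expr_div_n expr1n mul1r mulr1 => /ltW.
  have pt n x : (n < M)%N -> normc (mono d.+1 (mu^~ x) n - mono d (mu^~ x) n * ro x ^+ (n ^ d.+2)) <=
      e / 8 + 2 * (~~ cl b x)%:R.
    move=> nM; case: (boolP (cl b x)) => [/near h|_] /=; last first.
      rewrite mulr1; apply: le_trans (le_normcD _ _) _; rewrite normcN.
      have h1 : le1 (mono d.+1 (mu^~ x) n) by auto.
      have h2 : le1 (mono d (mu^~ x) n * ro x ^+ (n ^ d.+2)) by auto using unimod_le1.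
      by have := lerD h1 h2; lra.
    rewrite mulr0 addr0 mono_recr -mulrBr normcM (unimod_mono d n) // mul1r.
    apply: le_trans (dist_X _ (hmu _ _) (ro1 x)) _.
    have hn : (n ^ d.+2)%:R <= (M ^ d.+2).+1%:R :> R.
      by rewrite ler_nat ltnW // ltnS leq_exp2r // ltnW.
    apply: le_trans (ler_pM _ _ hn h) _; rewrite ?normc_ge0 //.
    by rewrite /del mulrCA divff ?mulr1 // pnatr_eq0.
  apply: (@le_trans _ _ (av M (fun n => cmean m (fun x => gc x * mono d.+1 (mu^~ x) n)) - e / 4)); first by lra.
  rewrite lerBlDr; have [M0|M0] := posnP M.
    by move: eM; rewrite M0 /av !big_ord0 !mul0r; lra.
  rewrite -[X in _ + X](av_const _ M0) -avD; apply: le_av => n nM.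
  apply: le_trans (cmean_lipschitz m (G := fun x => gc x * (mono d (mu^~ x) n * ro x ^+ (n ^ d.+2))) _ _) _.
  - by move=> x; auto 6.
  - by move=> x; auto 8 using unimod_le1.
  rewrite lerD2l; apply: (@le_trans _ _ (e / 8 + 2 * (m (fun x => normc (g x) * (cl B0 x)%:R) - m (fun x => normc (g x) * (cl b x)%:R)))); last by lra.
  rewrite -meanB; [|bd|bd]; rewrite -meanZ; last bd.
  rewrite -[X in X + _](mean_cst m) -meanD; [|bd|bd].
  apply: le_mean => [||x]; [|bd|].
    by apply: bdd_normcB => x; [auto 6|auto 8 using unimod_le1].
  rewrite -mulrBr normcM; have := pt n x nM; set t := normc (_ - _) => ht.
  have t0 : 0 <= t by exact: normc_ge0.
  have g0 := normc_ge0 (g x); have g1 : normc (g x) <= 1 by exact: ballP.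
  have bB := acl B0 b x (leq_maxl _ _).
  rewrite /= normcM normc_natr; move: ht bB; case: (cl B0 x); case: (cl b x) => /=;
  rewrite ?mulr1n ?mulr0n ?mulr1 ?mulr0 ?mul0r ?addr0 ?subr0; nra.
(* Expanding the periodic factor into characters moves it to the linear
   coefficient. *)
have /choice[c hc] : forall k, exists c : nat -> C, (forall a, le1 (c a)) /\
    forall n, (w ^+ k) ^+ (n ^ d.+2) = \sum_(a < Q) c a * (w ^+ a) ^+ n.
  move=> k3; apply: (fourier_periodic hw) => n; last by auto using unimod_le1.
  rewrite -!exprM -(prim_expr_mod hw) -[RHS](prim_expr_mod hw).
  by rewrite -modnMmr -[in RHS]modnMmr modnXm.
pose mu' a j x := if j is 0 then mu 0%N x * w ^+ a else mu j x.
have mu'1 l j x : unimod (mu' l j x).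
  by case: j => [|j] //=; apply/unimodM/unimodX.
have muE l j x : mu' l j x ^+ (q1 * Q) = mu j x ^+ (q1 * Q).
  case: j => //=; rewrite exprMn (_ : (w ^+ l) ^+ (q1 * Q) = 1) ?mulr1 //.
  by rewrite mulnC exprM [(w ^+ l) ^+ Q]exprAC (prim_expr_order hw) !expr1n.
pose ga a : ball R X := Ball (fun x => le1M (ballP gc x) (proj1 (hc (r x)) a)).
have monoE l n x : mono d (fun j => mu' l j x) n = mono d (mu^~ x) n * (w ^+ l) ^+ n.
  rewrite /mono !big_ord_recl /= expn1 exprMn -!mulrA; congr (_ * _).
  by rewrite mulrC; congr (_ * _); apply: eq_bigr.
have [|l aQ ha] := @frequently_fin Q (fun a M => e / (2 * Q%:R) <=
    av M (fun n => cmean m (fun x => ga a x * mono d (fun j => mu' a j x) n))).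
  move=> k2; have [M kM eM] := hf2 k2; exists M => //.
  apply: contrapT => hlt.
  have : av M (fun n => cmean m (fun x => gc x * (mono d (mu^~ x) n * ro x ^+ (n ^ d.+2)))) =
    \sum_(a < Q) av M (fun n => cmean m (fun x => ga a x * mono d (fun j => mu' a j x) n)).
    rewrite /av -mulr_suml exchange_big; congr (_ / _); apply: eq_bigr => n _.
    rewrite /cmean -mean_sum; last by move=> i; apply: bdd_Re => x; auto 6.
    apply: eq_mean => x; rewrite -Re_sum; congr Re.
    rewrite /ro (proj2 (hc _)) !mulr_sumr; apply: eq_bigr => i _.
    by rewrite monoE /=; ring.
  move=> hs; have : e / 2 < \sum_(a < Q) (e / (2 * Q%:R)).
    apply: (le_lt_trans eM); rewrite hs; apply: ltr_sum => [|i _].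
      by apply/hasP; exists (Ordinal Q0); rewrite ?mem_index_enum.
    by rewrite ltNge; apply/negP => h; apply: hlt; exists i.
  rewrite sumr_const card_ord -(mulr_natr (e / _)) (_ : e / _ * _ = e / 2) ?ltxx //.
  by field; rewrite pnatr_eq0 -lt0n.
have := hI X m (ga l) (mu' l) (mu'1 l) ha (Q * B)%N => hfin.
pose b := maxn B0 (q1 * B).
have hb : m (fun x => normc (g x) * (cl B0 x)%:R) - m (fun x => normc (g x) * (cl b x)%:R) <= k.
  by apply: hB0; rewrite leq_maxl.
suff : m (fun x => normc (ga l x) * (all_close d (Q * B) q1 (fun j => mu' l j x))%:R) <=
   m (fun x => normc (g x) * (all_close d.+1 B (q1 * Q) (mu^~ x))%:R) +
   (m (fun x => normc (g x) * (cl B0 x)%:R) - m (fun x => normc (g x) * (cl b x)%:R)) by lra.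
rewrite -meanB; [|bd|bd]; rewrite -meanD; [|bd|bd].
apply: le_mean => [||x]; [bd|bd|].
have g0 := normc_ge0 (g x); have bB := acl B0 b x (leq_maxl _ _).
have hc1 : normc (c (r x) l) <= 1 by apply: (proj1 (hc _)).
have c0 := normc_ge0 (c (r x) l).
have key : all_close d (Q * B) q1 (fun j => mu' l j x) -> cl b x -> all_close d.+1 B (q1 * Q) (mu^~ x).
  move=> /forallP h1 h2; apply/forallP => j; have [jd|jd] := ltnP j d.+1.
    have := h1 (Ordinal jd) => /close_X; rewrite -exprM => h3.
    by have := h3 (unimodX _ (mu'1 _ _ _)); rewrite muE.
  have -> : j = ord_max by apply: val_inj; apply/eqP; rewrite eqn_leq jd -ltnS ltn_ord.
  rewrite mulnC exprM; apply: close_X; first exact: unimodX.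
  by apply: close_le h2; rewrite leq_maxr.
rewrite /= !normcM normc_natr.
have h1 : normc (g x) * normc (c (r x) l) <= normc (g x) by rewrite ler_piMr.
have h2 : 0 <= normc (g x) * normc (c (r x) l) by rewrite mulr_ge0.
move: key; set A := all_close d.+1 _ _ _ => key.
have h3 : 0 <= normc (g x) * A%:R by rewrite mulr_ge0.
move: bB key h3; set n1 := normc (g x) in g0 h1 h2 *; set n2 := normc (c _ _) in c0 hc1 h1 h2 *.
rewrite mulrAC; move: (all_close d _ _ _) (cl B0 x) (cl b x) A => [] [] [] [] /= h4 key;
  rewrite ?mulr1n ?mulr0n ?mulr1 ?mulr0 ?mul0r => h3;
  try (clear -g0 h1 h2 h3 h4; lra);
  by have := key isT isT.
Qed.

Theorem weyl d : weyl_property R d.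
Proof. by elim: d => [|d]; [exact: weyl_linear|exact: weyl_step]. Qed.

End WeylStep.

(** * Independent polynomials *)

Section Independence.
Implicit Types ps : seq {poly int}.

Definition indep ps := uniq ps /\
  forall c : {poly int} -> int, \sum_(p <- ps) c p *: p = 0 -> forall p, p \in ps -> c p = 0.

Lemma common_denominator (I : finType) (v : I -> rat) :
  exists D, exists2 c : I -> int, (0 < D)%N & forall i, (c i)%:~R = D%:R * v i.
Proof.
exists (absz (\prod_i denq (v i))), (fun i => numq (v i) * \prod_(j | j != i) denq (v j)).
  by rewrite absz_gt0; apply/prodf_neq0 => i _; rewrite denq_neq0.
have D0 : 0 <= \prod_i denq (v i) by apply: prodr_ge0 => i _; apply: ltW; apply: denq_gt0.
move=> i; rewrite pmulrn gez0_abs // [in RHS](bigD1 i) //= !intrM.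
have := divq_num_den (v i); have : (denq (v i))%:~R != 0 :> rat by rewrite intr_eq0 denq_neq0.
set a := (numq _)%:~R; set b := (denq _)%:~R; set c := (\prod_(_ | _) _)%:~R => b0 <-.
by field.
Qed.

(** A rational relation between the rows becomes an integer one after clearing
    denominators. *)
Lemma indep_row_free ps d : indep ps -> (forall p, p \in ps -> (size p <= d.+2)%N) ->
  (forall p, p \in ps -> p.[0] = 0) ->
  row_free (\matrix_(i < size ps, j < d.+1) (((ps`_i)`_j.+1)%:~R : rat)).
Proof.
move=> [ups hps] sps ps0; apply: inj_row_free => v hv.
have [D [c D0 hc]] := common_denominator (fun i => v 0 i).
have Dn : D%:R != 0 :> rat by rewrite pnatr_eq0 -lt0n.
pose c' p : int := if insub (index p ps) is Some i then c i else 0.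
have c'E (i : 'I_(size ps)) : c' ps`_i = c i.
  by rewrite /c' index_uniq // valK.
have z : \sum_(p <- ps) c' p *: p = 0.
  apply/polyP => k; rewrite coef0 coef_sum (big_nth 0) big_mkord.
  case: k => [|k].
    apply: big1 => i _; rewrite coefZ -horner_coef0 ps0 ?mulr0 //.
    by apply: mem_nth.
  have [kd|kd] := ltnP k d.+1; last first.
    apply: big1 => i _; rewrite coefZ [(ps`_i)`_k.+1]nth_default ?mulr0 //.
    by apply: leq_trans (sps _ (mem_nth 0 (ltn_ord i))) _.
  apply/eqP; rewrite -(intr_eq0 rat) rmorph_sum /=; apply/eqP.
  have := congr1 (fun M : 'rV_d.+1 => D%:R * M 0 (Ordinal kd)) hv.
  rewrite !mxE mulr0 mulr_sumr => hs; rewrite -[RHS]hs; apply: eq_bigr => i _.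
  by rewrite coefZ intrM c'E hc !mxE mulrA.
apply/rowP => i; rewrite mxE; apply/eqP; rewrite -(mulrI_eq0 _ (mulfI Dn)) -hc intr_eq0.
by rewrite -c'E (hps _ z) ?mem_nth.
Qed.

(** The exponents of independent polynomials are recovered from their
    coefficients by integer combinations, up to a common multiple. *)
Lemma indep_dual ps d : indep ps -> (forall p, p \in ps -> (size p <= d.+2)%N) ->
  (forall p, p \in ps -> p.[0] = 0) ->
  exists D, exists2 W : 'I_d.+1 -> {poly int} -> int, (0 < D)%N &
  forall p r, p \in ps -> r \in ps ->
    \sum_(j < d.+1) r`_j.+1 * W j p = if r == p then D%:Z else 0.
Proof.
move=> hi sps ps0; have /row_freeP[V AV] := indep_row_free hi sps ps0.
have [D [c D0 hc]] := common_denominator (fun i => V i.1 i.2).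
exists D, (fun j p => if insub (index p ps) is Some i then c (j, i) else 0) => // p r pps rps.
rewrite -index_mem in pps; rewrite -index_mem in rps.
have := congr1 (fun M : 'M_(size ps) => D%:R * M (Ordinal rps) (Ordinal pps)) AV.
rewrite !mxE mulr_sumr insubT /= => h; apply/eqP; rewrite -(eqr_int rat) rmorph_sum /=.
apply/eqP; transitivity (D%:R * (Ordinal rps == Ordinal pps)%:R : rat).
  rewrite -h; apply: eq_bigr => j _; rewrite intrM hc !mxE /= nth_index -?index_mem //.
  by rewrite mulrCA.
rewrite -val_eqE /=; case: (r =P p) => [->|rp]; first by rewrite eqxx mulr1.
case: eqP => [e|]; last by rewrite mulr0.
by case: rp; rewrite -(nth_index 0 (_ : r \in ps)) -?index_mem // e nth_index -?index_mem.
Qed.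

End Independence.

Section WeylFamily.
Variable R : realType.
Local Notation C := R[i].

Lemma dist1_prod (I : Type) (r : seq I) (F : I -> C) : (forall i, unimod (F i)) ->
  normc (\prod_(i <- r) F i - 1) <= \sum_(i <- r) normc (F i - 1).
Proof.
move=> hF; elim: r => [|i r IH]; first by rewrite !big_nil subrr normc0.
by rewrite !big_cons; apply: le_trans (dist1_M _ (hF i)) _; rewrite lerD2l.
Qed.

(** Weyl's theorem makes the combinations of the [lam p] by the coefficients of each
    degree almost rational; by [indep_dual] these combinations generate the
    [lam p] up to bounded powers. *)
Theorem weyl_family (ps : seq {poly int}) (e : R) : indep ps ->
  (forall p, p \in ps -> p.[0] = 0) -> 0 < e ->
  exists q, exists2 c : R, (0 < q)%N /\ 0 < c &
  forall (X : Type) (m : mean R X) (g : ball R X) (lam : {poly int} -> X -> C),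
    (forall p x, unimod (lam p x)) ->
    frequently (fun M => e <= av M (fun n => cmean m (fun x => g x * phase ps id (lam^~ x) n))) ->
    forall B, c <= m (fun x => normc (g x) * (all (fun p => close B (lam p x ^+ q)) ps)%:R).
Proof.
move=> hi ps0 e0; pose d := (\max_(p <- ps) size p)%N.
have sps p : p \in ps -> (size p <= d.+2)%N.
  move=> pps; have := @leq_bigmax_seq _ ps xpredT (fun r : {poly int} => size r) p pps isT.
  by rewrite -/d => h; rewrite ltnW // ltnS ltnW.
have [D [W D0 hW]] := indep_dual hi sps ps0.
have [q [c [q0 c0] hq]] := weyl d e0.
exists (D * q)%N, c; first by rewrite muln_gt0 D0.
move=> X m g lam hl hf B.
pose nu j x : C := \prod_(p <- ps) lam p x ^ p`_j.+1.
have nu1 j x : unimod (nu j x) by apply: unimod_prod => p _; apply: unimodXz.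
have phE x n : phase ps id (lam^~ x) n = mono d (nu^~ x) n.
  pose tr p := if p \in ps then p else 0.
  have trE : {in ps, tr =1 id} by move=> p pps; rewrite /tr pps.
  transitivity (phase ps tr (lam^~ x) n).
    by apply: eq_big_seq => p /trE ->.
  rewrite (@phase_coef _ _ _ _ _ d.+2) //; last first.
    by move=> p; rewrite /tr; case: ifP => [/sps|] //; rewrite size_poly0.
  rewrite big_ord_recl expn0 expr1 [X in X * _]big1_seq ?mul1r; last first.
    by move=> p /andP[_ pps]; rewrite trE // -horner_coef0 ps0 // expr0z.
  apply: eq_bigr => j _; congr (_ ^+ _).
  by apply: eq_big_seq => p /trE ->.
pose T := (\sum_(p <- ps) \sum_(j < d.+1) `|W j p|)%N.
have := hq X m g nu nu1.
have E1 M : av M (fun n => cmean m (fun x => g x * phase ps id (lam^~ x) n)) =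
    av M (fun n => cmean m (fun x => g x * mono d (nu^~ x) n)).
  by apply: eq_av => n _; apply: eq_cmean => x; rewrite phE.
under [X in frequently X -> _]eq_fun => M do rewrite -E1.
move=> /(_ hf (T * B)%N) hc; apply: le_trans hc _; apply: le_mean => [||x]; [bd|bd|].
rewrite ler_wpM2l ?normc_ge0 // ler_nat.
case: (boolP (all_close _ _ _ _)) => // /forallP hcl.
suff -> : all (fun p => close B (lam p x ^+ (D * q))) ps by [].
apply/allP => p pps.
have -> : lam p x ^+ (D * q) = \prod_(j < d.+1) (nu j x ^+ q) ^ (W j p).
  transitivity (\prod_(j < d.+1) \prod_(r <- ps) (lam r x ^+ q) ^ (r`_j.+1 * W j p)).
    rewrite exchange_big /= (bigD1_seq p) //=; last by case: hi.
    have sumE r : r \in ps -> \prod_(j < d.+1) (lam r x ^+ q) ^ (r`_j.+1 * W j p) =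
        (lam r x ^+ q) ^ (if r == p then D%:Z else 0).
      move=> rps; rewrite -hW //; apply: esym; apply: (big_morph (fun z => _ ^ z)) => [a b|].
        by rewrite expfzDr // expf_neq0 // unimod_neq0.
      by rewrite expr0z.
    rewrite sumE // eqxx -exprnP -exprM mulnC big1_seq ?mulr1 // => r /andP[/negbTE rp rps].
    by rewrite sumE // rp expr0z.
  apply: eq_bigr => j _; rewrite /nu.
  rewrite -prodrXl; transitivity (\prod_(r <- ps) ((lam r x ^ r`_j.+1) ^+ q) ^ (W j p)).
    apply: eq_bigr => r _; rewrite !exprnP !exprz_exp; congr (_ ^ _); ring.
  apply: esym; apply: (big_morph (fun z => z ^ W j p)) => [a b|]; first exact: expfzMl.
  by rewrite exp1rz.
rewrite /close; apply: (@le_trans _ _ ((\sum_(j < d.+1) (`|W j p|%N)%:R * normc (nu j x ^+ q - 1)) * B%:R)).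
  rewrite ler_wpM2r //; apply: le_trans (dist1_prod _ _) _.
    by move=> j; apply/unimodXz/unimodX.
  by apply: ler_sum => j _; apply: dist1_Xz; apply: unimodX.
case: (posnP (T * B)) => [/eqP|TB0].
  rewrite muln_eq0 => /orP[/eqP T0|/eqP ->]; last by rewrite mulr0.
  rewrite big1 ?mul0r // => j _; suff -> : `|W j p|%N = 0%N by rewrite mul0r.
  move: T0; rewrite /T (big_rem p) //= => /eqP; rewrite addn_eq0 => /andP[/eqP h _].
  by move: h; rewrite (bigD1 j) //= => /eqP; rewrite addn_eq0 => /andP[/eqP].
have TBR : 0 < (T * B)%:R :> R by rewrite ltr0n.
apply: (@le_trans _ _ ((\sum_(j < d.+1) (`|W j p|%N)%:R * ((T * B)%:R^-1)) * B%:R)).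
  rewrite ler_wpM2r //; apply: ler_sum => j _; rewrite ler_wpM2l //.
  by have := hcl j; rewrite /close -ler_pdivlMr // div1r.
rewrite -mulr_suml -natr_sum mulrAC ler_pdivrMr // mul1r -natrM ler_nat leq_mul2r.
by rewrite /T (big_rem p) //= leq_addr orbT.
Qed.

End WeylFamily.

(** * Extensions carrying eigenfunctions *)

Section BoxMeanLemmas.
Variable R : realType.
Local Notation C := R[i].

Lemma eq_box_size Hs (F G : seq nat -> R) :
  (forall h, size h = size Hs -> F h = G h) -> box_mean R Hs F = box_mean R Hs G.
Proof.
elim: Hs F G => [|H Hs IH] F G h; first exact: h.
by rewrite !box_meanS; apply: eq_mean => a; apply: IH => k hk; apply: h; rewrite /= hk.
Qed.

Lemma box_exchange Hs Ks (F : seq nat -> seq nat -> R) (K : R) : (forall h k, `|F h k| <= K) ->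
  box_mean R Hs (fun h => box_mean R Ks (F h)) =
  box_mean R Ks (fun k => box_mean R Hs (F^~ k)).
Proof. by move=> hK; rewrite -mean_box // => k; exists K. Qed.

Lemma cubeX h h' (Z : seq nat -> C) n :
  cube h h' (fun l => Z l ^+ n) = cube h h' Z ^+ n.
Proof.
elim: n => [|n IH].
  rewrite expr0; elim: h h' Z => [|a h IHh] [|b h'] Z //=.
  by rewrite !IHh rmorph1 mulr1.
by rewrite exprS -IH -cubeM; apply: eq_cube => l; rewrite exprS.
Qed.

Lemma unimod_cube h h' (Z : seq nat -> C) : (forall l, unimod (Z l)) -> unimod (cube h h' Z).
Proof.
elim: h h' Z => [|a h IH] [|b h'] Z hZ //=.
by apply: unimodM; [|apply: unimodJ]; apply: IH.
Qed.

Lemma cubeXz h h' (Z : seq nat -> C) (n : int) : (forall l, unimod (Z l)) ->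
  cube h h' (fun l => Z l ^ n) = cube h h' Z ^ n.
Proof.
move=> hZ; case: n => n; first exact: cubeX.
rewrite NegzE -exprnN -exprVn unimodV; last exact: unimod_cube.
rewrite -cube_conj -cubeX; apply: eq_cube => l.
by rewrite -exprnN -exprVn unimodV.
Qed.

End BoxMeanLemmas.

Section Factor.
Variable R : realType.

Definition factor (T S : system R) (r : T -> S) :=
  (forall a z, r (act a z) = act a (r z)) /\
  forall F, bdd F -> smean T (fun z => F (r z)) = smean S F.

Lemma factor_comp (T U S : system R) (r : T -> U) (s : U -> S) :
  factor r -> factor s -> factor (s \o r).
Proof.
move=> [ra rm] [sa sm]; split=> [a z|F hF] /=; first by rewrite ra sa.
by rewrite (rm (fun u => F (s u))) ?sm //; apply: bdd_comp.
Qed.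

End Factor.

Section Lift.
Variable R : realType.
Local Notation C := R[i].
Variables (S : system R) (d : nat).

(* Factorials, so that every fixed length divides all but finitely many. *)
Definition len t := (t.+1)`!.
Definition lens t := nseq d (len t).

Lemma len_gt0 t : (0 < len t)%N. Proof. exact: fact_gt0. Qed.
Hint Resolve len_gt0 : core.

Lemma len2_gt0 t : (0 < 2 * len t)%N. Proof. by rewrite muln_gt0 len_gt0. Qed.
Hint Resolve len2_gt0 : core.

(** A point of the extension is a point [y] of [S] with a time [i]; the system
    acts on the time and is a factor through [act i y]. The eigenfunctions found
    along each orbit are characters of the time; they depend on the length [t] and
    the cube parameters as well. *)
Definition index := (nat * (seq nat * (seq nat * seq nat)))%type.

Definition orbit_mean t : mean R (S * int) :=
  bind_mean (smean S) (fun y => map_mean (fun i => (y, i%:Z)) (unif (2 * len t))).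

Definition index_mean : mean R index :=
  bind_mean LIM (fun t => bind_mean (box_mean R (lens t)) (fun h' =>
    bind_mean (box_mean R (lens t)) (fun h =>
      map_mean (fun k => (t, (h', (h, k)))) (box_mean R (lens t))))).

Definition lift_mean : mean R (index * (S * int)) :=
  bind_mean index_mean (fun w => map_mean (fun u => (w, u)) (orbit_mean w.1)).

Lemma orbit_meanE t F : orbit_mean t F =
  smean S (fun y => av (2 * len t) (fun i => F (y, i%:Z))).
Proof.
by apply: (@eq_mean _ _ (smean S) (fun y => unif _ (fun i => F (y, i%:Z)))) => y; rewrite unifE.
Qed.

Lemma index_meanE F : index_mean F = LIM (fun t => box_mean R (lens t) (fun h' =>
  box_mean R (lens t) (fun h => box_mean R (lens t) (fun k => F (t, (h', (h, k))))))).
Proof. by []. Qed.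

Lemma lift_meanE F : lift_mean F = index_mean (fun w => orbit_mean w.1 (fun u => F (w, u))).
Proof. by []. Qed.

Lemma orbit_mean_act t (k : int) F : bdd F ->
  orbit_mean t (fun u => F (act (u.2 + k) u.1)) = smean S F.
Proof.
move=> [K hK]; rewrite orbit_meanE mean_av => [|i]; last by exists K.
rewrite -[RHS](av_const _ (len2_gt0 t)); apply: eq_av => i _ /=.
by apply: smean_act; exists K.
Qed.

Lemma index_mean_small (F : index -> R) (K : R) :
  (forall w, `|F w| <= K / (w.1).+1%:R) -> index_mean F = 0.
Proof.
move=> hK; rewrite index_meanE; apply: (LIM_small (K := K)) => t.
by do 3!apply: mean_norm => ?; apply: hK.
Qed.

(** A translation of the time by [a] changes averages over [2 * len t] times by at
    most a multiple of [a / len t], which vanishes in the limit. *)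
Lemma lift_mean_act (a : int) (F : index * (S * int) -> R) : bdd F ->
  lift_mean (fun z => F (z.1, (z.2.1, z.2.2 + a))) = lift_mean F.
Proof.
have nn (b : nat) (G : index * (S * int) -> R) : bdd G ->
    lift_mean (fun z => G (z.1, (z.2.1, z.2.2 + b%:Z))) = lift_mean G.
  move=> [K1 hK1]; have [K [K0 hK]] : exists K : R, 0 <= K /\ forall z, `|G z| <= K.
    by exists `|K1|; split=> // z; apply: le_trans (hK1 z) (ler_norm _).
  apply/eqP; rewrite -subr_eq0 !lift_meanE.
  have hb (L : index * (S * int) -> R) : (forall z, `|L z| <= K) -> bdd (fun w => orbit_mean w.1 (fun u => L (w, u))).
    by move=> hL; exists K => w; apply: mean_norm.
  rewrite -(meanB index_mean); [|by apply: (hb (fun z => G (z.1, (z.2.1, z.2.2 + b%:Z)))) => z|exact: hb].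
  apply/eqP; apply: (@index_mean_small _ (2 * K * b%:R)).
  move=> w; rewrite -(meanB (orbit_mean w.1)); [|by exists K => u|by exists K => u].
  rewrite orbit_meanE; apply: mean_norm => y /=.
  rewrite avB; have := av_shift (2 * len w.1) b (c := fun i => G (w, (y, i%:Z))) (fun i => hK _).
  rewrite (eq_av (d := fun n => G (w, (y, n%:Z + b%:Z)))) => [|n _]; last by rewrite PoszD.
  move=> h; apply: le_trans h _; rewrite ler_wpM2l ?mulr_ge0 // lef_pV2 ?posrE ?ltr0n //.
  by rewrite ler_nat /len; apply: leq_trans (leq_pmull _ (isT : (0 < 2)%N)); apply: fact_geq.
case: a => b hF; first exact: nn.
rewrite NegzE -(nn b.+1); last by case: hF => K hK; exists K.
by apply: (eq_mean lift_mean) => -[w [y i]]; congr (F (w, (y, _))) => /=; lia.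
Qed.

Definition lift_system : system R.
Proof.
refine (@System R (index * (S * int)) (fun a z => (z.1, (z.2.1, z.2.2 + a))) lift_mean _ _ _).
- by case=> w [y i] /=; rewrite addr0.
- by move=> a b [w [y i]] /=; rewrite -addrA [b + a]addrC.
- exact: lift_mean_act.
Defined.

Definition lift_map (z : lift_system) : S := act z.2.2 z.2.1.

Lemma orbit_mean_map t F : bdd F -> orbit_mean t (fun u => F (act u.2 u.1)) = smean S F.
Proof.
move=> hF; rewrite -(orbit_mean_act t 0 hF).
by apply: (eq_mean (orbit_mean t)) => u; rewrite addr0.
Qed.

Lemma lift_mean_shift (k : index -> int) F : bdd F ->
  smean lift_system (fun z => F (act (k z.1) (lift_map z))) = smean S F.
Proof.
move=> hF; rewrite [LHS]lift_meanE -[RHS](mean_cst index_mean); apply: (eq_mean index_mean) => w.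
rewrite -(orbit_mean_act w.1 (k w) hF); apply: (eq_mean (orbit_mean w.1)) => u.
by rewrite /lift_map /= -actD addrC.
Qed.

Lemma lift_factor : factor lift_map.
Proof.
split=> [a z|F hF]; first by rewrite /lift_map /= -actD addrC.
rewrite -(lift_mean_shift (fun=> 0) hF); apply: eq_mean => z; by rewrite act0.
Qed.

Lemma le_index (F G : index -> R) : bdd F -> bdd G ->
  (forall t h' h k, size h' = d -> size h = d -> size k = d ->
     F (t, (h', (h, k))) <= G (t, (h', (h, k)))) -> index_mean F <= index_mean G.
Proof.
move=> [KF hF] [KG hG] hFG.
pose ok (w : index) := [&& size w.2.1 == d, size w.2.2.1 == d & size w.2.2.2 == d].
apply: (@le_trans _ _ (index_mean (fun w => if ok w then F w else G w))).
  rewrite le_eqVlt; apply/orP; left; apply/eqP; rewrite !index_meanE.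
  apply: eq_mean => t; apply: eq_box_size => h'; rewrite size_nseq => sh'.
  apply: eq_box_size => k; rewrite size_nseq => sk.
  apply: eq_box_size => l; rewrite size_nseq => sl.
  by rewrite /ok sh' sk sl !eqxx.
apply: le_mean => [||w]; [|by exists KG|].
  exists (`|KF| + `|KG|) => w; case: (ok w).
    by apply: le_trans (hF w) _; rewrite (le_trans (ler_norm _)) // lerDl.
  by apply: le_trans (hG w) _; rewrite (le_trans (ler_norm _)) // lerDr.
case: w => t [h' [h k]]; case: ifP => // /and3P[/eqP s1 /eqP s2 /eqP s3].
exact: hFG.
Qed.

Lemma eq_lift (F G : lift_system -> R) :
  (forall t h' h k u, size h' = d -> size h = d -> size k = d ->
     F ((t, (h', (h, k))), u) = G ((t, (h', (h, k))), u)) ->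
  smean lift_system F = smean lift_system G.
Proof.
move=> h; rewrite ![LHS]lift_meanE ![RHS]lift_meanE !index_meanE; apply: eq_mean => t; apply: eq_box_size => h'; rewrite size_nseq => sh'.
apply: eq_box_size => k; rewrite size_nseq => sk.
apply: eq_box_size => l; rewrite size_nseq => sl.
by apply: (eq_mean (orbit_mean t)) => u; apply: h.
Qed.

End Lift.

Section PartialDeps.
Variable R : realType.
Local Notation C := R[i].

Lemma partial_deps1 (P : Type) d : partial_deps d (fun (_ : seq nat) (_ : P) => 1 : C).
Proof.
elim: d => [|d IH] //=; exists (fun _ _ => 1), (fun _ _ _ => 1); split=> *; auto.
by rewrite mulr1.
Qed.

Lemma cube_first_vertices (P : Type) d (Z : seq nat -> P -> C) : (forall h p, le1 (Z h p)) ->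
  exists W : seq nat -> seq nat -> P -> C,
  [/\ forall k, partial_deps d (W k), (forall k h p, le1 (W k h p)) &
    forall k h p, size k = d -> size h = d -> cube h k (fun l => Z l p) = Z h p * W k h p].
Proof.
move=> hZ; suff /choice[W hW] : forall k, exists V : seq nat -> P -> C,
  [/\ partial_deps d V, (forall h p, le1 (V h p)) &
    forall h p, size k = d -> size h = d -> cube h k (fun l => Z l p) = Z h p * V h p].
  by exists W; split=> k *; have [? ? ?] := hW k; auto.
move=> k; have [skd|skd] := eqVneq (size k) d.
  have [W] := cube_first_vertex k hZ; rewrite skd => -[? ? hW].
  by exists W; split=> // h p _ sh; apply: hW; rewrite sh.
exists (fun _ _ => 1); split=> [|*|h p sk]; [exact: partial_deps1|auto|].
by rewrite sk eqxx in skd.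
Qed.

Lemma cube_norm01 h k (Z : seq nat -> C) : (forall l, normc (Z l) = 0 \/ normc (Z l) = 1) ->
  normc (cube h k Z) = 0 \/ normc (cube h k Z) = 1.
Proof.
elim: h k Z => [|a h IH] [|b k] Z hZ //=.
rewrite normcM normc_conj.
have [->|->] := IH k (fun l => Z (a :: l)) (fun l => hZ _).
  by left; rewrite mul0r.
by rewrite mul1r; apply: IH.
Qed.

End PartialDeps.

Section Characters.
Variable R : realType.
Local Notation C := R[i].
Variables (S : system R) (f : ball R S) (d : nat) (c : R).
Hypothesis c0 : 0 < c.
Hypothesis f_structured : forall H, (0 < H)%N -> c <= Box (nseq d.+2 H) f.
Local Notation E := (cmean (smean S)).
Local Notation T := (lift_system S d).
Hint Resolve len_gt0 len2_gt0 : core.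

Lemma local_character t h h' (y : S) : exists2 z : C, normc z = 1 &
  av (len t) (fun a => av (len t) (fun a' => av (len t) (fun b => av (len t) (fun b' =>
     Re ((dcube h h' f (act (a + b)%N%:Z y) * (dcube h h' f (act (a' + b)%N%:Z y))^J) *
         (dcube h h' f (act (a + b')%N%:Z y) * (dcube h h' f (act (a' + b')%N%:Z y))^J)^J)))))
  <= 2 * normc (av (2 * len t) (fun i => dcube h h' f (act i%:Z y) * z ^+ i)).
Proof. by apply: (@box2_inverse _ (len t) (fun i => dcube h h' f (act i y))) => // i; auto. Qed.

Definition freq t h h' y : C := s2val (cid2 (local_character t h h' y)).

Lemma freq_unimod t h h' y : unimod (freq t h h' y).
Proof. exact: s2valP (cid2 (local_character t h h' y)). Qed.
Hint Resolve freq_unimod : core.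

Definition cor t h h' y : C :=
  av (2 * len t) (fun i => dcube h h' f (act i%:Z y) * freq t h h' y ^+ i).

(** Points where the correlation with the character is too small are discarded,
    so that the rest is controlled pointwise. *)
Definition good t h h' y : bool := c / 4 <= normc (cor t h h' y).

Definition amp t h h' y : C :=
  if good t h h' y then (cor t h h' y)^J / (normc (cor t h h' y))%:C else 0.

Definition chi t h h' (u : S * int) : C := amp t h h' u.1 * freq t h h' u.1 ^ u.2.

Lemma le1_cor t h h' y : le1 (cor t h h' y).
Proof. by rewrite /cor; auto 8 using unimod_le1. Qed.

Lemma normc_amp t h h' y : normc (amp t h h' y) = (good t h h' y)%:R.
Proof.
rewrite /amp; case: (boolP (good _ _ _ _)) => [g|_]; last by rewrite normc0.
have n0 : normc (cor t h h' y) != 0.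
  by rewrite gt_eqF //; apply: lt_le_trans g; rewrite divr_gt0.
by rewrite normcM normcV normc_conj normc_real ger0_norm ?normc_ge0 // divff.
Qed.

Lemma normc_chi t h h' u : normc (chi t h h' u) = (good t h h' u.1)%:R.
Proof. by rewrite /chi normcM normc_amp (unimodXz _ (freq_unimod _ _ _ _)) mulr1. Qed.

Lemma le1_chi t h h' u : le1 (chi t h h' u).
Proof. by rewrite /le1 normc_chi; case: (good _ _ _ _). Qed.
Hint Resolve le1_chi : core.

Lemma chi_act t h h' y i (a : int) : chi t h h' (y, i + a) = freq t h h' y ^ a * chi t h h' (y, i).
Proof.
rewrite /chi /= addrC expfzDr; first by rewrite mulrCA.
exact: unimod_neq0.
Qed.

Lemma Re_amp_cor t h h' y : Re (amp t h h' y * cor t h h' y) = normc (cor t h h' y) * (good t h h' y)%:R.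
Proof.
rewrite /amp; case: (good _ _ _ _); last by rewrite mul0r mulr0.
have [->|n0] := eqVneq (cor t h h' y) 0; first by rewrite mulr0 normc0 mul0r.
rewrite mulr1 mulrAC [_^J * _]mulrC mulcJ -[_^-1]fmorphV -rmorphM /=.
by rewrite expr2 mulfK // normc_eq0.
Qed.

Lemma orbit_chi t h h' y :
  av (2 * len t) (fun i => Re (dcube h h' f (act i%:Z y) * chi t h h' (y, i%:Z))) =
  normc (cor t h h' y) * (good t h h' y)%:R.
Proof.
rewrite -Re_amp_cor -Re_av -avZ; congr Re; apply: eq_av => i _.
by rewrite /chi /= mulrCA exprnP.
Qed.

Lemma Box2E H (g : S -> C) : (0 < H)%N -> (forall x, le1 (g x)) ->
  Box [:: H; H] g = smean S (fun y => av H (fun a => av H (fun a' => av H (fun b => av H (fun b' =>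
     Re ((g (act (a + b)%N%:Z y) * (g (act (a' + b)%N%:Z y))^J) *
         (g (act (a + b')%N%:Z y) * (g (act (a' + b')%N%:Z y))^J)^J)))))).
Proof.
move=> H0 hg; rewrite /= !(maxn_idPl H0).
rewrite mean_av => [|a]; last bd; apply: eq_av => a _.
rewrite mean_av => [|a']; last bd; apply: eq_av => a' _.
rewrite mean_av => [|b]; last bd; apply: eq_av => b _.
rewrite mean_av => [|b']; last bd; apply: eq_av => b' _.
by apply: eq_mean => y; rewrite -!actD -!PoszD.
Qed.

Lemma Box2_le t h h' :
  Box [:: len t; len t] (dcube h h' f) <=
  2 * (cmean (orbit_mean S t) (fun u => dcube h h' f (act u.2 u.1) * chi t h h' u) + c / 4).
Proof.
rewrite Box2E => [||x]; [|exact: len_gt0|auto].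
rewrite /cmean orbit_meanE -{1}(mean_cst (smean S) (c / 4)) -meanD; [|bd|bd].
rewrite -meanZ; last bd.
apply: le_mean => [||y]; [bd|bd|].
have := s2valP' (cid2 (local_character t h h' y)); rewrite -/(freq t h h' y) -/(cor t h h' y).
move=> hc; apply: le_trans hc _; rewrite ler_wpM2l // orbit_chi.
have := normc_ge0 (cor t h h' y); rewrite /good; move: (normc _) => r.
by case: (leP (c / 4) r) => [_|hlt] r0; rewrite ?mulr1n ?mulr0n ?mulr1 ?mulr0; move: c0; lra.
Qed.

(** The inequality [box2_inverse] applies to each piece of orbit; discarding the
    small correlations costs at most [c / 4]. *)
Lemma lift_chi : c / 4 <= cmean (smean T)
  (fun z => dcube z.1.2.2.1 z.1.2.1 f (lift_map z) * chi z.1.1 z.1.2.2.1 z.1.2.1 z.2).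
Proof.
rewrite /cmean [leRHS]lift_meanE index_meanE.
have K1 t h h' : `|orbit_mean S t (fun u => Re (dcube h h' f (act u.2 u.1) * chi t h h' u))| <= 1.
  by apply: mean_norm => u; apply: le_trans (absRe_le _) _; apply: (_ : le1 _); auto.
apply: (LIM_ge (N := 0)) => [|t _].
  by exists 1 => t; do 3!apply: mean_norm => ?; apply: K1.
have := f_structured (len_gt0 t).
have -> : nseq d.+2 (len t) = lens d t ++ [:: len t; len t] by rewrite /lens -addn2 nseqD.
rewrite Box_cat => [hc|x]; last by auto.
pose orb h h' := orbit_mean S t (fun u => Re (dcube h h' f (act u.2 u.1) * chi t h h' u)).
have {hc} : c <= 2 * (box_mean R (lens d t) (fun h => box_mean R (lens d t) (fun h' => orb h h')) + c / 4).
  apply: le_trans hc _.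
  have bo h : bdd (orb h) by exists 1 => h'; apply: K1.
  have bb : bdd (fun h => box_mean R (lens d t) (orb h)).
    by exists 1 => h; apply: mean_norm => h'; apply: K1.
  rewrite -[X in _ + X](mean_cst (box_mean R (lens d t))) -meanD; [|exact: bb|exact: bdd_cst].
  rewrite -meanZ; last by apply: bddD; [exact: bb|exact: bdd_cst].
  apply: le_mean => [||h]; [|by apply: bddM; [exact: bdd_cst|apply: bddD; [exact: bb|exact: bdd_cst]]|].
    by exists 1 => h; apply: mean_norm => h'; apply: Box_norm => x; auto.
  rewrite -[X in _ + X](mean_cst (box_mean R (lens d t))) -meanD; [|exact: bo|exact: bdd_cst].
  rewrite -meanZ; last by apply: bddD => //; exact: bdd_cst.
  apply: le_mean => [||h']; [|by apply: bddM; [exact: bdd_cst|apply: bddD => //; exact: bdd_cst]|].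
    by exists 1 => h'; apply: Box_norm => x; auto.
  exact: Box2_le.
have aux (A B X : R) : c <= 2 * (A + c / 4) -> A = B -> B = X -> c / 4 <= X by lra.
move=> hc; apply: (aux _ _ _ hc (@box_exchange R (lens d t) (lens d t) orb 1 (K1 t))).
by apply: eq_mean => h'; apply: eq_mean => h; exact: (esym (mean_cst (box_mean R (lens d t)) (orb h h'))).
Qed.

(** The eigenfunction built from the characters on the vertices of a cube. *)
Definition vertex_chi (z : T) : C := cube z.1.2.2.1 z.1.2.2.2 (fun l => chi z.1.1 l z.1.2.1 z.2).
Definition vertex_freq (z : T) : C := cube z.1.2.2.1 z.1.2.2.2 (fun l => freq z.1.1 l z.1.2.1 z.2.1).

Lemma unimod_vertex_freq z : unimod (vertex_freq z).
Proof. by apply: unimod_cube => l. Qed.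

Lemma le1_vertex_chi z : le1 (vertex_chi z).
Proof. by rewrite /vertex_chi; auto. Qed.

Lemma vertex_chi_act (a : int) z : vertex_chi (act a z) = vertex_freq z ^ a * vertex_chi z.
Proof.
case: z => w [y i]; rewrite /vertex_chi /vertex_freq -cubeXz; last by move=> l.
by rewrite -cubeM; apply: eq_cube => l; rewrite -chi_act.
Qed.

End Characters.

Definition positive (R : realType) (c : nat -> R) :=
  exists2 e, 0 < e & frequently (fun M => e <= av M c).

Section MeanCauchySchwarz.
Variable R : realType.
Local Notation C := R[i].

Lemma av_exp2 M d (u : nat -> R) : (0 < M)%N -> bdd u ->
  av M u ^+ (2 ^ d) <= av M (fun n => u n ^+ (2 ^ d)).
Proof. by move=> M0 hu; rewrite -!unifE //; apply: mean_exp2. Qed.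

Lemma mean_box_cauchy_schwarz (Q P : Type) (m : mean R Q) (mu : Q -> mean R P)
    (Hs : Q -> seq nat) d (Z W : Q -> seq nat -> P -> C) :
  (forall q, size (Hs q) = d) ->
  (forall q h p, le1 (Z q h p)) -> (forall q h p, le1 (W q h p)) ->
  (forall q, partial_deps d (W q)) ->
  m (fun q => box_mean R (Hs q) (fun h => cmean (mu q) (fun p => Z q h p * W q h p))) ^+ (2 ^ d)
  <= m (fun q => box_mean R (Hs q) (fun h => box_mean R (Hs q) (fun k =>
       cmean (mu q) (fun p => cube h k (fun l => Z q l p))))).
Proof.
move=> sHs hZ hW dW.
have hb : bdd (fun q => box_mean R (Hs q) (fun h => cmean (mu q) (fun p => Z q h p * W q h p))).
  by exists 1 => q; apply: mean_norm => h; apply: cmean_norm => p; auto.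
apply: le_trans (mean_exp2 _ _ hb) _; apply: le_mean => [||q]; [exact: bddX| |].
  by exists 1 => q; do 2!apply: mean_norm => ?; apply: cmean_norm => p; auto.
by have := @box_cauchy_schwarz R P (mu q) (Hs q) (Z q) (W q); rewrite sHs; apply.
Qed.

End MeanCauchySchwarz.

Section Correlation.
Variable R : realType.
Local Notation C := R[i].
Variables (S : system R) (f : ball R S) (d : nat) (c : R).
Hypothesis c0 : 0 < c.
Hypothesis f_structured : forall H, (0 < H)%N -> c <= Box (nseq d.+2 H) f.
Local Notation E := (cmean (smean S)).
Local Notation T := (lift_system S d).
Local Notation chi := (chi f c).
Local Notation freq := (freq f).
Local Notation X := (@vertex_chi R S f d c).
Local Notation L := (@vertex_freq R S f d).
Hint Resolve len_gt0 len2_gt0 le1_chi le1_vertex_chi : core.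

Lemma first_vertices_f : exists W : seq nat -> seq nat -> S -> C,
  [/\ forall k, partial_deps d (W k), (forall k h p, le1 (W k h p)) &
    forall k h x, size k = d -> size h = d -> dcube h k f x = f (act (sumn h)%:Z x) * W k h x].
Proof. by apply: (@cube_first_vertices R S d (fun h x => f (act (sumn h)%:Z x))) => h x; auto. Qed.

(** In [lift_chi] the function [f] occurs at the first vertex of each cube, where it
    is replaced by the averages approximating it. The other vertices are removed by
    the Cauchy--Schwarz inequality, which differentiates what is left along cubes;
    translating by [p n] then produces the power of the eigenvalue. *)
Lemma lift_correlates (a : nat -> S -> C) (p : nat -> int) : (forall n x, le1 (a n x)) ->
  approximable f (fun M x => av M (fun n => a n (act (- p n) x))) ->
  positive (fun n => cmean (smean T) (fun z =>
    dcube z.1.2.2.1 z.1.2.2.2 (a n) (lift_map z) * (X z * L z ^ p n))).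
Proof.
move=> ha hap; have [W [dW W1 hW]] := first_vertices_f.
pose r (z : T) := act (sumn z.1.2.2.1)%:Z (lift_map z).
pose G (z : T) := W z.1.2.1 z.1.2.2.1 (lift_map z) * chi z.1.1 z.1.2.2.1 z.1.2.1 z.2.
have G1 z : le1 (G z) by rewrite /G; auto.
have hc : c / 4 <= cmean (smean T) (fun z => f (r z) * G z).
  apply: le_trans (lift_chi c0 f_structured) _; rewrite le_eqVlt; apply/orP; left; apply/eqP.
  by apply: eq_lift => t h' h k u s1 s2 s3; rewrite [X in X * _]hW // -mulrA.
have c40 : 0 < c / 4 by rewrite divr_gt0.
have {}hap := hap T (smean T) r G (c / 4)
  (fun F => @lift_mean_shift R S d (fun w => (sumn w.2.2.1)%:Z) F) G1 c40 hc.
exists ((c / 4 / 2) ^+ (2 ^ d)); first by rewrite exprn_gt0 // !divr_gt0.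
move=> k; have [M kM hM] := hap k.+1; exists M; first exact: ltnW.
have M0 : (0 < M)%N by apply: leq_trans kM.
pose y n := cmean (smean T) (fun z => a n (act (- p n) (r z)) * G z).
have yM : c / 4 / 2 <= av M y.
  apply: le_trans hM _; rewrite /y -cmean_av => [|n z]; last by auto.
  by rewrite le_eqVlt; apply/orP; left; apply/eqP; apply: eq_cmean => z; rewrite avZr.
have c80 : 0 <= c / 4 / 2 by rewrite !divr_ge0 // ltW.
apply: (@le_trans _ _ (av M y ^+ (2 ^ d))).
  by rewrite lerXn2r ?nnegrE // (le_trans c80).
have by' : bdd y by apply: bdd_cmean => n z; auto.
apply: le_trans (av_exp2 d M0 by') _; apply: le_av => n _.
pose m : mean R (nat * seq nat) := bind_mean LIM (fun t => map_mean (pair t) (box_mean R (lens d t))).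
pose Z (q : nat * seq nat) h (u : S * int) :=
  a n (act (- p n) (act (sumn h)%:Z (act u.2 u.1))) * chi q.1 h q.2 u.
pose V (q : nat * seq nat) h (u : S * int) := W q.2 h (act u.2 u.1).
have Z1 q h u : le1 (Z q h u) by rewrite /Z; auto.
have := @mean_box_cauchy_schwarz R _ _ m (fun q => orbit_mean S q.1) (fun q => lens d q.1) d Z V
  (fun q => size_nseq _ _) Z1 (fun q h u => W1 _ _ _)
  (fun q => partial_deps_comp _ (dW _)).
set lhs := m _; have -> : lhs = y n.
  rewrite /lhs /y; transitivity (cmean (smean T) (fun z => Z (z.1.1, z.1.2.1) z.1.2.2.1 z.2 * V (z.1.1, z.1.2.1) z.1.2.2.1 z.2)).
    apply: (@eq_mean _ _ LIM) => t; apply: (@eq_mean _ _ (box_mean R (lens d t))) => h'.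
    apply: (@eq_mean _ _ (box_mean R (lens d t))) => h.
    exact: (esym (mean_cst (box_mean R (lens d t)) (cmean (orbit_mean S t) (fun u => Z (t, h') h u * V (t, h') h u)))).
  by apply: eq_cmean => z; rewrite /Z /V /G mulrAC mulrA.
move=> h; apply: le_trans h _.
pose F (z : T) := cube z.1.2.2.1 z.1.2.2.2 (fun l => Z (z.1.1, z.1.2.1) l z.2).
have F1 z : le1 (F z) by rewrite /F; auto.
have := cmean_act (p n) F1 => hF.
apply: (@le_trans _ _ (cmean (smean T) F)); first exact: lexx.
rewrite -hF le_eqVlt; apply/orP; left; apply/eqP; apply: eq_cmean => z.
rewrite [_ * L z ^ _]mulrC -vertex_chi_act /F /Z cubeM; congr (_ * _).
apply: eq_cube => l; congr (a n _).
case: z => w [u i]; rewrite /lift_map /= -!actD; congr (act _ _); ring.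
Qed.

End Correlation.

(** * Lowering the dimension of the structure *)

Section Descent.
Variable R : realType.
Local Notation C := R[i].
Variables (S : system R) (f : ball R S) (d : nat) (c : R).
Hypothesis c0 : 0 < c.
Hypothesis f_structured : forall H, (0 < H)%N -> c <= Box (nseq d.+2 H) f.
Local Notation E := (cmean (smean S)).
Local Notation T := (lift_system S d).
Local Notation chi := (chi f c).
Local Notation freq := (freq f).
Local Notation X := (@vertex_chi R S f d c).
Local Notation L := (@vertex_freq R S f d).
Hint Resolve len_gt0 len2_gt0 le1_chi le1_vertex_chi unimod_vertex_freq : core.

Lemma first_vertices_chi : exists V : seq nat -> seq nat -> nat * (seq nat * (S * int)) -> C,
  [/\ forall k, partial_deps d (V k), (forall k h p, le1 (V k h p)) &
    forall k h t h' u, size k = d -> size h = d ->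
      cube h k (fun l => chi t l h' u) = chi t h h' u * V k h (t, (h', u))].
Proof.
have h1 h (p : nat * (seq nat * (S * int))) : le1 (chi p.1 h p.2.1 p.2.2) by auto.
have [V [dV V1 hV]] := @cube_first_vertices R _ d _ h1.
by exists V; split=> // k h t h' u sk sh; apply: (hV k h (t, (h', u))).
Qed.

Lemma normc_vertex_chi (w : index) y i : normc (X (w, (y, i))) = normc (X (w, (y, 0))).
Proof.
have -> : (w, (y, i)) = act i ((w, (y, 0)) : T) by rewrite /= add0r.
by rewrite vertex_chi_act normcM (unimodXz _ (unimod_vertex_freq _ _)) mul1r.
Qed.

(** Unless the product vanishes both factors have modulus one, and the conjugate of
    the second one removes it. *)
Lemma mul_norm01 (z v : C) : le1 z -> le1 v -> normc (z * v) = 0 \/ normc (z * v) = 1 ->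
  (normc (z * v))%:C * z = z * v * v^J.
Proof.
move=> z1 v1; case=> h; rewrite h.
  by move/eqP: h; rewrite normc_eq0 => /eqP ->; rewrite !mul0r.
have hv : normc v = 1.
  move: h z1 v1; rewrite normcM /le1; have := normc_ge0 z; have := normc_ge0 v.
  by move: (normc v) (normc z) => a b; nra.
by rewrite mul1r -mulrA mulcJ1 // mulr1.
Qed.

Lemma good_gain (xi r : R) (g : bool) : 0 <= xi -> c / 4 <= r \/ g = false ->
  (g = false -> xi = 0) -> c / 4 * xi <= xi * (r * g%:R).
Proof.
move=> x0; case: g => [[h|//] _|_ ->] //; last by rewrite !mul0r mulr0.
by rewrite mulr1 [leRHS]mulrC ler_wpM2r.
Qed.

Lemma local_correlation (B q : nat) :
  c / 4 * smean T (fun z => normc (X z) * (close B (L z ^+ q))%:R) <=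
  cmean (smean T) (fun z => (close B (L z ^+ q))%:R * ((normc (X z))%:C *
    (dcube z.1.2.2.1 z.1.2.1 f (lift_map z) * chi z.1.1 z.1.2.2.1 z.1.2.1 z.2))).
Proof.
have [V [dV V1 hV]] := first_vertices_chi.
have X1 z : le1 ((normc (X z))%:C : C).
  by rewrite /le1 normc_real ger0_norm ?normc_ge0 //; apply: le1_vertex_chi.
have b1 (b : bool) : le1 (b%:R : C) by case: b; auto.
rewrite -meanZ; last bd.
pose F1 (z : T) : R := c / 4 * (normc (X z) * (close B (L z ^+ q))%:R).
pose F2 (z : T) : R := Re ((close B (L z ^+ q))%:R * ((normc (X z))%:C *
    (dcube z.1.2.2.1 z.1.2.1 f (lift_map z) * chi z.1.1 z.1.2.2.1 z.1.2.1 z.2))).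
apply: (@le_index _ d (fun w => orbit_mean S w.1 (fun u => F1 (w, u)))
                 (fun w => orbit_mean S w.1 (fun u => F2 (w, u)))).
- exists `|c / 4| => w; apply: mean_norm => u; rewrite normrM ler_piMr //.
  rewrite ger0_norm ?mulr_ge0 ?normc_ge0 // -[leRHS]mulr1.
  by apply: ler_pM; rewrite ?normc_ge0 ?lern1 ?leq_b1 //; apply: le1_vertex_chi.
- exists 1 => w; apply: mean_norm => u; apply: le_trans (absRe_le _) _.
  by apply: (_ : le1 _); auto 8.
move=> t h' h k s1 s2 s3; rewrite !orbit_meanE /F1 /F2.
pose w : index := (t, (h', (h, k))); pose xi y := normc (X (w, (y, 0))).
pose cl y := (close B (L (w, (y, 0)) ^+ q))%:R : R.
apply: (@le_trans _ _ (smean S (fun y => cl y * (c / 4 * xi y)))).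
  rewrite le_eqVlt; apply/orP; left; apply/eqP; apply: eq_mean => y.
  rewrite -[RHS](av_const _ (len2_gt0 t)); apply: eq_av => i _ /=.
  by rewrite normc_vertex_chi -/(xi y) [xi y * _]mulrC mulrCA.
apply: (@le_trans _ _ (smean S (fun y => cl y * (xi y * (normc (cor f t h h' y) * (good f c t h h' y)%:R))))).
  apply: le_mean => [||y].
  - by rewrite /xi /cl; bd.
  - by rewrite /xi /cl; apply: bddM; [bd|apply: bddM; [bd|apply: bddM; [apply: bdd_normc => y; apply: le1_cor|bd]]].
  rewrite ler_wpM2l ?ler0n //; apply: good_gain => [||g0]; first exact: normc_ge0.
    by rewrite /good; case: (boolP (_ <= _)) => _; [left|right].
  have gz : normc (chi t h h' (y, 0)) = (good f c t h h' y)%:R by apply: normc_chi.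
  by rewrite /xi /vertex_chi hV // normcM gz g0 mul0r.
rewrite le_eqVlt; apply/orP; left; apply/eqP; apply: eq_mean => y.
rewrite -orbit_chi // -!avZ; apply: eq_av => i _.
have -> : (close B (L (t, (h', (h, k)), (y, i%:Z)) ^+ q))%:R = (cl y)%:C.
  by rewrite /cl; case: (close _ _).
by rewrite Re_scale normc_vertex_chi Re_scale.
Qed.

Lemma bool_le1 (b : bool) : le1 (b%:R : C). Proof. by case: b; auto. Qed.
Hint Resolve bool_le1 : core.

(** The correlation with the eigenfunction is localized where the [q]-th power of
    the eigenvalue is close to one; there the eigenfunction is almost invariant
    along progressions of step [q] and factors out of the averages over them. *)
Lemma averaged_correlation (B q : nat) (c3 : R) : (0 < q)%N -> 0 < c3 -> (0 < B)%N ->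
  (forall B', c3 <= smean T (fun z => normc (X z) * (close B' (L z ^+ q))%:R)) ->
  forall (G : T -> C), (forall z, le1 (G z)) ->
  (forall z : T, size z.1.2.1 = d -> size z.1.2.2.1 = d -> size z.1.2.2.2 = d ->
    (normc (X z))%:C * (dcube z.1.2.2.1 z.1.2.1 f (lift_map z) * chi z.1.1 z.1.2.2.1 z.1.2.1 z.2)
    = X z * G z) ->
  exists2 g : T -> C, (forall z, le1 (g z)) &
  c / 4 * c3 / 2 <= av B (fun b => cmean (smean T) (fun z => g z * G (act (q * b)%N%:Z z))).
Proof.
move=> q0 c30 B0 hX G G1 hG; pose c7 := c / 4 * c3.
have c70 : 0 < c7 by rewrite mulr_gt0 ?divr_gt0.
have [B' [B'0 hB']] := archi_lt (divr_ge0 (mulr_ge0 (ler0n R 2) (ler0n R B)) (ltW c70)).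
pose cl (z : T) := close B' (L z ^+ q).
pose g (z : T) := (cl z)%:R * X z.
have g1 z : le1 (g z) by rewrite /g; auto.
exists g => //.
have h1 : c7 <= cmean (smean T) (fun z => g z * G z).
  apply: le_trans (_ : _ <= cmean (smean T) (fun z => (cl z)%:R * ((normc (X z))%:C *
    (dcube z.1.2.2.1 z.1.2.1 f (lift_map z) * chi z.1.1 z.1.2.2.1 z.1.2.1 z.2)))) _.
    apply: le_trans (local_correlation B' q).
    by rewrite ler_wpM2l ?divr_ge0 ?(ltW c0).
  rewrite le_eqVlt; apply/orP; left; apply/eqP; apply: eq_lift => t h' h k u s1 s2 s3.
  by rewrite hG // /g mulrA.
apply: le_av_const => // b bB.
rewrite -(cmean_act (q * b)%N%:Z) in h1; last by move=> z; auto.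
have : c7 <= cmean (smean T) (fun z => g z * G (act (q * b)%N%:Z z)) + B%:R / B'%:R.
  apply: le_trans h1 _.
  apply: le_trans (cmean_lipschitz (smean T) (G := fun z => g z * G (act (q * b)%N%:Z z)) _ _) _.
  - by move=> z; auto.
  - by move=> z; auto.
  rewrite lerD2l; apply: mean_le => [|z]; first by bd.
  rewrite /g vertex_chi_act -/(cl z) -mulrBl normcM; set x := normc (G _).
  have x1 : x <= 1 by apply: G1.
  have x0 : 0 <= x by exact: normc_ge0.
  apply: (@le_trans _ _ (normc ((cl z)%:R * (L z ^ (q * b)%N * X z) - (cl z)%:R * X z) * 1)).
    by rewrite ler_wpM2l ?normc_ge0.
  rewrite mulr1 -mulrBr; rewrite /cl; case: (boolP (close _ _)) => [hcl|_]; last first.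
    by rewrite mul0r normc0 divr_ge0.
  rewrite mul1r -{2}[X z]mul1r -mulrBl normcM.
  apply: (@le_trans _ _ (normc (L z ^ (q * b)%N - 1) * 1)).
    by rewrite ler_wpM2l ?normc_ge0 //; apply: le1_vertex_chi.
  rewrite mulr1 -exprnP exprM; apply: le_trans (dist1_X _ _) _.
    by apply: unimodX; apply: unimod_vertex_freq.
  rewrite ler_pdivlMr ?ltr0n // -mulrA; apply: (@le_trans _ _ (b%:R * 1)).
    by rewrite ler_wpM2l.
  by rewrite mulr1 ler_nat ltnW.
have : B%:R / B'%:R <= c7 / 2.
  rewrite ler_pdivrMr ?ltr0n //; move: hB'; rewrite ltr_pdivrMr // => /ltW; lra.
by rewrite -/c7; lra.
Qed.

(** Once the eigenfunction is averaged out, squaring and the Cauchy--Schwarz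
    inequality over the cube parameters leave a box norm of [f] in dimension
    [d + 1], one coordinate of which runs through a progression of step [q]; this
    is compared with a genuine box norm by [Box_step]. *)
Theorem lift_descends (q : nat) (c3 : R) : (0 < d)%N -> (0 < q)%N -> 0 < c3 ->
  (forall B, c3 <= smean T (fun z => normc (X z) * (close B (L z ^+ q))%:R)) ->
  structured d.+1 f.
Proof.
move=> d0 q0 c30 hX.
have [V [dV V1 hV]] := first_vertices_chi.
have [W [dW W1 hW]] := first_vertices_f f d.
pose Y (w : nat * (seq nat * seq nat)) h (u : S * int) := V w.2.2 h (w.1, (w.2.1, u)).
pose G (z : T) := f (act (sumn z.1.2.2.1)%:Z (lift_map z)) *
   ((Y (z.1.1, (z.1.2.1, z.1.2.2.2)) z.1.2.2.1 z.2)^J * W z.1.2.1 z.1.2.2.1 (lift_map z)).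
have Y1 w h u : le1 (Y w h u) by rewrite /Y; auto.
have G1 z : le1 (G z) by rewrite /G; auto.
have hG (z : T) : size z.1.2.1 = d -> size z.1.2.2.1 = d -> size z.1.2.2.2 = d ->
    (normc (X z))%:C * (dcube z.1.2.2.1 z.1.2.1 f (lift_map z) * chi z.1.1 z.1.2.2.1 z.1.2.1 z.2)
    = X z * G z.
  move=> s1 s2 s3; rewrite hW //.
  have XE : X z = chi z.1.1 z.1.2.2.1 z.1.2.1 z.2 * Y (z.1.1, (z.1.2.1, z.1.2.2.2)) z.1.2.2.1 z.2.
    exact: hV.
  have X01 : normc (X z) = 0 \/ normc (X z) = 1.
    by apply: cube_norm01 => l; rewrite normc_chi //; case: good; [right|left].
  rewrite XE in X01 *.
  rewrite [_ * chi _ _ _ _]mulrC mulrA (mul_norm01 _ _ X01); [|by auto|by auto].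
  by rewrite /G; set v := (Y _ _ _)^J; set w := W _ _ _; ring.
exists ((c / 4 * c3 / 2) ^+ (2 * 2 ^ d) / q%:R ^+ 2).
  by rewrite divr_gt0 ?exprn_gt0 ?ltr0n // !divr_gt0 // mulr_gt0 ?divr_gt0.
move=> B B0; have [g g1 hg] := averaged_correlation q0 c30 B0 hX G1 hG.
have c70 : 0 <= c / 4 * c3 / 2 by apply: ltW; rewrite divr_gt0 // mulr_gt0 ?divr_gt0.
pose Gb b (z : T) := G (act (q * b)%N%:Z z).
pose y b b' := cmean (smean T) (fun z => Gb b z * (Gb b' z)^J).
have y1 b b' : `|y b b'| <= 1 by apply: cmean_norm => z; rewrite /Gb; auto.
have h1 : (c / 4 * c3 / 2) ^+ 2 <= av B (fun b => av B (y b)).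
  apply: le_trans (@cauchy_schwarz_av R T (smean T) B g Gb g1 _); last by move=> b z; apply: G1.
  by rewrite lerXn2r ?nnegrE // (le_trans c70).
pose F b b' x := f (act (q%:Z * b%:Z) x) * (f (act (q%:Z * b'%:Z) x))^J.
have F1 b b' x : le1 (F b b' x) by rewrite /F; auto.
have hy b b' : y b b' ^+ (2 ^ d) <= LIM (fun t => Box (lens d t) (F b b')).
  pose m : mean R (nat * (seq nat * seq nat)) := bind_mean LIM (fun t =>
    bind_mean (box_mean R (lens d t)) (fun h' => map_mean (fun k => (t, (h', k))) (box_mean R (lens d t)))).
  pose Z (w : nat * (seq nat * seq nat)) h (u : S * int) := F b b' (act (sumn h)%:Z (act u.2 u.1)).
  pose D1 bb w h (u : S * int) :=
    (Y w h (u.1, u.2 + (q * bb)%N%:Z))^J * W w.2.1 h (act (u.2 + (q * bb)%N%:Z) u.1).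
  pose D w h u := D1 b w h u * (D1 b' w h u)^J.
  have Z1 w h u : le1 (Z w h u) by rewrite /Z; auto.
  have D11 bb w h u : le1 (D1 bb w h u) by rewrite /D1; auto.
  have dD1 bb w : partial_deps d (D1 bb w).
    apply: partial_depsM.
      by apply/partial_depsJ/(partial_deps_comp (fun u : S * int => (w.1, (w.2.1, (u.1, u.2 + (q * bb)%N%:Z)))) (dV w.2.2)).
    exact: (partial_deps_comp (fun u : S * int => act (u.2 + (q * bb)%N%:Z) u.1) (dW w.2.1)).
  have := @mean_box_cauchy_schwarz R _ _ m (fun w => orbit_mean S w.1) (fun w => lens d w.1) d Z D
    (fun w => size_nseq _ _) Z1 (fun w h u => le1M (D11 b w h u) (le1J (D11 b' w h u)))
    (fun w => partial_depsM (dD1 b w) (partial_depsJ (dD1 b' w))).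
  pose o t h' k h := cmean (orbit_mean S t) (fun u => Z (t, (h', k)) h u * D (t, (h', k)) h u).
  have o1 t h' k h : `|o t h' k h| <= 1 by apply: cmean_norm => u; rewrite /D; auto.
  set lhs := m _; have -> : lhs = y b b'.
    transitivity (LIM (fun t => box_mean R (lens d t) (fun h' => box_mean R (lens d t) (fun h =>
        box_mean R (lens d t) (fun k => o t h' k h))))).
      apply: (@eq_mean _ _ LIM) => t; apply: (@eq_mean _ _ (box_mean R (lens d t))) => h'.
      exact: (@box_exchange R (lens d t) (lens d t) (fun k h => o t h' k h) 1 (o1 t h')).
    apply: (@eq_cmean _ _ (smean T) (fun z => Z (z.1.1, (z.1.2.1, z.1.2.2.2)) z.1.2.2.1 z.2 *
       D (z.1.1, (z.1.2.1, z.1.2.2.2)) z.1.2.2.1 z.2)) => z.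
    case: z => -[t [h' [h k]]] [x i]; rewrite /Z /D /D1 /F /Gb /G /lift_map /= -!actD.
    rewrite -!PoszM ![(_ + i)%R]addrC ![(i + _)%R]addrC.
    rewrite -!addrA ![(sumn h)%:Z + (_ + i)]addrCA [(f _ * (_ * _))^J]rmorphM.
    exact: mulrACA.
  move=> h; apply: le_trans h _; rewrite le_eqVlt; apply/orP; left; apply/eqP.
  apply: (@eq_mean _ _ LIM) => t.
  transitivity (box_mean R (lens d t) (fun h => box_mean R (lens d t) (fun k =>
       Box [::] (dcube h k (F b b'))))); last first.
    by rewrite -[in RHS](cats0 (lens d t)); apply/esym; apply: Box_cat.
  have E1 h k : cmean (orbit_mean S t) (fun u => cube h k (fun l => F b b' (act (sumn l)%:Z (act u.2 u.1)))) =
      Box [::] (dcube h k (F b b')).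
    apply: (@orbit_mean_map R S t (fun x => Re (dcube h k (F b b') x))).
    by apply: bdd_Re => x; auto.
  rewrite -[RHS](mean_cst (box_mean R (lens d t))); apply: (@eq_mean _ _ (box_mean R (lens d t))) => h'.
  rewrite -[RHS](mean_cst (box_mean R (lens d t))); apply: (@eq_mean _ _ (box_mean R (lens d t))) => k'.
  apply: (@eq_mean _ _ (box_mean R (lens d t))) => h; apply: (@eq_mean _ _ (box_mean R (lens d t))) => k.
  exact: E1.
have bB t : bdd (fun b => av B (fun b' => Box (lens d t) (F b b'))).
  by apply: bdd_av => b'; exists 1 => b; apply: Box_norm.
rewrite ler_pdivrMr ?exprn_gt0 ?ltr0n //.
rewrite exprM; apply: (@le_trans _ _ (av B (fun b => av B (y b)) ^+ (2 ^ d))).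
  by rewrite lerXn2r ?nnegrE ?exprn_ge0 // (le_trans _ h1) ?exprn_ge0.
apply: (@le_trans _ _ (av B (fun b => av B (fun b' => y b b' ^+ (2 ^ d))))).
  have by1 b : bdd (y b) by exists 1.
  have by2 : bdd (fun b => av B (y b)).
    by exists 1 => b; apply: le_trans (av_norm _ _) _; apply: av_le.
  apply: le_trans (av_exp2 d B0 by2) _; apply: le_av => b _; exact: av_exp2.
apply: (@le_trans _ _ (LIM (fun t => av B (fun b => av B (fun b' => Box (lens d t) (F b b')))))).
  rewrite mean_av => [|b]; last by apply: bdd_av => b'; exists 1 => t; apply: Box_norm.
  apply: le_av => b _; rewrite mean_av => [|b']; last by exists 1 => t; apply: Box_norm.
  by apply: le_av => b' _; apply: hy.
apply: (LIM_le (N := B)) => [|t tB].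
  by apply: bdd_av => b; apply: bdd_av => b'; exists 1 => t; apply: Box_norm.
case: d d0 => // d' _.
have := @Box_step R S q%:Z B (len t) (nseq d' (len t)) f _ B0 (ballP f).
move=> h; apply: le_trans (h _) _; first by rewrite eqz_nat -lt0n.
rewrite mulrC ler_wpM2r ?exprn_ge0 //.
apply: Box_mono => //=; [exact: ballP|by rewrite !size_nseq| |].
  by rewrite muln_gt0 q0 B0 len_gt0 all_nseq len_gt0 orbT.
rewrite dvdn_mull //=; have BD : (B %| len t)%N by rewrite /len dvdn_fact // B0 ltnW.
by rewrite BD; elim: d' {h} => //= d' ->; rewrite BD.
Qed.

End Descent.

(** * Replacing functions by eigenfunctions *)

Lemma indep_sub (ps ps' : seq {poly int}) : indep ps -> uniq ps' -> {subset ps' <= ps} -> indep ps'.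
Proof.
move=> [ups hps] ups' sub; split=> // c hc p pps.
pose c2 p := if p \in ps' then c p else 0.
have := hps c2; rewrite /c2.
have -> : \sum_(p <- ps) (if p \in ps' then c p else 0) *: p = \sum_(p <- ps') c p *: p.
  rewrite (eq_bigr (fun p => if p \in ps' then c p *: p else 0)) => [|r _]; last first.
    by case: ifP => // _; rewrite scale0r.
  rewrite -big_mkcond -big_filter; apply: perm_big; apply: uniq_perm => //.
    exact: filter_uniq.
  by move=> r; rewrite mem_filter andb_idr // => /sub.
by move=> /(_ hc p (sub p pps)); rewrite pps.
Qed.

Lemma indep_neq0 (ps : seq {poly int}) p : indep ps -> p \in ps -> p != 0.
Proof.
move=> [ups hps] pps; apply/eqP => p0.
have := hps (fun r => (r == 0)%:R) _ p pps; rewrite p0 eqxx => h.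
suff /h : \sum_(r <- ps) (r == 0)%:R *: r = 0 :> {poly int} by [].
by apply: big1 => r _; case: eqP => [->|_]; rewrite ?scaler0 ?scale0r.
Qed.

Section Eigenfunctions.
Variable R : realType.
Local Notation C := R[i].

Definition phases (S : system R) (lam : {poly int} -> S -> C) :=
  (forall p, invariant (lam p)) /\ forall p x, unimod (lam p x).

Definition corr (S : system R) (f0 : S -> C) (fs : seq ({poly int} * ball R S)) ls
    (lam : {poly int} -> S -> C) n x : C :=
  f0 x * (prodF fs n x * phase ls id (lam^~ x) n).

Lemma unimod_phase (ls : seq {poly int}) (l : {poly int} -> C) n :
  (forall p, unimod (l p)) -> unimod (phase ls id l n).
Proof. by move=> h; apply: unimod_prod => p _; apply: unimodXz. Qed.

Lemma le1_corr (S : system R) (f0 : S -> C) fs ls (lam : {poly int} -> S -> C) n x :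
  (forall x, le1 (f0 x)) -> (forall p x, unimod (lam p x)) -> le1 (corr f0 fs ls lam n x).
Proof.
move=> h0 hl; apply: le1M => //; apply: le1M; first exact: le1_prodF.
by apply/unimod_le1/unimod_phase.
Qed.

Lemma invariant_phase (S : system R) ls (lam : {poly int} -> S -> C) n :
  phases lam -> invariant (fun x => phase ls id (lam^~ x) n).
Proof. by move=> [h _] a x; apply: eq_bigr => p _; rewrite h. Qed.

Definition pull (T S : system R) (r : T -> S) (fs : seq ({poly int} * ball R S)) :=
  [seq (a.1, ball_comp r a.2) | a <- fs].

Lemma pull_fst (T S : system R) (r : T -> S) fs : map fst (pull r fs) = map fst fs.
Proof. by rewrite /pull -map_comp; apply: eq_map. Qed.

Lemma prodF_pull (T S : system R) (r : T -> S) fs n z : factor r ->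
  prodF (pull r fs) n z = prodF fs n (r z).
Proof. by move=> [ra _]; rewrite /prodF big_map; apply: eq_bigr => a _ /=; rewrite ra. Qed.

Definition extend (T S : system R) (r : T -> S) p (l : T -> C) (lam : {poly int} -> S -> C) :
  {poly int} -> T -> C := fun p' => if p' == p then l else fun z => lam p' (r z).

Lemma phases_extend (T S : system R) (r : T -> S) p (l : T -> C) lam : factor r ->
  invariant l -> (forall z, unimod (l z)) -> phases lam -> phases (extend r p l lam).
Proof.
move=> [ra _] il ul [ilam ulam]; split=> p'; rewrite /extend; case: eqP => // _ a z.
by rewrite ra ilam.
Qed.

Lemma phase_extend (T S : system R) (r : T -> S) p (l : T -> C) lam ls n z : p \notin ls ->
  phase (p :: ls) id ((extend r p l lam)^~ z) n = l z ^ p.[n%:Z] * phase ls id (lam^~ (r z)) n.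
Proof.
move=> pls; rewrite /phase big_cons /extend eqxx; congr (_ * _).
by apply: eq_big_seq => p' hp'; case: eqP => // e; rewrite -e hp' in pls.
Qed.

(** The induction on the number of functions: correlations along independent
    polynomials survive only where all the eigenvalues are almost rational. *)
Definition rational_eigenvalues (l : nat) :=
  forall (S : system R) (f0 : ball R S) fs ls lam,
    size fs = l -> phases lam -> indep (map fst fs ++ ls) ->
    (forall p, p \in map fst fs ++ ls -> p.[0] = 0) ->
    positive (fun n => cmean (smean S) (corr f0 fs ls lam n)) ->
  exists q, exists2 c : R, (0 < q)%N /\ 0 < c & forall B,
    c <= smean S (fun x => normc (f0 x) * (all (fun p => close B (lam p x ^+ q)) ls)%:R).

Lemma rational_eigenvalues0 : rational_eigenvalues 0.
Proof.
move=> S f0 [] // ls lam _ [ilam ulam] hi h0 [e e0 he].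
have [q [c [q0 c0] hq]] := weyl_family hi h0 e0.
exists q, c => // B; apply: hq => // k; have [M kM eM] := he k; exists M => //.
apply: le_trans eM _; rewrite le_eqVlt; apply/orP; left; apply/eqP.
apply: eq_av => n _; apply: eq_cmean => x.
by rewrite /corr /prodF big_nil mul1r.
Qed.

Section Lifting.
Variables (S : system R) (f : ball R S) (d : nat) (c : R).
Hypothesis c0 : 0 < c.
Local Notation T := (lift_system S d).
Local Notation X := (@vertex_chi R S f d c).
Local Notation L := (@vertex_freq R S f d).
Variables (f0 : ball R S) (fs : seq ({poly int} * ball R S)) (ls : seq {poly int}).
Variables (lam : {poly int} -> S -> C) (p : {poly int}).
Hypothesis hlam : phases lam.
Hypothesis pls : p \notin ls.

Definition dball (g : ball R S) : ball R T.
Proof.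
by exists (fun z : T => dcube z.1.2.2.1 z.1.2.2.2 g (lift_map z)) => z; auto.
Defined.

Definition chi_ball : ball R T.
Proof. by exists X => z; apply: le1_vertex_chi. Defined.

(** In positive dimension the phases, being invariant, cancel over each cube. *)
Lemma lift_corr n : (0 < d)%N ->
  cmean (smean T) (fun z => dcube z.1.2.2.1 z.1.2.2.2 (corr f0 fs ls lam n) (lift_map z) *
    (X z * L z ^ p.[n%:Z])) =
  cmean (smean T) (corr (ballM (dball f0) chi_ball) [seq (a.1, dball a.2) | a <- fs] [:: p]
    (extend (@lift_map R S d) p L lam) n).
Proof.
move=> d0; apply: eq_lift => t h' h k u s1 s2 s3; congr Re.
rewrite /corr phase_extend // [phase [::] _ _ _]big_nil mulr1 !dcubeM.
set z : T := (_, u).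
have -> : dcube h k (fun x => phase ls id (lam^~ x) n) (lift_map z) = 1.
  rewrite /dcube (@eq_cube _ _ _ _ (fun=> phase ls id (lam^~ (lift_map z)) n)) => [|l]; last first.
    exact: invariant_phase.
  apply: cube_cst; rewrite ?s2 ?s3 //; apply: unimod_phase => p'; exact: (proj2 hlam).
have -> : dcube h k (prodF fs n) (lift_map z) = prodF [seq (a.1, dball a.2) | a <- fs] n z.
  rewrite /prodF big_map /dcube cube_prod; apply: eq_bigr => a _.
  transitivity (dcube h k a.2 (lift_map (act a.1.[n%:Z] z))); last by [].
  by rewrite (proj1 (lift_factor S d)) /dcube; apply: eq_cube => l; rewrite actC.
by rewrite mulr1 /=; ring.
Qed.

End Lifting.

Lemma lift_corr0 (S : system R) (f : ball R S) (c : R) (c0 : 0 < c) (f0 : ball R S) fs (ls : seq {poly int}) lam (p : {poly int}) n :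
  phases lam -> p \notin ls ->
  cmean (smean (lift_system S 0)) (fun z => dcube z.1.2.2.1 z.1.2.2.2 (corr f0 fs ls lam n) (lift_map z) *
    (vertex_chi f c z * vertex_freq f z ^ p.[n%:Z])) =
  cmean (smean (lift_system S 0)) (corr (ballM (ball_comp (@lift_map R S 0) f0) (chi_ball f 0 c0))
    (pull (@lift_map R S 0) fs) (p :: ls)
    (extend (@lift_map R S 0) p (@vertex_freq R S f 0) lam) n).
Proof.
move=> hlam pls; apply: eq_lift => t h' h k u s1 s2 s3; congr Re.
rewrite /corr phase_extend // prodF_pull; last exact: lift_factor.
have [-> ->] : h = [::] /\ k = [::] by case: h k s2 s3 => [|? ?] [|? ?].
rewrite {1}/dcube /= act0; ring.
Qed.

End Eigenfunctions.

Section Extension.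
Variable R : realType.
Local Notation C := R[i].

Lemma cmean_le (X : Type) (m : mean R X) (F G : X -> C) : (forall x, F x = G x) ->
  cmean m F <= cmean m G.
Proof. by move=> h; rewrite le_eqVlt (eq_cmean m h) eqxx. Qed.

Lemma limit_factor (S : system R) : @factor R (limit_system S) S fst.
Proof.
split=> // F hF; rewrite -[RHS](mean_cst LIM); exact: (@eq_mean _ _ LIM).
Qed.

(** A descent on the dimension of the structure: each step removes one dimension
    because the eigenvalues found there are almost rational, which is the case of
    fewer functions. *)
Lemma structured2 l (S : system R) (f f0 : ball R S) fs ls lam (p : {poly int}) d :
  rational_eigenvalues R l -> size fs = l -> phases lam ->
  indep (p :: map fst fs ++ ls) -> (forall r, r \in p :: map fst fs ++ ls -> r.[0] = 0) ->
  approximable f (fun M x => av M (fun n => corr f0 fs ls lam n (act (- p.[n%:Z]) x))) ->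
  structured d.+2 f -> structured 2 f.
Proof.
move=> hS sfs hlam hi h0 happ; elim: d => [|d IH] // [c c0 hc].
apply: IH; have corr1 n x : le1 (corr f0 fs ls lam n x).
  by apply: le1_corr => [x'|]; [auto|exact: (proj2 hlam)].
have [e e0 he] := @lift_correlates R S f d.+1 c c0 hc (corr f0 fs ls lam) (fun n => p.[n%:Z]) corr1 happ.
have pls : p \notin ls.
  by case: hi => /= /andP[]; rewrite mem_cat negb_or => /andP[].
have hi' : indep (map fst [seq (a.1, dball d.+1 a.2) | a <- fs] ++ [:: p]).
  have -> : map fst [seq (a.1, dball d.+1 a.2) | a <- fs] = map fst fs.
    by rewrite -map_comp; apply: eq_map.
  apply: (indep_sub hi) => [|r].
    by case: hi => /=; rewrite cats1 rcons_uniq cat_uniq mem_cat negb_or -andbA => /and3P[-> _ /andP[->]].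
  by rewrite cats1 mem_rcons !inE mem_cat => /orP[->|->] //; rewrite orbT.
have [||r hr||q [c3 [q0 c30] hq]] := hS (lift_system S d.+1) (ballM (dball d.+1 f0) (chi_ball f d.+1 c0)) _ _
   (extend (@lift_map R S d.+1) p (@vertex_freq R S f d.+1) lam) _ _ hi'.
- by rewrite size_map.
- apply: phases_extend => //; [exact: lift_factor|exact: unimod_vertex_freq].
- apply: h0; move: hr; rewrite -map_comp (eq_map (g := fst)) // cats1 mem_rcons !inE mem_cat.
  by case/orP => [->|->] //; rewrite orbT.
- exists e; first exact: e0.
  move=> k; have [M kM eM] := he k; exists M; first exact: kM.
  apply: le_trans eM _.
  rewrite le_eqVlt; apply/orP; left; apply/eqP; apply: eq_av => n _.
  exact: lift_corr.
apply: (@lift_descends R S f d.+1 c c0 q c3) => // B.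
apply: le_trans (hq B) _; apply: le_mean => [||z].
- by bd.
- by apply: bddM; [apply: bdd_normc => z; apply: le1_vertex_chi|bd].
have -> : all (fun p' => close B (extend (@lift_map R S d.+1) p (vertex_freq f (d := d.+1)) lam p' z ^+ q)) [:: p]
  = close B (vertex_freq f z ^+ q) by rewrite /= /extend eqxx andbT.
rewrite ler_wpM2r ?ler0n // -[leRHS]mul1r normcM ler_wpM2r ?normc_ge0 //.
exact: (ballP (dball d.+1 f0)).
Qed.

(** The dual function given by [dual_limit] has structure by [pet], in dimension two
    by [structured2]; the characters of the corresponding lift then replace it. *)
Theorem eigen_extension l (S : system R) (f f0 : ball R S) fs ls lam (p : {poly int}) :
  rational_eigenvalues R l -> size fs = l -> phases lam ->
  indep (p :: map fst fs ++ ls) -> (forall r, r \in p :: map fst fs ++ ls -> r.[0] = 0) ->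
  positive (fun n => cmean (smean S) (corr f0 ((p, f) :: fs) ls lam n)) ->
  exists (T : system R) (r : T -> S) (lp : T -> C) (chi : ball R T),
  [/\ factor r, phases (extend r p lp lam), forall a z, chi (act a z) = lp z ^ a * chi z &
    positive (fun n => cmean (smean T) (corr (ballM (ball_comp r f0) chi) (pull r fs) (p :: ls)
      (extend r p lp lam) n))].
Proof.
move=> hS sfs hlam hi h0 [e e0 he].
have corr1 n x : le1 (corr f0 fs ls lam n x).
  by apply: le1_corr => [x'|]; [auto|exact: (proj2 hlam)].
pose v M x := av M (fun n => corr f0 fs ls lam n (act (- p.[n%:Z]) x)).
have v1 M x : le1 (v M x) by rewrite /v; auto.
have hv k : exists2 M, (k <= M)%N & e <= cmean (smean S) (fun x => v M x * f x).
  have [M kM eM] := he k; exists M => //; apply: le_trans eM _.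
  rewrite -[leRHS](_ : cmean (smean S) (fun x => av M (fun n => corr f0 fs ls lam n (act (- p.[n%:Z]) x) * f x)) = _).
    rewrite cmean_av => [|n x]; last by auto.
    rewrite le_eqVlt; apply/orP; left; apply/eqP; apply: eq_av => n _.
    rewrite -[RHS](cmean_act p.[n%:Z]) => [|x]; last by auto.
    apply: eq_cmean => x; rewrite -actD addNr act0 /corr prodF_cons /=.
    by rewrite -!mulrA; congr (_ * _); rewrite mulrC mulrA.
  by apply: eq_cmean => x; rewrite avZr.
have [f1 [happ [e1 e10 he1]]] := dual_limit v1 (ballP f) e0 hv.
pose S1 := limit_system S; pose r1 : S1 -> S := fst.
have fr1 : factor r1 by exact: limit_factor.
have hlam1 : phases (fun p => lam p \o r1).
  by case: hlam => il ul; split=> [p' a q|p' q]; [exact: il|exact: ul].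
have corrE n q : corr (ball_comp r1 f0) (pull r1 fs) ls (fun p => lam p \o r1) n q = corr f0 fs ls lam n (r1 q).
  by rewrite /corr prodF_pull.
have corr11 n q : le1 (corr (ball_comp r1 f0) (pull r1 fs) ls (fun p => lam p \o r1) n q) by rewrite corrE.
have happ1 : approximable f1 (fun M x => av M (fun n =>
    corr (ball_comp r1 f0) (pull r1 fs) ls (fun p => lam p \o r1) n (act (- p.[n%:Z]) x))).
  move=> P m r G c hm hG c0 hc k; have [M kM hM] := happ P m r G c hm hG c0 hc k.
  exists M => //; apply: le_trans hM _; apply: cmean_le => x; congr (_ * _).
  by apply: eq_av => n _; rewrite corrE.
have pls : p \notin ls /\ p \notin map fst fs.
  by case: hi => /= /andP[]; rewrite mem_cat negb_or => /andP[].
(* The dual function correlates with the averages defining it, so it has structure. *)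
have [d hd] : exists d, structured d.+2 f1.
  pose y n := cmean (smean S1) (fun q => corr (ball_comp r1 f0) (pull r1 fs) ls (fun p => lam p \o r1) n q
     * ballJ f1 (act p.[n%:Z] q)).
  have by1 : bdd y by apply: bdd_cmean => n q; auto.
  have fry : frequently (fun M => e1 <= av M y).
    move=> k; have [M kM hM] := he1 k; exists M => //; apply: le_trans hM _.
    rewrite -cmean_av => [|n q]; last by auto.
    rewrite -[leLHS](_ : cmean (smean S1) (fun q => av M (fun n => corr f0 fs ls lam n (act (- p.[n%:Z]) (r1 q)) * (f1 q)^J)) = _); last first.
      by apply: eq_cmean => q; rewrite avZr.
    rewrite !cmean_av => [|n q|n q]; [|by auto|by auto].
    rewrite le_eqVlt; apply/orP; left; apply/eqP; apply: eq_av => n _.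
    rewrite -[LHS](cmean_act p.[n%:Z]) => [|q]; last by auto.
    by apply: eq_cmean => q; rewrite corrE (proj1 fr1) -actD addNr act0.
  have [mm [mm_inv mme _]] := cesaro_mean by1 fry.
  have phi1 n q : le1 (phase ls id ((fun p => lam p \o r1)^~ q) n).
    by apply/unimod_le1/unimod_phase => p'; apply: (proj2 hlam).
  pose phi n : ball R S1 := Ball (phi1 n).
  have sz1 (u : {poly int}) : u.[0] = 0 -> u != 0 -> nonconst u.
    move=> u0; apply: contraNT; rewrite /nonconst -leqNgt => /size1_polyC uE.
    by move: u0; rewrite uE hornerC => ->.
  have in0 u : u \in p :: map fst fs ++ ls -> u != 0 by exact: indep_neq0.
  have : ctrl (ballJ f1).
    apply: (@pet R S1 mm mm_inv (pull r1 fs) p phi (ball_comp r1 f0)).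
    - by apply: sz1; rewrite ?h0 ?in0 ?inE ?eqxx.
    - move=> u; rewrite pull_fst => ufs; apply: sz1.
        by rewrite hornerD hornerN !h0 ?subrr // !inE ?eqxx // mem_cat ufs orbT.
      rewrite subr_eq0; apply: contraNneq (proj2 pls) => ->; exact: ufs.
    - move=> n a q; exact: invariant_phase.
    - apply: (lt_le_trans e10); apply: le_trans mme _; rewrite le_eqVlt; apply/orP; left; apply/eqP.
      by apply: eq_mean => n; apply: eq_cmean => q; rewrite /corr /=; ring.
  by move=> [d hd]; exists d; apply: structured_conj hd.
have hi1 : indep (p :: map fst (pull r1 fs) ++ ls) by rewrite pull_fst.
have h01 u : u \in p :: map fst (pull r1 fs) ++ ls -> u.[0] = 0 by rewrite pull_fst; apply: h0.
have sfs1 : size (pull r1 fs) = l by rewrite size_map.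
have [c c0 hc] := structured2 hS sfs1 hlam1 hi1 h01 happ1 hd.
have [e2 e20 he2] := @lift_correlates R S1 f1 0 c c0 hc _ (fun n => p.[n%:Z]) corr11 happ1.
pose T := lift_system S1 0; pose r2 : T -> S1 := @lift_map R S1 0.
have fr2 : factor r2 by exact: lift_factor.
exists T, (r1 \o r2), (@vertex_freq R S1 f1 0), (chi_ball f1 0 c0); split.
- exact: factor_comp.
- by apply: phases_extend => //; [exact: factor_comp|exact: unimod_vertex_freq].
- by move=> a z; apply: vertex_chi_act.
exists e2; first exact: e20.
move=> k; have [M kM hM] := he2 k; exists M; first exact: kM.
apply: le_trans hM _; rewrite le_eqVlt; apply/orP; left; apply/eqP; apply: eq_av => n _.
rewrite (lift_corr0 f1 c0); [|exact: hlam1|exact: (proj1 pls)].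
by apply: eq_cmean => z; rewrite /corr !prodF_pull //; exact: factor_comp.
Qed.

(** With fewer functions to go, a function is replaced by an eigenfunction whose
    eigenvalue joins the others. *)
Theorem rational_eigenvalues_all l : rational_eigenvalues R l.
Proof.
elim: l => [|l IH]; first exact: rational_eigenvalues0.
move=> S f0 [|[p f] fs] // ls lam [sfs] hlam hi h0 hpos.
have [T [r [lp [chi [fr hlam' hchi hpos']]]]] := eigen_extension IH sfs hlam hi h0 hpos.
have hi' : indep (map fst (pull r fs) ++ p :: ls).
  rewrite pull_fst; apply: (indep_sub hi) => [|u].
    by rewrite (perm_uniq (permEl (perm_catCA (map fst fs) [:: p] ls))); case: hi.
  by rewrite !inE !mem_cat !inE orbCA.
have h0' u : u \in map fst (pull r fs) ++ p :: ls -> u.[0] = 0.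
  by rewrite pull_fst => hu; apply: h0; move: hu; rewrite /= !inE !mem_cat !inE orbCA.
have [|q [c [q0 c0] hq]] := IH T _ _ _ _ _ hlam' hi' h0' hpos'; first by rewrite size_map.
exists q, c => // B; apply: le_trans (hq B) _.
rewrite -(proj2 fr); last by bd.
apply: le_mean => [||z]; [bd| |].
  by apply: (@bdd_comp _ _ _ r (fun x => normc (f0 x) * (all (fun p0 => close B (lam p0 x ^+ q)) ls)%:R)); bd.
have pls : p \notin ls by case: hi => /= /andP[]; rewrite mem_cat negb_or => /andP[].
have -> : all (fun p0 => close B (extend r p lp lam p0 z ^+ q)) (p :: ls) =
  close B (lp z ^+ q) && all (fun p0 => close B (lam p0 (r z) ^+ q)) ls.
  rewrite /= {1}/extend eqxx; congr (_ && _); apply: eq_in_all => u uls.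
  by rewrite /extend; case: eqP => // e; rewrite -e uls in pls.
rewrite /= normcM; apply: ler_pM; rewrite ?mulr_ge0 ?normc_ge0 //.
  by rewrite -[leRHS]mulr1 ler_wpM2l ?normc_ge0 //; apply: ballP.
by rewrite ler_nat; case: (close _ _).
Qed.

End Extension.

(** * Only almost periodic components matter *)

Lemma indep_opp (p : {poly int}) ps : indep (p :: ps) -> indep (- p :: ps).
Proof.
move=> hi; have [/= /andP[pps ups] hps] := hi; have p0 := indep_neq0 hi (mem_head p ps).
have Nps : - p \notin ps.
  apply/negP => h; have Np : - p != p.
    apply: contra p0 => /eqP h1; apply/eqP/polyP => i; rewrite coef0.
    have := congr1 (fun r : {poly int} => r`_i) h1; rewrite /= coefN; move: (p`_i) => a; lia.
  have : \sum_(r <- p :: ps) ((r == p) || (r == - p))%:R *: r = 0 :> {poly int}.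
    rewrite big_cons eqxx scale1r (big_rem (- p)) //= eqxx orbT scale1r.
    rewrite big1_seq ?addr0 ?subrr // => r; rewrite (mem_rem_uniq _ ups) inE => /andP[_ /andP[rNp rps]].
    rewrite (negbTE rNp) orbF; case: eqP => [e|]; last by rewrite scale0r.
    by rewrite -e rps in pps.
  by move/(hps (fun r => ((r == p) || (r == - p))%:R))/(_ p (mem_head _ _)); rewrite eqxx.
split=> [|c hc r]; first by rewrite /= Nps.
pose c' s := if s == p then - c (- p) else c s.
have hc' : \sum_(s <- p :: ps) c' s *: s = 0.
  have E : \sum_(s <- ps) c' s *: s = \sum_(s <- ps) c s *: s.
    by apply: eq_big_seq => s sps; rewrite /c'; case: eqP => // e; rewrite -e sps in pps.
  by move: hc; rewrite !big_cons E /c' eqxx scaleNr scalerN.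
rewrite inE => /orP[/eqP ->|rps].
  by have := hps c' hc' p (mem_head _ _); rewrite /c' eqxx => /eqP; rewrite oppr_eq0 => /eqP.
have := hps c' hc' r; rewrite inE rps orbT => /(_ isT); rewrite /c'; case: eqP => // e.
by rewrite -e rps in pps.
Qed.

Section Progression.
Variable R : realType.
Local Notation C := R[i].

(** Along progressions of step [q] the twist is almost constant when its [q]-th power
    is close to one. *)
Lemma av_twisted (lp : C) (G : nat -> C) B q B' : unimod lp -> (forall i, le1 (G i)) ->
  (0 < B)%N -> (0 < q)%N -> (0 < B')%N -> close B' (lp ^+ q) ->
  normc (av (B * q) (fun i => lp ^+ i * G i)) <=
  av q (fun a => normc (av B (fun b => G (b * q + a)%N))) + B%:R / B'%:R.
Proof.
move=> hl hG B0 q0 B'0 hcl; rewrite av_blocks // exchange_av.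
rewrite -[X in _ + X](av_const _ q0) -avD; apply: le_trans (normc_av _ _) _.
apply: le_av => a _.
rewrite [X in normc X <= _](eq_av (d := fun b => lp ^+ a * ((lp ^+ q) ^+ b * G (b * q + a)%N))) => [|b _]; last first.
  by rewrite /= exprD [lp ^+ (b * q)](_ : _ = (lp ^+ q) ^+ b) -?exprM 1?mulnC // mulrA [_ ^+ a * _]mulrC.
rewrite avZ normcM (unimodX a hl) mul1r.
have -> : av B (fun b => (lp ^+ q) ^+ b * G (b * q + a)%N) =
   av B (fun b => G (b * q + a)%N) + av B (fun b => ((lp ^+ q) ^+ b - 1) * G (b * q + a)%N).
  by rewrite -avD; apply: eq_av => b _; ring.
apply: le_trans (le_normcD _ _) _; rewrite lerD2l; apply: le_trans (normc_av _ _) _.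
apply: av_le => // b bB; rewrite normcM.
apply: (@le_trans _ _ (normc ((lp ^+ q) ^+ b - 1) * 1)).
  by rewrite ler_wpM2l ?normc_ge0 //; apply: hG.
rewrite mulr1; apply: le_trans (dist1_X _ _) _; first exact: unimodX.
rewrite ler_pdivlMr ?ltr0n // -mulrA; apply: (@le_trans _ _ (b%:R * 1)); first by rewrite ler_wpM2l.
by rewrite mulr1 ler_nat ltnW.
Qed.

(** With a single function the roles of the two functions are exchanged by
    translation, so that the other one becomes an eigenfunction. Averaging along a
    progression does not change the correlation with invariant phases; where the
    eigenvalues are almost rational, it cannot be small on a suitable progression. *)
Lemma progression_average1 (S : system R) (g g0 : ball R S) ls lam (p : {poly int}) :
  phases lam -> indep (p :: ls) -> (forall r, r \in p :: ls -> r.[0] = 0) ->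
  positive (fun n => cmean (smean S) (corr g0 [:: (p, g)] ls lam n)) ->
  exists q, exists2 c : R, (0 < q)%N /\ 0 < c & forall B, (0 < B)%N ->
    c <= smean S (fun x => normc (av B (fun b => g (act (b * q)%N%:Z x))) ^+ 2).
Proof.
move=> hlam hi h0 [e e0 he].
have hi' := indep_opp hi.
have h0' r : r \in - p :: ls -> r.[0] = 0.
  rewrite inE => /orP[/eqP ->|rls]; first by rewrite hornerN h0 ?oppr0 ?mem_head.
  by rewrite h0 // inE rls orbT.
have pos1 : positive (fun n => cmean (smean S) (corr g [:: (- p, g0)] ls lam n)).
  exists e => // k; have [M kM eM] := he k; exists M => //; apply: le_trans eM _.
  rewrite le_eqVlt; apply/orP; left; apply/eqP; apply: eq_av => n _.
  rewrite -[RHS](cmean_act p.[n%:Z]) => [|x]; last first.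
    by apply: le1_corr => [x'|]; [auto|exact: (proj2 hlam)].
  apply: eq_cmean => x; rewrite /corr !prodF_cons /= /prodF !big_nil !mulr1.
  rewrite (invariant_phase _ _ hlam) hornerN -actD addNr act0; ring.
have [T [r [lp [chi [fr [ilam ulam] hchi [e1 e10 he1]]]]]] :=
  eigen_extension (@rational_eigenvalues_all R 0) (erefl : size ([::] : seq ({poly int} * ball R S)) = 0%N) hlam hi' h0' pos1.
have [q [c [q0 c0] hq]] := weyl_family hi' h0' e10.
exists q, ((c / 2) ^+ 2); first by rewrite exprn_gt0 ?divr_gt0.
move=> B B0; have [B' [B'0 hB']] := archi_lt (divr_ge0 (mulr_ge0 (ler0n R 2) (ler0n R B)) (ltW c0)).
pose G := ballM (ball_comp r g) chi.
have GB1 z : le1 (av (B * q) (fun b => G (act b%:Z z))) by auto.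
pose GB : ball R T := Ball GB1.
have hu u z : unimod (extend r (- p) lp lam u z) by exact: ulam.
have hfr : frequently (fun M => e1 <= av M (fun n => cmean (smean T)
    (fun z => GB z * phase (- p :: ls) id ((extend r (- p) lp lam)^~ z) n))).
  move=> k; have [M kM hM] := he1 k; exists M => //; apply: le_trans hM _.
  rewrite le_eqVlt; apply/orP; left; apply/eqP; apply: eq_av => n _.
  have Bq0 : (0 < B * q)%N by rewrite muln_gt0 B0.
  rewrite (_ : cmean _ (fun x => GB x * _) = cmean (smean T) (fun x => av (B * q) (fun b =>
      corr G [::] (- p :: ls) (extend r (- p) lp lam) n (act b%:Z x)))).
    rewrite cmean_av => [|b z]; last by apply: le1_corr => // z'; auto.
    rewrite -[LHS](av_const _ Bq0); apply: eq_av => b _.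
    by rewrite cmean_act // => z; apply: le1_corr => // z'; auto.
  apply: eq_cmean => z; rewrite -avZr; apply: eq_av => b _.
  by rewrite /corr /prodF big_nil mul1r (invariant_phase _ _ (conj ilam ulam)).
have hc := hq T (smean T) GB _ hu hfr B'.
pose N := smean S (fun x => normc (av B (fun b => g (act (b * q)%N%:Z x)))).
have g1 a x : le1 (av B (fun b => g (act (b * q + a)%N%:Z x))) by auto.
have hN : c <= N + B%:R / B'%:R.
  apply: le_trans hc _.
  apply: (@le_trans _ _ (smean T (fun z => av q (fun a => normc (av B (fun b => g (act (b * q + a)%N%:Z (r z))))) + B%:R / B'%:R))).
    apply: le_mean => [||z]; [bd|bd|].
    case: (boolP (all _ _)) => [/= /andP[hcl _]|_]; last first.
      by rewrite mulr0; apply: addr_ge0; [apply: av_ge0 => a _; exact: normc_ge0|rewrite divr_ge0].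
    rewrite /extend eqxx in hcl; rewrite mulr1.
    have ul : unimod (lp z) by have := hu (- p) z; rewrite /extend eqxx.
    apply: le_trans (av_twisted (G := fun i => g (act i%:Z (r z))) ul _ B0 q0 B'0 hcl); last by move=> i; auto.
    rewrite /GB /= (eq_av (d := fun i => (lp z ^+ i * g (act i%:Z (r z))) * chi z)) => [|i _]; last first.
      by rewrite hchi (proj1 fr) -exprnP /=; ring.
    rewrite avZr normcM -[leRHS]mulr1 ler_wpM2l ?normc_ge0 //; exact: ballP.
  rewrite meanD; [|bd|bd]; rewrite mean_cst lerD2r mean_av => [|a]; last bd.
  apply: av_le => // a _.
  rewrite (proj2 fr (fun x => normc (av B (fun b => g (act (b * q + a)%N%:Z x))))); last bd.
  rewrite /N -[leRHS](smean_act a%:Z); last by bd.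
  rewrite le_eqVlt; apply/orP; left; apply/eqP; apply: eq_mean => x; congr normc.
  by apply: eq_av => b _; rewrite -actD.
have h2 : B%:R / B'%:R <= c / 2.
  rewrite ler_pdivrMr ?ltr0n //; move: hB'; rewrite ltr_pdivrMr // => /ltW; lra.
apply: (@le_trans _ _ (N ^+ 2)).
  rewrite lerXn2r ?nnegrE ?divr_ge0 ?(ltW c0) //; last lra.
  by rewrite /N; apply: mean_ge0 => [|x]; [bd|exact: normc_ge0].
by apply: mean_sqr; bd.
Qed.

(** The other functions become phases one after the other; the extensions needed do
    not change the averages of [g] along progressions. *)
Theorem progression_average l (S : system R) (g g0 : ball R S) fs ls lam (p : {poly int}) :
  size fs = l -> phases lam -> indep (p :: map fst fs ++ ls) ->
  (forall r, r \in p :: map fst fs ++ ls -> r.[0] = 0) ->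
  positive (fun n => cmean (smean S) (corr g0 ((p, g) :: fs) ls lam n)) ->
  exists q, exists2 c : R, (0 < q)%N /\ 0 < c & forall B, (0 < B)%N ->
    c <= smean S (fun x => normc (av B (fun b => g (act (b * q)%N%:Z x))) ^+ 2).
Proof.
elim: l S g g0 fs ls lam => [|l IH] S g g0 [|[p' f'] fs] ls lam //.
  by move=> _ hlam hi h0 hpos; apply: progression_average1 hlam hi h0 hpos.
move=> [sfs] hlam hi h0 [e e0 he].
have e1 : uniq (p' :: (p :: map fst fs) ++ ls).
  case: hi => /= h _; move: h; rewrite !inE !mem_cat !negb_or -!andbA eq_sym => /and5P[-> -> -> -> ]; by move=> /andP[-> ->].
have hi1 : indep (p' :: map fst ((p, g) :: fs) ++ ls).
  by apply: (indep_sub hi) => // u; rewrite /= !inE orbCA.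
have h01 u : u \in p' :: map fst ((p, g) :: fs) ++ ls -> u.[0] = 0.
  by move=> hu; apply: h0; move: hu; rewrite /= !inE orbCA.
have pos1 : positive (fun n => cmean (smean S) (corr g0 ((p', f') :: (p, g) :: fs) ls lam n)).
  exists e => // k; have [M kM eM] := he k; exists M => //; apply: le_trans eM _.
  rewrite le_eqVlt; apply/orP; left; apply/eqP; apply: eq_av => n _; apply: eq_cmean => x.
  by rewrite /corr !prodF_cons /=; congr (_ * (_ * _)); rewrite mulrCA.
have sz : size ((p, g) :: fs) = l.+1 by rewrite /= sfs.
have [T [r [lp [chi [fr hlam' hchi hpos]]]]] :=
  eigen_extension (@rational_eigenvalues_all R l.+1) sz hlam hi1 h01 pos1.
have [||u hu|q [c qc hq]] := IH T _ _ (pull r fs) (p' :: ls) _ _ hlam' _ _ hpos.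
- by rewrite size_map.
- apply: (indep_sub hi); rewrite pull_fst.
    rewrite -[p :: _]cat1s catA (perm_uniq (permEl (perm_catCA _ [:: p'] ls))) /=.
    by move: e1; rewrite /= inE.
  by move=> u; rewrite /= !inE !mem_cat !inE; case: (u == p); case: (u == p') => //=; rewrite orbT.
- apply: h0; move: hu; rewrite pull_fst /= !inE !mem_cat !inE.
  by case: (u == p); case: (u == p') => //=; rewrite orbT.
exists q, c => // B B0; apply: le_trans (hq B B0) _; rewrite le_eqVlt; apply/orP; left; apply/eqP.
rewrite -(proj2 fr); last by bd.
apply: eq_mean => z; congr (normc _ ^+ 2); apply: eq_av => b _.
by rewrite /= (proj1 fr).
Qed.

End Progression.

(** * Recurrence *)

Section Recurrence.
Variable R : realType.
Local Notation C := R[i].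
Variables (S : system R) (f : S -> R).
Hypothesis f01 : forall x, 0 <= f x <= 1.
Implicit Types (v : S -> C) (r : nat).

Definition translates r (v : S -> C) : Prop :=
  exists b : nat, v = fun x => (f (act (r`! * b)%N%:Z x))%:C.

Lemma bdd_f : bdd f.
Proof. by exists 1 => x; case/andP: (f01 x) => h1 h2; rewrite ger0_norm. Qed.

Lemma conv_real r v x : conv (translates r) v -> v x = (Re (v x))%:C /\ 0 <= Re (v x) <= 1.
Proof.
elim=> [u [b ->]|t u u' /andP[t0 t1] _ [uE u01] _ [u'E u'01]].
  by split=> //; apply: f01.
rewrite /mix uE u'E -!rmorphM -rmorphD /=; split=> //.
move: u01 u'01; move: (Re _) (Re _) => a b /andP[a0 a1] /andP[b0 b1]; apply/andP; split; nra.
Qed.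

Lemma conv_le1 r v x : conv (translates r) v -> le1 (v x).
Proof.
move=> /(@conv_real _ _ x)[-> /andP[h1 h2]].
by rewrite /le1 normc_real ger0_norm.
Qed.

Lemma conv_mean r v : conv (translates r) v -> cmean (smean S) v = smean S f.
Proof.
elim=> [u [b ->]|t u u' t01 hu IHu hu' IHu'].
  by rewrite -[RHS](smean_act (r`! * b)%N%:Z); last exact: bdd_f.
have bu : bdd (fun x => Re (u x)) by apply: bdd_Re => x; apply: conv_le1 hu.
have bu' : bdd (fun x => Re (u' x)) by apply: bdd_Re => x; apply: conv_le1 hu'.
rewrite /cmean (eq_mean _ (g := fun x => t * Re (u x) + (1 - t) * Re (u' x))) => [|x]; last first.
  by rewrite /mix ReD !Re_scale.
rewrite meanD ?meanZ //; [|by apply: bddM => //; exact: bdd_cst|by apply: bddM => //; exact: bdd_cst].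
by move: IHu IHu'; rewrite /cmean => -> ->; ring.
Qed.

Lemma conv_act r v (m : nat) : conv (translates r) v ->
  conv (translates r) (fun x => v (act (r`! * m)%N%:Z x)).
Proof.
elim=> [u [b ->]|t u u' t01 _ IHu _ IHu']; last exact: (conv_mix t01 IHu IHu').
apply: conv_base; exists (b + m)%N; apply/funext => x.
by rewrite -actD -PoszD mulnDr.
Qed.

Lemma av_real M (c : nat -> R) : av M (fun n => (c n)%:C) = (av M c)%:C.
Proof. by rewrite /av rmorphM fmorphV rmorph_sum rmorph_nat. Qed.

(** Averages along the progression do not see the difference between a function
    and a convex combination of its translates along that progression. *)
Lemma conv_av r v (e : R) : conv (translates r) v -> 0 < e ->
  exists N, forall B, (N <= B)%N -> forall x,
  normc (av B (fun b => v (act (b * r`!)%N%:Z x)) - av B (fun b => (f (act (b * r`!)%N%:Z x))%:C)) <= e.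
Proof.
move=> hv e0; elim: hv => [u [k ->]|t u u' /andP[t0 t1] _ [N hN] _ [N' hN']].
  have [N [N0 hN]] := archi_lt (divr_ge0 (mulr_ge0 (ler0n R 2) (ler0n R k)) (ltW e0)).
  exists N => B NB x; rewrite !av_real -rmorphB normc_real.
  have f1 b : `|f (act (b * r`!)%N%:Z x)| <= 1.
    by case/andP: (f01 (act (b * r`!)%N%:Z x)) => h1 h2; rewrite ger0_norm.
  have := av_shift B k (c := fun b => f (act (b * r`!)%N%:Z x)) f1.
  rewrite [X in `|X - _| <= _](eq_av (d := fun b => f (act (r`! * k)%N%:Z (act (b * r`!)%N%:Z x)))) => [|b _]; last first.
    by rewrite -actD -PoszD; congr (f (act _%:Z x)); ring.
  move=> h; apply: le_trans h _; rewrite mulr1.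
  have B0 : 0 < B%:R :> R by rewrite ltr0n; apply: leq_trans NB.
  have : N%:R <= B%:R :> R by rewrite ler_nat.
  rewrite ler_pdivrMr //; move: hN; rewrite ltr_pdivrMr //; move: B0 e0; move: (B%:R) (N%:R) => b n.
  by nra.
exists (maxn N N') => B; rewrite geq_max => /andP[/hN h1 /hN' h2] x.
set A := av B (fun b => (f _)%:C).
have -> : av B (fun b => mix t u u' (act (b * r`!)%N%:Z x)) - A =
  t%:C * (av B (fun b => u (act (b * r`!)%N%:Z x)) - A) +
  (1 - t)%:C * (av B (fun b => u' (act (b * r`!)%N%:Z x)) - A).
  by rewrite /mix avD !avZ rmorphB rmorph1; ring.
apply: le_trans (le_normcD _ _) _; rewrite !normcM !normc_real !ger0_norm ?subr_ge0 //.
have := h1 x; have := h2 x; rewrite -/A; move: (normc _) (normc _) => a b; nra.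
Qed.

Lemma bernoulli_tangent (x m : R) n : 0 <= x -> 0 <= m ->
  m ^+ n.+1 + n.+1%:R * m ^+ n * (x - m) <= x ^+ n.+1.
Proof.
move=> x0 m0; elim: n => [|n IH]; first by rewrite !expr1 expr0; lra.
rewrite [leRHS]exprS; apply: le_trans (ler_wpM2l x0 IH).
rewrite -subr_ge0.
have -> : x * (m ^+ n.+1 + n.+1%:R * m ^+ n * (x - m)) - (m ^+ n.+2 + n.+2%:R * m ^+ n.+1 * (x - m)) =
  n.+1%:R * m ^+ n * (x - m) ^+ 2.
  by rewrite !exprS -[n.+2%:R]natr1 expr0; move: (m ^+ n) (n.+1%:R) => u k; ring.
by apply: mulr_ge0; [apply: mulr_ge0 => //; exact: exprn_ge0|exact: sqr_ge0].
Qed.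

Lemma mean_expn (X : Type) (m : mean R X) (u : X -> R) n : (forall x, 0 <= u x <= 1) ->
  m u ^+ n <= m (fun x => u x ^+ n).
Proof.
move=> u01; have bu : bdd u by exists 1 => x; case/andP: (u01 x) => h1 h2; rewrite ger0_norm.
have m0 : 0 <= m u by apply: mean_ge0 => // x; case/andP: (u01 x).
case: n => [|n].
  by rewrite expr0 (eq_mean _ (g := fun=> 1)) ?mean1.
apply: (@le_trans _ _ (m (fun x => m u ^+ n.+1 + n.+1%:R * m u ^+ n * (u x - m u)))).
  rewrite meanD; [|bd|bd]; rewrite mean_cst meanZ; last bd.
  by rewrite meanB ?mean_cst ?subrr ?mulr0 ?addr0 //; bd.
by apply: le_mean => [||x]; [bd|bd|]; apply: bernoulli_tangent => //; case/andP: (u01 x).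
Qed.

End Recurrence.

Section Telescoping.
Variable R : realType.
Local Notation C := R[i].

Lemma positive_add (a b : nat -> R) : positive (fun n => a n + b n) -> positive a \/ positive b.
Proof.
move=> [e e0 he]; have e20 : 0 < e / 2 by rewrite divr_gt0.
have /frequently_or[h|h] : frequently (fun M => e / 2 <= av M a \/ e / 2 <= av M b).
- move=> k; have [M kM] := he k; rewrite avD => eM; exists M => //.
  by case: (lerP (e / 2) (av M a)) => h; [left|right; lra].
- by left; exists (e / 2).
- by right; exists (e / 2).
Qed.

Lemma eq_positive (a b : nat -> R) : (forall n, a n = b n) -> positive a -> positive b.
Proof. by move=> ab [e e0 he]; exists e => // k; have [M] := he k; rewrite (eq_av (d := b)); [exists M|]. Qed.

Lemma dist_prod (I : Type) (r : seq I) (a b : I -> C) : (forall i, le1 (a i)) -> (forall i, le1 (b i)) ->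
  normc (\prod_(i <- r) a i - \prod_(i <- r) b i) <= \sum_(i <- r) normc (a i - b i).
Proof.
move=> ha hb; elim: r => [|i r IH]; first by rewrite !big_nil subrr normc0.
rewrite !big_cons; set A := \prod_(_ <- _) a _; set B := \prod_(_ <- _) b _.
have -> : a i * A - b i * B = (a i - b i) * A + b i * (A - B) by ring.
apply: le_trans (le_normcD _ _) _; rewrite !normcM; apply: lerD.
  by rewrite -[leRHS]mulr1 ler_wpM2l ?normc_ge0 //; apply: (_ : le1 A); rewrite /A; auto.
by apply: le_trans IH; rewrite -[leRHS]mul1r ler_wpM2r ?normc_ge0 //; apply: hb.
Qed.

Definition one_phase (S : system R) : {poly int} -> S -> C := fun _ _ => 1.

Lemma one_phases (S : system R) : phases (@one_phase S).
Proof. by split=> // p x; rewrite /unimod normc1. Qed.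

(** Replacing the functions of a product one at a time. *)
Lemma telescoping (S : system R) (f0 g h D : ball R S) fs (ps : seq {poly int}) :
  (forall x, D x = g x - h x) ->
  positive (fun n => cmean (smean S) (fun x => f0 x * (prodF fs n x *
    (prodF [seq (p, g) | p <- ps] n x - prodF [seq (p, h) | p <- ps] n x)))) ->
  exists p fs1, perm_eq (p :: map fst fs1) (map fst fs ++ ps) /\
    positive (fun n => cmean (smean S) (corr f0 ((p, D) :: fs1) [::] (@one_phase S) n)).
Proof.
move=> hD; elim: ps fs => [|p ps IH] fs hpos.
  have : positive (fun=> 0 : R).
    apply: eq_positive hpos => n; rewrite -[RHS](mean_cst (smean S)); apply: eq_mean => x.
    by rewrite /= subrr !mulr0.
  by move=> [e e0 /(_ 0%N)[M _]]; rewrite /av big1 // mul0r leNgt e0.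
have D1 n x : le1 (prodF fs n x * (D (act p.[n%:Z] x) * prodF [seq (r, g) | r <- ps] n x)).
  by apply: le1M; [exact: le1_prodF|apply: le1M; [auto|exact: le1_prodF]].
have [||hp] := @positive_add
  (fun n => cmean (smean S) (fun x => f0 x * (prodF fs n x * (D (act p.[n%:Z] x) * prodF [seq (r, g) | r <- ps] n x))))
  (fun n => cmean (smean S) (fun x => f0 x * (prodF ((p, h) :: fs) n x *
    (prodF [seq (r, g) | r <- ps] n x - prodF [seq (r, h) | r <- ps] n x)))).
- apply: eq_positive hpos => n; rewrite /cmean -meanD.
  + apply: eq_mean => x; rewrite -ReD; congr Re.
    by rewrite !prodF_cons /= hD; ring.
  + by apply: bdd_Re => x; auto.
  + exists 2 => x; apply: le_trans (absRe_le _) _; rewrite !normcM.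
    have h1 : le1 (f0 x) by auto.
    have h2 : le1 (prodF ((p, h) :: fs) n x) by exact: le1_prodF.
    have h3 : normc (prodF [seq (r, g) | r <- ps] n x - prodF [seq (r, h) | r <- ps] n x) <= 2.
      apply: le_trans (le_normcD _ _) _; rewrite normcN.
      have := le1_prodF [seq (r, g) | r <- ps] n x; have := le1_prodF [seq (r, h) | r <- ps] n x.
      by rewrite /le1 => ? ?; lra.
    rewrite -[2]mul1r; apply: ler_pM => //; rewrite ?mulr_ge0 ?normc_ge0 //.
    by rewrite -[2]mul1r; apply: ler_pM => //; rewrite ?normc_ge0.
- move=> hp; exists p, (fs ++ [seq (r, g) | r <- ps]); split.
    have -> : map fst (fs ++ [seq (r, g) | r <- ps]) = map fst fs ++ ps.
      by rewrite map_cat -map_comp map_id.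
    exact: (permEl (perm_catCA [:: p] _ _)).
  apply: eq_positive hp => n; apply: eq_cmean => x.
  rewrite /corr prodF_cons prodF_cat /= /phase big_nil mulr1.
  by congr (_ * _); rewrite mulrCA.
have [r [fs1 [pfs hr]]] := IH _ hp; exists r, fs1; split=> //.
by apply: (perm_trans pfs); exact: (permEl (perm_catCA [:: p] (map fst fs) ps)).
Qed.

End Telescoping.

Lemma sqr_le_sum (R : realType) (z u v x e : R) : 0 <= z -> z <= u + v -> 0 <= u -> 0 <= v ->
  u ^+ 2 <= x -> v <= e -> z ^+ 2 <= 2 * x + 2 * e ^+ 2.
Proof.
move=> z0 zuv u0 v0 ux ve; have h1 : z ^+ 2 <= (u + v) ^+ 2 by rewrite lerXn2r ?nnegrE ?addr_ge0.
have h2 : v ^+ 2 <= e ^+ 2 by rewrite lerXn2r ?nnegrE // (le_trans v0).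
have h3 := sqr_ge0 (u - v); nra.
Qed.

Section RecurrenceTheorem.
Variable R : realType.
Local Notation C := R[i].
Variables (S : system R) (f : S -> R).
Hypothesis f01 : forall x, 0 <= f x <= 1.
Local Notation S1 := (limit_system S).
Local Notation K := (fun r => conv (translates f r)).
Variables (w : nat -> S -> C) (rho : nat -> R).
Hypothesis wK : forall r, K r (w r).
Hypothesis rho0 : forall e, 0 < e -> exists r0, forall r, (r0 <= r)%N -> rho r <= e.
Hypothesis w_cauchy : forall r s, (r <= s)%N -> smean S (fun x => normc (w s x - w r x) ^+ 2) <= rho r.
Hypothesis w_min : forall r v, K r v -> nrm2 (smean S) v <= nrm2 (smean S) (w r) ->
  smean S (fun x => normc (v x - w r x) ^+ 2) <= rho r.

Lemma w1 r x : le1 (w r x). Proof. exact: conv_le1 (wK r). Qed.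
Hint Resolve w1 : core.

(** The limit of the near-minimizers; it plays the role of the projection of [f] to
    the functions of rational spectrum. *)
Definition w_limit : ball R S1.
Proof. by exists (fun q : S1 => w q.2 q.1). Defined.

Definition f_limit : ball R S1.
Proof.
exists (fun q : S1 => (f q.1)%:C) => q; rewrite /le1 normc_real.
by case/andP: (f01 q.1) => h1 h2; rewrite ger0_norm.
Defined.

Lemma w_limit_near r : smean S1 (fun q => normc (w_limit q - w r q.1) ^+ 2) <= rho r.
Proof.
apply: (@LIM_le R (fun t => smean S (fun x => normc (w t x - w r x) ^+ 2)) _ r); last exact: w_cauchy.
exists 4 => t; apply: mean_norm => x; rewrite ger0_norm ?sqr_ge0 //.
have : normc (w t x - w r x) <= 2.
  apply: le_trans (le_normcD _ _) _; rewrite normcN; have := w1 t x; have := w1 r x.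
  by rewrite /le1 => ? ?; lra.
have := normc_ge0 (w t x - w r x); move: (normc _) => a; nra.
Qed.

Lemma w_near r (eta : R) : 0 <= eta -> rho r <= eta ^+ 2 ->
  smean S1 (fun q => normc (w_limit q - w r q.1)) <= eta.
Proof.
move=> eta0 hr; apply: mean_le_root => //; first by bd.
exact: le_trans (w_limit_near r) hr.
Qed.

(** A translate of a near-minimizer lies in the same convex set and has the same
    norm, so that it cannot be far away. *)
Lemma w_almost_invariant r (m : int) (eta : R) : 0 <= eta -> rho r <= eta ^+ 2 ->
  smean S (fun x => normc (w r (act (r`!%:Z * m) x) - w r x)) <= eta.
Proof.
move=> eta0 hr.
have nn (k : nat) : smean S (fun x => normc (w r (act (r`! * k)%N%:Z x) - w r x)) <= eta.
  apply: mean_le_root => //; first by bd.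
  apply: le_trans hr; apply: (w_min (v := fun x => w r (act (r`! * k)%N%:Z x))).
    exact: conv_act.
  by rewrite /nrm2 (smean_act _ (f := fun x => normc (w r x) ^+ 2)) //; bd.
case: m => k; first exact: nn.
rewrite -[leLHS](smean_act (r`! * k.+1)%N%:Z); last by bd.
apply: le_trans (nn k.+1); rewrite le_eqVlt; apply/orP; left; apply/eqP; apply: eq_mean => x.
rewrite normcB -actD; congr (normc (w r _ - _)).
by rewrite NegzE mulrN -PoszM addNr act0.
Qed.

Lemma w_limit_almost_invariant r (m : int) (eta : R) : 0 <= eta -> rho r <= eta ^+ 2 ->
  smean S1 (fun q => normc (w_limit (act (r`!%:Z * m) q) - w_limit q)) <= 3 * eta.
Proof.
move=> eta0 hr; have h1 := w_near eta0 hr.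
have h2 := w_almost_invariant m eta0 hr.
pose d (q : S1) := normc (w_limit q - w r q.1).
pose d2 (q : S1) := normc (w r (act (r`!%:Z * m) q.1) - w r q.1).
have bd1 : bdd d by rewrite /d; bd.
have bd2 : bdd d2 by rewrite /d2; bd.
have bd3 : bdd (fun q => d (act (r`!%:Z * m) q)) by apply: bdd_comp.
apply: (@le_trans _ _ (smean S1 (fun q => d (act (r`!%:Z * m) q) + d2 q + d q))).
  apply: le_mean => [||q]; [bd|by apply: bddD => //; apply: bddD|].
  set a := w_limit (act _ q); set b := w_limit q.
  have -> : a - b = (a - w r (act (r`!%:Z * m) q.1)) + (w r (act (r`!%:Z * m) q.1) - w r q.1) + (w r q.1 - b) by ring.
  apply: le_trans (le_normcD _ _) _; rewrite /d [normc (w r q.1 - b)]normcB lerD2r.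
  exact: le_normcD.
rewrite !meanD //; last exact: bddD.
rewrite smean_act //.
have -> : smean S1 d2 = smean S (fun x => normc (w r (act (r`!%:Z * m) x) - w r x)).
  by rewrite -(proj2 (limit_factor S)) //; bd.
by rewrite -/d in h1; lra.
Qed.

(** By [conv_av] the long averages of [f] and of a near-minimizer agree, and the
    latter is close to the limit in norm, uniformly under translations. *)
Lemma w_difference_small (D : ball R S1) (q : nat) (c : R) : (forall x, D x = w_limit x - f_limit x) ->
  (0 < q)%N -> 0 < c -> exists2 B, (0 < B)%N &
  smean S1 (fun x => normc (av B (fun b => D (act (b * q)%N%:Z x))) ^+ 2) < c.
Proof.
move=> hD q0 c0; have c80 : 0 < c / 8 by rewrite divr_gt0.
have [r0 hr0] := rho0 c80; pose r := maxn r0 q; have hr : rho r <= c / 8 by apply: hr0; rewrite leq_maxl.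
pose e : R := Num.min 1 (c / 8).
have e0 : 0 < e by rewrite lt_min ltr01.
have ec : e ^+ 2 <= c / 8.
  have : e <= 1 by rewrite /e ge_min lexx.
  have : e <= c / 8 by rewrite /e ge_min lexx orbT.
  by move: e e0 => x; nra.
have /dvdnP[s rE] : (q %| r`!)%N by apply: dvdn_fact; rewrite q0 leq_maxr.
have s0 : (0 < s)%N by case: s rE => // rE; have := fact_gt0 r; rewrite rE.
have [N hN] := conv_av f01 (wK r) e0.
pose B := maxn N 1; have B0 : (0 < B)%N by rewrite leq_maxr.
exists (B * s)%N; first by rewrite muln_gt0 B0.
pose G (x : S1) := av B (fun b => D (act (b * r`!)%N%:Z x)).
have G1 x : le1 (G x) by rewrite /G; auto.
apply: (@le_lt_trans _ _ (smean S1 (fun x => normc (G x) ^+ 2))).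
  apply: (@le_trans _ _ (smean S1 (fun x => av s (fun a => normc (G (act (a * q)%N%:Z x)) ^+ 2)))).
    apply: le_mean => [||x]; [bd|bd|].
    rewrite av_blocks // exchange_av; set F := (fun a : nat => _ : C).
    have <- : av s (fun a => normc (F a) ^+ 2) = av s (fun a => normc (G (act (a * q)%N%:Z x)) ^+ 2).
      apply: eq_av => a _; congr (normc _ ^+ 2); apply: eq_av => b _.
      by rewrite -actD -PoszD rE; congr (D (act _%:Z x)); ring.
    apply: le_trans (av_sqr _ s0); rewrite lerXn2r ?nnegrE ?normc_ge0 //.
      by apply: av_ge0 => a _; exact: normc_ge0.
    exact: normc_av.
  rewrite mean_av => [|a]; last by bd.
  apply: av_le => [|a _]; first exact: s0.
  by rewrite (smean_act (s := S1) _ (f := fun x => normc (G x) ^+ 2)); [exact: lexx|bd].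
apply: (@le_lt_trans _ _ (2 * (c / 8) + 2 * (c / 8))); last by lra.
apply: (@le_trans _ _ (smean S1 (fun x => 2 * av B (fun b => normc (w_limit (act (b * r`!)%N%:Z x) - w r (act (b * r`!)%N%:Z x).1) ^+ 2) + 2 * e ^+ 2))).
  apply: le_mean => [||x]; [bd|bd|].
  have := hN B (leq_maxl _ _) x.1; set V := av B _ - av B _ => hV.
  have -> : G x = av B (fun b => w_limit (act (b * r`!)%N%:Z x) - w r (act (b * r`!)%N%:Z x).1) + V.
    by rewrite /G /V -!avB -avD; apply: eq_av => b _; rewrite hD /=; ring.
  set U := av B _.
  have hU : normc U ^+ 2 <= av B (fun b => normc (w_limit (act (b * r`!)%N%:Z x) - w r (act (b * r`!)%N%:Z x).1) ^+ 2).
    apply: le_trans (av_sqr _ B0); rewrite lerXn2r ?nnegrE ?normc_ge0 //.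
      by apply: av_ge0 => a _; exact: normc_ge0.
    exact: normc_av.
  exact: sqr_le_sum (normc_ge0 _) (le_normcD U V) (normc_ge0 _) (normc_ge0 _) hU hV.
rewrite meanD; [|bd|bd]; rewrite mean_cst meanZ; last by bd.
rewrite lerD //; last by rewrite ler_wpM2l.
rewrite ler_wpM2l // mean_av => [|b]; last by bd.
apply: av_le => // b _; rewrite (smean_act (s := S1) _ (f := fun x => normc (w_limit x - w r x.1) ^+ 2)); last by bd.
exact: le_trans (w_limit_near r) hr.
Qed.

Lemma sum_const (I : Type) (r : seq I) (a : R) : \sum_(i <- r) a = (size r)%:R * a.
Proof. by rewrite big_const_seq count_predT iter_addr addr0 mulr_natl. Qed.

(** Powers of a near-minimizer are almost invariant, so that [f] may be replaced by
    its translates, hence by the near-minimizer itself; convexity concludes. *)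
Lemma w_limit_power (k : nat) (eta : R) : 0 < eta ->
  smean S f ^+ k.+1 - k%:R * eta <= cmean (smean S1) (fun q => f_limit q * w_limit q ^+ k).
Proof.
move=> eta0; have [r0 hr0] := rho0 (exprn_gt0 2 eta0).
have f1 x : le1 ((f x)%:C : C).
  by rewrite /le1 normc_real; case/andP: (f01 x) => h1 h2; rewrite ger0_norm.
apply: (@LIM_ge R (fun t => cmean (smean S) (fun x => (f x)%:C * w t x ^+ k)) _ r0).
  by apply: bdd_cmean => t x; auto.
move=> t tr; have ht := hr0 t tr.
have wE x : w t x = (Re (w t x))%:C /\ 0 <= Re (w t x) <= 1 by exact: (conv_real f01 x (wK t)).
apply: (@le_trans _ _ (cmean (smean S) (fun x => w t x * w t x ^+ k) - k%:R * eta)).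
  rewrite lerD2r -(conv_mean f01 (wK t)).
  apply: le_trans (mean_expn _ _ (fun x => proj2 (wE x))) _.
  rewrite le_eqVlt; apply/orP; left; apply/eqP; apply: eq_mean => x.
  by rewrite -exprS (proj1 (wE x)) -rmorphXn.
rewrite lerBlDr.
apply: (@conv_le R S S (smean S) id (fun x => w t x ^+ k) (translates f t)).
- by move=> v [b ->] x; apply: f1.
- by move=> x; auto.
- move=> v [b ->].
  rewrite -(cmean_act (- (t`! * b)%N%:Z)) => [|x]; last by auto.
  apply: le_trans (cmean_lipschitz (smean S) (G := fun x => (f x)%:C * w t x ^+ k) _ _) _.
  + by move=> x; auto.
  + by move=> x; auto.
  rewrite lerD2l.
  apply: (@le_trans _ _ (smean S (fun x => k%:R * normc (w t (act (t`!%:Z * - b%:Z) x) - w t x)))).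
    apply: le_mean => [||x]; [bd|bd|].
    rewrite -actD addrN act0 -mulrBr normcM; apply: (@le_trans _ _ (1 * normc (w t (act (- (t`! * b)%N%:Z) x) ^+ k - w t x ^+ k))).
      by rewrite ler_wpM2r ?normc_ge0 //; apply: f1.
    rewrite mul1r mulrN -PoszM; set a := w t _; set b' := w t x.
    have := @dist_prod R 'I_k (index_enum 'I_k) (fun=> a) (fun=> b') (fun=> w1 _ _) (fun=> w1 _ _).
    by rewrite !prodr_const sumr_const card_ord mulr_natl.
  rewrite meanZ; last bd.
  by rewrite ler_wpM2l // w_almost_invariant // ltW.
- exact: wK.
Qed.

End RecurrenceTheorem.

Lemma horner_factor (p : {poly int}) (a : int) : p.[0] = 0 -> exists m, p.[a] = a * m.
Proof.
move=> p0; have /factor_theorem[q ->] : root p 0 by apply/eqP.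
by exists q.[a]; rewrite hornerM !hornerE mulrC.
Qed.

Definition dilate (r : int) (p : {poly int}) := p \Po (r *: 'X).

Lemma horner_dilate r p (n : int) : (dilate r p).[n] = p.[r * n].
Proof. by rewrite horner_comp hornerZ hornerX. Qed.

Lemma dilate_eq0 r p : r != 0 -> (dilate r p == 0) = (p == 0).
Proof. by move=> r0; rewrite comp_poly_eq0 // size_scale // size_polyX. Qed.

Lemma dilate_inj r : r != 0 -> injective (dilate r).
Proof.
move=> r0 p q /eqP; rewrite -subr_eq0 /dilate -comp_polyB -/(dilate r _) dilate_eq0 // subr_eq0.
by move/eqP.
Qed.

Lemma indep_dilate r ps : r != 0 -> indep ps -> indep (map (dilate r) ps).
Proof.
move=> r0 [ups hps]; split=> [|c hc p]; first by rewrite map_inj_uniq //; apply: dilate_inj.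
move=> /mapP[q qps ->]; apply: (hps (fun s => c (dilate r s))) => //.
apply/eqP; rewrite -(dilate_eq0 _ r0); apply/eqP; apply: etrans hc.
rewrite big_map /dilate raddf_sum.
by apply: eq_bigr => s _; rewrite /= comp_polyZ.
Qed.

Section MultipleRecurrence.
Variable R : realType.
Local Notation C := R[i].

Lemma av_indicator0 M : (0 < M)%N -> av M (fun n => (n == 0)%N%:R) = M%:R^-1 :> R.
Proof.
by case: M => // M _; rewrite /av big_ord_recl big1 ?addr0 ?mul1r.
Qed.

(** Restricting [n] to multiples of a factorial makes the limit [W] of the
    near-minimizers almost invariant under all the translations that occur; the
    difference of [W] and [f] contributes nothing on average. *)
Theorem polynomial_recurrence (S : system R) (f : S -> R) (ps : seq {poly int}) (eps : R) :
  (forall x, 0 <= f x <= 1) -> indep ps -> (forall p, p \in ps -> p.[0] = 0) -> 0 < eps ->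
  exists n : nat, (0 < n)%N /\
    smean S f ^+ (size ps).+1 - eps <=
    smean S (fun x => f x * \prod_(p <- ps) f (act p.[n%:Z] x)).
Proof.
move=> f01 hi h0 eps0; apply: contrapT => hn.
have {}hn n : (0 < n)%N -> smean S (fun x => f x * \prod_(p <- ps) f (act p.[n%:Z] x)) <
    smean S f ^+ (size ps).+1 - eps.
  by move=> n0; rewrite ltNge; apply/negP => h; apply: hn; exists n.
have [w [rho [wK rho0 w_cauchy _ w_min]]] : exists (w : nat -> S -> C) (rho : nat -> R),
  [/\ forall r, conv (translates f r) (w r),
      forall e, 0 < e -> exists r0, forall r, (r0 <= r)%N -> rho r <= e,
      forall r s, (r <= s)%N -> smean S (fun x => normc (w s x - w r x) ^+ 2) <= rho r,
      forall r v, conv (translates f r) v -> nrm2 (smean S) (w r) - rho r <= cmean (smean S) (fun x => v x * (w r x)^J) &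
      forall r v, conv (translates f r) v -> nrm2 (smean S) v <= nrm2 (smean S) (w r) ->
        smean S (fun x => normc (v x - w r x) ^+ 2) <= rho r].
  apply: near_minimizers => [r|r v hv x|r t v v' t01 hv hv'|r].
  - apply: conv_mono => v [b ->]; exists (r.+1 * b)%N; apply/funext => x.
    by rewrite factS mulnCA mulnA.
  - exact: (conv_le1 f01 x hv).
  - exact: conv_mix t01 hv hv'.
  - by exists (fun x => (f (act (r`! * 0)%N%:Z x))%:C); apply: conv_base; exists 0%N.
pose S1 := limit_system S; pose W : ball R S1 := w_limit f01 wK; pose F : ball R S1 := f_limit f01.
pose k := size ps; pose eta : R := eps / (8 * k.+1%:R).
have eta0 : 0 < eta by rewrite divr_gt0 ?mulr_gt0 ?ltr0n.
have [r hr] := rho0 _ (exprn_gt0 2 eta0); have {}hr := hr r (leqnn r).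
have r0 : r`!%:Z != 0 by rewrite eqz_nat -lt0n fact_gt0.
pose qs := map (dilate r`!%:Z) ps.
have sqs : size qs = k by rewrite size_map.
have f_le1 x : 0 <= f x <= 1 by exact: f01.
have AE n : cmean (smean S1) (fun x => F x * prodF [seq (p, F) | p <- qs] n x) =
    smean S (fun x => f x * \prod_(p <- ps) f (act p.[(r`! * n)%N%:Z] x)).
  pose G x := f x * \prod_(p <- ps) f (act p.[(r`! * n)%N%:Z] x).
  rewrite -[RHS](proj2 (limit_factor S) G); last first.
    exists 1 => x; have /andP[h1 h2] := f01 x.
    have h3 : 0 <= \prod_(p <- ps) f (act p.[(r`! * n)%N%:Z] x).
      by apply: prodr_ge0 => p _; case/andP: (f01 (act p.[(r`! * n)%N%:Z] x)).
    have h4 : \prod_(p <- ps) f (act p.[(r`! * n)%N%:Z] x) <= 1.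
      by apply: prodr_ile1 => p _; apply: f01.
    by rewrite /G ger0_norm ?mulr_ge0 // mulr_ile1.
  apply: eq_mean => x; rewrite /prodF !big_map /G /=.
  have -> : \prod_(p <- ps) (f (act (dilate r`!%:Z p).[n] x.1))%:C =
     (\prod_(p <- ps) f (act p.[(r`! * n)%N] x.1))%:C.
    by rewrite rmorph_prod; apply: eq_bigr => p _; rewrite horner_dilate.
  by rewrite -rmorphM.
have BE n : smean S f ^+ k.+1 - eps / 2 <= cmean (smean S1) (fun x => F x * prodF [seq (p, W) | p <- qs] n x).
  have hW := w_limit_power f01 wK rho0 w_min k eta0.
  apply: (@le_trans _ _ (cmean (smean S1) (fun q => F q * W q ^+ k) - k%:R * (3 * eta))).
    have keta : k%:R * eta <= eps / 8.
      rewrite /eta mulrA ler_pdivrMr ?mulr_gt0 ?ltr0n //.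
      have : k%:R <= k.+1%:R :> R by rewrite ler_nat.
      move: (k%:R) (k.+1%:R) => a b ab; nra.
    rewrite -/F -/W in hW; lra.
  rewrite lerBlDr.
  apply: le_trans (cmean_lipschitz (smean S1) (G := fun x => F x * prodF [seq (p, W) | p <- qs] n x) _ _) _.
  - by move=> x; auto.
  - by move=> x; apply: le1M; [auto|exact: le1_prodF].
  rewrite lerD2l.
  apply: (@le_trans _ _ (smean S1 (fun x => \sum_(p <- ps) normc (W (act (dilate r`!%:Z p).[n%:Z] x) - W x)))).
    apply: le_mean => [||x].
    - by apply: bdd_normcB => x; [auto|apply: le1M; [auto|exact: le1_prodF]].
    - by apply: bdd_sum => p; bd.
    rewrite -mulrBr normcM; apply: (@le_trans _ _ (1 * normc (W x ^+ k - prodF [seq (p, W) | p <- qs] n x))).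
      by rewrite ler_wpM2r ?normc_ge0 //; apply: ballP.
    rewrite mul1r normcB /prodF !big_map /=.
    have := @dist_prod R _ ps (fun p => W (act (dilate r`!%:Z p).[n%:Z] x)) (fun=> W x)
      (fun p => ballP W _) (fun p => ballP W _).
    by rewrite [\prod_(i <- ps) W x]big_const_seq count_predT iter_mulr_1.
  rewrite mean_sum => [|p]; last by bd.
  apply: (@le_trans _ _ (\sum_(p <- ps) (3 * eta))); last by rewrite sum_const.
  rewrite !big_seq; apply: ler_sum => p pps.
  rewrite horner_dilate; have [m mE] := horner_factor (r`!%:Z * n%:Z) (h0 p pps).
  rewrite mE -mulrA; exact: (w_limit_almost_invariant f01 wK w_cauchy w_min _ (ltW eta0) hr).
have D1 x : le1 (W x - F x).
  have [wE /andP[w0 w1]] := conv_real f01 x.1 (wK x.2); have /andP[f0 f1] := f01 x.1.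
  rewrite /le1 /W /F /= wE -rmorphB normc_real ler_norml.
  by move: (Re _) w0 w1 {wE} => a; lra.
pose D : ball R S1 := Ball D1.
have pos : positive (fun n => cmean (smean S1) (fun x => F x * (prodF [::] n x *
    (prodF [seq (p, W) | p <- qs] n x - prodF [seq (p, F) | p <- qs] n x)))).
  pose A n := cmean (smean S1) (fun x => F x * prodF [seq (p, F) | p <- qs] n x).
  pose B n := cmean (smean S1) (fun x => F x * prodF [seq (p, W) | p <- qs] n x).
  have hAB n : eps / 2 - (2 + eps / 2) * (n == 0)%N%:R <= B n - A n.
    case: n => [|n].
      have h1 : `|A 0%N| <= 1 by apply: cmean_norm => x; apply: le1M; [auto|exact: le1_prodF].
      have h2 : `|B 0%N| <= 1 by apply: cmean_norm => x; apply: le1M; [auto|exact: le1_prodF].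
      rewrite eqxx mulr1; move: h1 h2; rewrite !ler_norml => /andP[? ?] /andP[? ?]; lra.
    rewrite mulr0 subr0; have := BE n.+1; have := hn (r`! * n.+1)%N; rewrite muln_gt0 fact_gt0 -AE.
    by move=> /(_ isT); rewrite -/(A n.+1) -/(B n.+1) -/k; lra.
  exists (eps / 4); first by rewrite divr_gt0.
  have [N [N0 hN]] := @archi_lt R ((2 + eps / 2) / (eps / 4)) ltac:(by rewrite divr_ge0 ?addr_ge0 ?divr_ge0 // ltW).
  move=> k0; exists (maxn k0 N); first by rewrite leq_maxl.
  set M := maxn k0 N; have M0 : (0 < M)%N by apply: leq_trans (leq_maxr _ _).
  apply: (@le_trans _ _ (av M (fun n => B n - A n))); last first.
    rewrite le_eqVlt; apply/orP; left; apply/eqP; apply: eq_av => n _.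
    rewrite /A /B /cmean -meanB.
    + apply: eq_mean => x; rewrite -ReB -mulrBr; congr (Re (_ * _)).
      by rewrite [prodF [::] n x]big_nil mul1r.
    + by apply: bdd_Re => x; apply: le1M; [auto|exact: le1_prodF].
    + by apply: bdd_Re => x; apply: le1M; [auto|exact: le1_prodF].
  apply: (@le_trans _ _ (av M (fun n => eps / 2 - (2 + eps / 2) * (n == 0)%N%:R))); last first.
    by apply: le_av => n _; apply: hAB.
  rewrite avB av_const // [X in _ - X]avZ av_indicator0 //.
  have hM : N%:R <= M%:R :> R by rewrite ler_nat leq_maxr.
  have MR : 0 < M%:R :> R by rewrite ltr0n.
  have : (2 + eps / 2) / M%:R <= eps / 4.
    rewrite ler_pdivrMr //; move: hN; rewrite ltr_pdivrMr ?divr_gt0 // => hN.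
    by apply: le_trans (ltW hN) _; rewrite mulrC ler_wpM2l // divr_ge0 // ltW.
  by lra.
have hqs : indep qs by apply: indep_dilate.
have [p [fs1 [pfs hpos]]] := telescoping (D := D) (fun x => erefl) pos.
have hi1 : indep (p :: map fst fs1 ++ [::]).
  rewrite cats0; apply: (indep_sub hqs) => [|u]; first by rewrite (perm_uniq pfs); case: hqs.
  by rewrite (perm_mem pfs).
have h01 u : u \in p :: map fst fs1 ++ [::] -> u.[0] = 0.
  rewrite cats0 (perm_mem pfs) => /mapP[s sps ->].
  by rewrite horner_dilate mulr0 h0.
have [q [c [q0 c0] hc]] := progression_average (erefl _) (@one_phases R S1) hi1 h01 hpos.
have [B B0 hB] := w_difference_small rho0 w_cauchy (D := D) (fun x => erefl) q0 c0.
by have := hc B B0; rewrite leNgt hB.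
Qed.

End MultipleRecurrence.

(** * From sets of integers to systems *)

Section IntegerPolynomials.
Variable R : realType.

(** The values at [0, ..., d - 1] determine the coefficients through an integral
    Vandermonde matrix, whose determinant is a common denominator. *)
Lemma integer_poly_denominator d : exists2 D : nat, (0 < D)%N &
  forall p : {poly R}, (size p <= d)%N -> integer_poly p -> forall j, D%:R * p`_j \is a Num.int.
Proof.
pose V : 'M[int]_d := Vandermonde d (\row_(j < d) (j%:Z)).
have V0 : \det V != 0.
  rewrite det_Vandermonde; apply/prodf_neq0 => i _; apply/prodf_neq0 => j ij.
  by rewrite !mxE subr_eq0 eqz_nat gtn_eqF.
exists `|\det V|%N => [|p sp hp j]; first by rewrite absz_gt0.
have [jd|jd] := ltnP j d; last by rewrite nth_default ?mulr0 ?rpred0 // (leq_trans sp).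
pose c : 'rV[R]_d := \row_j p`_j; pose VR : 'M[R]_d := map_mx intr V.
have cV i : (c *m VR) 0 i \is a Num.int.
  have <- : p.[(i%:Z)%:~R] = (c *m VR) 0 i; last exact: hp.
  rewrite (horner_coef_wide _ sp) !mxE; apply: eq_bigr => l _.
  by rewrite !mxE rmorphXn.
have : (c *m VR *m map_mx intr (\adj V)) 0 (Ordinal jd) \is a Num.int.
  by rewrite mxE; apply: rpred_sum => i _; rewrite rpredM // mxE intr_int.
rewrite -mulmxA -map_mxM mul_mx_adj map_scalar_mx mul_mx_scalar !mxE /=.
by case: (\det V) => n; rewrite // NegzE abszN mulrNz mulNr rpredN.
Qed.

(** Multiplying the variable by a common denominator makes the coefficients
    integral, as the constant terms vanish. *)
Lemma integer_polys (k : nat) (p : 'I_k -> {poly R}) : (forall i, integer_poly (p i)) ->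
  (forall i, (p i).[0] = 0) ->
  exists2 D : nat, (0 < D)%N & exists q : 'I_k -> {poly int},
    forall i j, ((q i)`_j)%:~R = D%:R ^+ j * (p i)`_j.
Proof.
move=> hp p0; have [D D0 hD] := integer_poly_denominator (\max_i size (p i)).
exists D => //; exists (fun i => \poly_(j < size (p i)) Num.floor (D%:R ^+ j * (p i)`_j)) => i j.
rewrite coef_poly; case: ltnP => [jp|jp]; last by rewrite nth_default ?mulr0.
rewrite floorK //; case: j jp => [|j] _; first by rewrite -horner_coef0 p0 mulr0 rpred0.
rewrite exprSr -mulrA rpredM ?rpredX ?natr_int //; apply: hD => //.
by apply: (@leq_bigmax_cond _ xpredT (fun i => size (p i))).
Qed.

End IntegerPolynomials.

Section IntervalSystem.
Variable R : realType.

Variable N : nat -> nat.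
Hypothesis ltN : forall j, (j < N j)%N.

Definition interval_mean : mean R (nat * int) :=
  bind_mean LIM (fun j => map_mean (fun i => (j, i.+1%:Z)) (unif (N j))).

Lemma interval_meanE F : interval_mean F = LIM (fun j => av (N j) (fun i => F (j, i.+1%:Z))).
Proof. by apply: (@eq_mean _ _ LIM (fun j => unif (N j) _)) => j; rewrite unifE // (leq_trans _ (ltN j)). Qed.

Lemma interval_mean_act (a : int) F : bdd F ->
  interval_mean (fun z => F (z.1, z.2 + a)) = interval_mean F.
Proof.
have nn (b : nat) (G : nat * int -> R) : bdd G ->
    interval_mean (fun z => G (z.1, z.2 + b%:Z)) = interval_mean G.
  move=> [K1 hK1]; pose K := `|K1|.
  have hK z : `|G z| <= K by apply: le_trans (hK1 z) (ler_norm _).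
  have N0 j : (0 < N j)%N by apply: leq_trans (ltN j).
  have hb (H : nat * int -> R) : (forall z, `|H z| <= K) -> bdd (fun j => av (N j) (fun i => H (j, i.+1%:Z))).
    by move=> hH; exists K => j; rewrite -unifE //; apply: mean_norm.
  rewrite !interval_meanE; apply/eqP; rewrite -subr_eq0 -(meanB LIM); last 2 first.
  - by apply: (hb (fun z => G (z.1, z.2 + b%:Z))).
  - exact: hb.
  apply/eqP; apply: (LIM_small (K := 2 * K * b%:R)) => j.
  have := av_shift (N j) b (c := fun i => G (j, i.+1%:Z)) (fun i => hK _).
  rewrite (eq_av (d := fun n => G (j, n.+1%:Z + b%:Z))) => [h|n _]; last by rewrite -PoszD addSn.
  apply: le_trans h _; rewrite ler_wpM2l ?mulr_ge0 ?normr_ge0 // lef_pV2 ?posrE ?ltr0n //.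
  by rewrite ler_nat.
case: a => b hF; first exact: nn.
rewrite -(nn b.+1); last by case: hF => K hK; exists K.
by apply: (eq_mean interval_mean) => -[j i]; congr (F (j, _)) => /=; lia.
Qed.

(** The limit of the uniform distributions on the intervals [1, N j], on which the
    integers act by translation. *)
Definition interval_system : system R.
Proof.
refine (@System R (nat * int) (fun a z => (z.1, z.2 + a)) interval_mean _ _ _).
- by case=> j i /=; rewrite addr0.
- by move=> a b [j i] /=; rewrite -addrA [b + a]addrC.
- exact: interval_mean_act.
Defined.

Lemma av_fset (M : nat) (A : {fset int}) : (forall x : int, x \in A -> 1 <= x <= M%:Z) ->
  av M (fun i => (i.+1%:Z \in A)%:R) = (#|` A|)%fset%:R / M%:R :> R.
Proof.
move=> hA; rewrite /av; congr (_ / _).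
rewrite -natr_sum; congr (_%:R).
pose s := [seq i.+1%:Z | i <- iota 0 M].
transitivity (size [seq x <- s | x \in A]).
  rewrite size_filter /s count_map -sum1_count [RHS]big_mkcond /= -(big_mkord xpredT (fun i => nat_of_bool (i.+1%:Z \in A))).
  by rewrite /index_iota subn0; apply: eq_bigr => i _; case: (_ \in A).
apply/perm_size/uniq_perm => [||x].
- by apply: filter_uniq; rewrite map_inj_uniq ?iota_uniq // => i j [].
- exact: fset_uniq.
rewrite mem_filter andb_idr // => xA; have /andP[x1 xM] := hA x xA.
apply/mapP; exists (`|x|.-1)%N; last by lia.
by rewrite mem_iota; lia.
Qed.

End IntervalSystem.

Theorem theorem2p2 (R : realType) (k : nat) (p : 'I_k -> {poly R})
    (p_int : forall i, integer_poly (p i))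
    (p_indep : rationally_independent p)
    (p_0 : forall i, (p i).[0] = 0)
    (delta epsilon : R) (delta_gt0 : 0 < delta) (epsilon_gt0 : 0 < epsilon) :
  exists N0 : nat, forall N : nat, (N0 < N)%N ->
    forall L : {fset int},
      (forall x : int, x \in L -> 1 <= x <= N%:Z) ->
      delta * N%:R <= (#|` L|)%fset%:R ->
      exists n : nat, (0 < n)%N /\
        (1 - epsilon) * delta ^+ k.+1 * N%:R
          <= (#|` config_starts p L n|)%fset%:R.
Proof.
have [D D0 [q hq]] := integer_polys p_int p_0.
have q_0 i : (q i).[0] = 0.
  by apply/eqP; rewrite horner_coef0 -(intr_eq0 R) hq -horner_coef0 p_0 mulr0.
have DR : D%:R != 0 :> R by rewrite pnatr_eq0 -lt0n.
have q_indep (c : 'I_k -> int) : \sum_i c i *: q i = 0 -> forall i, c i = 0.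
  move=> hc i; apply/eqP; apply: contraT => ci.
  have [] := p_indep c (ex_intro _ i ci) 0.
  apply/polyP => j; rewrite coefC if_same coef_sum.
  apply: (mulfI (expf_neq0 j DR)); rewrite mulr0 mulr_sumr.
  have := congr1 (fun r : {poly int} => (r`_j)%:~R : R) hc.
  rewrite /= coef0 coef_sum rmorph_sum => hj; apply: etrans hj; apply: eq_bigr => l _.
  rewrite coefZ rmorphM /= hq [RHS]mulrCA; congr (_ * _).
  by rewrite -[LHS]/(coefp j (p l *~ c l)) raddfMz -mulrzl.
pose qs := [seq q i | i <- enum 'I_k].
have q_inj : injective q.
  move=> i j qij; apply/eqP; apply: contraT => ij.
  have := q_indep (fun l => (l == i)%:R - (l == j)%:R) _ i; rewrite eqxx (negbTE ij) => h.
  suff /h : \sum_l ((l == i)%:R - (l == j)%:R) *: q l = 0 :> {poly int} by [].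
  rewrite (bigD1 i) //= (bigD1 j) //= ?[j == i]eq_sym ?(negbTE ij) // !eqxx.
  rewrite subr0 sub0r scale1r scaleN1r -qij big1 ?addr0 ?subrr // => l /andP[/negbTE-> /negbTE->].
  by rewrite subrr scale0r.
have qs_indep : indep qs.
  split=> [|c]; first by rewrite map_inj_uniq ?enum_uniq.
  rewrite big_map big_enum /= => hc r /mapP[i _ ->].
  exact: (q_indep (fun i => c (q i))).
have q_val i (n : nat) : int_value (p i) (D * n)%N%:Z = (q i).[n%:Z].
  rewrite /int_value; set d := maxn (size (p i)) (size (q i)).
  have -> : (p i).[((D * n)%N%:Z)%:~R] = ((q i).[n%:Z])%:~R; last exact: intrKfloor.
  rewrite (@horner_coef_wide _ d) ?leq_maxl // (@horner_coef_wide _ d) ?leq_maxr //.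
  rewrite rmorph_sum; apply: eq_bigr => j _.
  transitivity (D%:R ^+ j * (p i)`_j * n%:R ^+ j : R).
    by rewrite -pmulrn natrM exprMn; ring.
  by rewrite /= intrM hq rmorphXn /= -pmulrn.
apply/not_existsP => hn.
have {}hn j : exists NL : nat * {fset int}, [/\ (j < NL.1)%N,
    forall x : int, x \in NL.2 -> 1 <= x <= NL.1%:Z, delta * NL.1%:R <= (#|` NL.2|)%fset%:R &
    forall n, (0 < n)%N -> (#|` config_starts p NL.2 n|)%fset%:R < (1 - epsilon) * delta ^+ k.+1 * NL.1%:R].
  apply/not_existsP => h; apply: (hn j) => N jN L hL dL; apply/not_existsP => h2.
  apply: (h (N, L)); split=> // n n0; rewrite ltNge; apply/negP => h3.
  by apply: (h2 n).
have {hn} [NL hNL] := choice hn; pose N j := (NL j).1.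
have ltN j : (j < N j)%N by have [] := hNL j.
have NR j : 0 < (N j)%:R :> R by rewrite ltr0n (leq_trans _ (ltN j)).
pose S := interval_system R ltN.
pose f (z : nat * int) : R := (z.2 \in (NL z.1).2)%:R.
have f01 z : 0 <= f z <= 1 by rewrite /f; case: (_ \in _); rewrite ?ler01 ?lexx.
have mf : delta <= smean S f.
  rewrite [leRHS]interval_meanE //; apply: (LIM_ge (N := 0)).
    by exists 1 => j; apply: le_trans (av_norm _ _) _; apply: av_le => [|i _]; [rewrite (leq_trans _ (ltN j))|rewrite /f normr_nat lern1 leq_b1].
  move=> j _; have [_ h1 h2 _] := hNL j; apply: (@le_trans _ _ ((#|` (NL j).2|)%fset%:R / (N j)%:R)).
    by rewrite ler_pdivlMr.
  by rewrite le_eqVlt -(av_fset R h1) eqxx.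
have e0 : 0 < epsilon * delta ^+ k.+1 / 2 by rewrite divr_gt0 // mulr_gt0 ?exprn_gt0.
have [r rqs|n [n0 hr]] := polynomial_recurrence (S := S) f01 qs_indep _ e0.
  by move: rqs => /mapP[i _ ->].
have sqs : size qs = k by rewrite size_map size_enum_ord.
have hle : smean S (fun x => f x * \prod_(p <- qs) f (act p.[n%:Z] x)) <= (1 - epsilon) * delta ^+ k.+1.
  have fE j x : f (j, x) * \prod_(r <- qs) f (act r.[n%:Z] ((j, x) : S)) =
      (x \in config_starts p (NL j).2 (D * n))%:R.
    rewrite big_map big_enum /= !inE /f /=.
    case: (x \in _) => /=; last by rewrite mul0r.
    rewrite mul1r; case: (boolP [forall i, _]) => [/forallP h|].
      by rewrite big1 // => i _; have := h i; rewrite q_val => ->.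
    rewrite negb_forall => /existsP[l]; rewrite q_val => /negbTE hl.
    by rewrite (bigD1 l) //= hl mul0r.
  rewrite [leLHS]interval_meanE //; apply: (LIM_le (N := 0)).
    exists 1 => j; apply: le_trans (av_norm _ _) _; apply: av_le => [|i _]; first by rewrite (leq_trans _ (ltN j)).
    by rewrite fE normr_nat lern1 leq_b1.
  move=> j _; have [_ h1 _ h2] := hNL j.
  rewrite (eq_av (d := fun i => (i.+1%:Z \in config_starts p (NL j).2 (D * n))%:R)) => [|i _]; last exact: fE.
  rewrite av_fset => [|x]; last by rewrite !inE => /andP[/h1].
  by rewrite ler_pdivrMr // ltW // h2 // muln_gt0 D0.
have hp : delta ^+ k.+1 <= smean S f ^+ k.+1.
  by rewrite lerXn2r ?nnegrE ?(ltW delta_gt0) // (le_trans (ltW delta_gt0)).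
have dk : 0 < epsilon * delta ^+ k.+1 by rewrite mulr_gt0 ?exprn_gt0.
move: hr; rewrite sqs => hr; move: hle hr hp dk e0; move: (smean S _) (smean S f ^+ _) (delta ^+ _) => a b c; lra.
Qed.
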